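(* Fix $1<p<\infty$. There is a constant $C=C_p\in\mathbb{N}$, depending only on $p$, such that for every $f\in L^p(\mathbb{T})$ with $\|f\|_p\le 1$ and every $n\in\mathbb{N}$, writing $\mu=\mu^{(p)}_f$, $\sigma=\sigma^{(p)}_f$, $\varphi=\varphi^{(p)}_f$: (a) $\varphi(n)\le \mu(n+C)+n+C$; (b) $\mu(n)\le 2\varphi(n+C)+n+C$; (c) $\sigma(n)\le \mu(n+C)$; (d) $\mu(n)\le \sigma(n+C)+pn+C$.
   Context: $\mathbb{T}=[0,1)\bmod 1$ is the unit interval with wraparound, with Lebesgue measure; $L^p(\mathbb{T})$ is the space of (classes of) measurable $p$-integrable complex functions on $\mathbb{T}$ with $\|f\|_p=(\int_0^1|f(t)|^p\,dt)^{1/p}$. For $\delta\in\mathbb{R}$, $(\tau_\delta f)(t):=f(t+\delta\bmod 1)$. $L^p$-modulus: $\mu^{(p)}_f(n)$ is the least $m\in\mathbb{N}$ such that $\|f-\tau_\delta f\|_p\le 2^{-n}$ for all $|\delta|\le 2^{-m}$. Step rate: for $K\ge1$, $\mathcal{S}_K(\mathbb{T})$ is the space of complex functions constant on each interval $[k/K,(k+1)/K)$, $0\le k<K$; $\sigma^{(p)}_f(n)$ is the least $s\in\mathbb{N}$ such that some $g\in\mathcal{S}_{2^s}(\mathbb{T})$ satisfies $\|f-g\|_p\le 2^{-n}$. Fourier rate: $\hat f_k=\int_0^1 f(t)e^{-2\pi ikt}\,dt$ for $k\in\mathbb{Z}$, $\mathcal{F}_Kf(t)=\sum_{|k|\le K}\hat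 f_k e^{2\pi ikt}$; $\varphi^{(p)}_f(n)$ is the least $m\in\mathbb{N}$ such that $\|f-\mathcal{F}_{2^m}f\|_p\le 2^{-n}$. *)

(* Defs.v *)
From HB Require Import structures.
From mathcomp Require Import all_boot all_order all_algebra.
From mathcomp Require Import all_classical all_reals all_analysis.
From mathcomp Require Import complex.
Set Implicit Arguments. Unset Strict Implicit. Unset Printing Implicit Defensive.
Import Order.TTheory GRing.Theory Num.Theory.
Import numFieldNormedType.Exports.
Local Open Scope classical_set_scope.
Local Open Scope ring_scope.

Section Torus.
Variable R : realType.

(* Complex numbers are R[i]; a function on T is a map R -> R[i], only
   its values on [0,1) matter. *)
Definition cabs (z : R[i]) : R := ComplexField.Normc.normc z.

Definition modT (t : R) : R := t - (Num.floor t)%:~R.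

Definition tau (d : R) (f : R -> R[i]) : R -> R[i] := fun t => f (modT (t + d)).

Definition Tdom : set R := `[0%R, 1%R[.

Definition Lpnorm (p : R) (g : R -> R[i]) : \bar R :=
  ((\int[@lebesgue_measure R]_(t in Tdom) ((cabs (g t)) `^ p)%:E) `^ p^-1)%E.

Definition cmeasurable (f : R -> R[i]) : Prop :=
  measurable_fun Tdom (fun t => @complex.Re R (f t)) /\ measurable_fun Tdom (fun t => @complex.Im R (f t)).

(* the least natural number satisfying P (0 if none exists) *)
Definition least (P : nat -> Prop) : nat :=
  xget 0%N [set m | P m /\ forall k, P k -> (m <= k)%N].

Definition pow2n (n : nat) : R := (2 ^- n)%R.

Definition Lp_modulus (p : R) (f : R -> R[i]) (n : nat) : nat :=
  least (fun m => forall d : R, `|d| <= pow2n m ->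
     (Lpnorm p (fun t => (f t - tau d f t)%R) <= (pow2n n)%:E)%E).

Definition is_step (K : nat) (g : R -> R[i]) : Prop :=
  exists c : 'I_K -> R[i], forall (k : 'I_K) (t : R),
    (k%:R / K%:R <= t) -> (t < k.+1%:R / K%:R) -> g t = c k.

Definition Lp_steprate (p : R) (f : R -> R[i]) (n : nat) : nat :=
  least (fun s => exists g, is_step (2 ^ s)%N g /\
     (Lpnorm p (fun t => (f t - g t)%R) <= (pow2n n)%:E)%E).

Definition expi (th : R) : R[i] := (cos th +i* sin th)%C.

Definition fourier_coef (f : R -> R[i]) (k : int) : R[i] :=
  let h := fun t => f t * expi (- (2 * pi * k%:~R * t)) in
  (Rintegral (@lebesgue_measure R) Tdom (fun t => @complex.Re R (h t)) +i*
   Rintegral (@lebesgue_measure R) Tdom (fun t => @complex.Im R (h t)))%C.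

Definition fourier_partial (K : nat) (f : R -> R[i]) : R -> R[i] :=
  fun t => \sum_(i < (K + K).+1)
     (let k : int := (i%:Z - K%:Z)%R in fourier_coef f k * expi (2 * pi * k%:~R * t)).

Definition Lp_fourierrate (p : R) (f : R -> R[i]) (n : nat) : nat :=
  least (fun m =>
     (Lpnorm p (fun t => (f t - fourier_partial (2 ^ m)%N f t)%R) <= (pow2n n)%:E)%E).

End Torus.

(* Main.v *)
(* Let F be the periodization of f and let w = 2^(-np).  All estimates bound
   integrals of |.|^p, so that constants are absorbed by the shift n + C.

   (c) Sampling F at t |-> (left end of the cell of t) + d and averaging over d
   in one cell bounds the p-th power of the error by the translation modulus at
   scale 2^-s, so some d yields a good step function.
   (d) A step function g on cells of length 2^-s changes under translation by d
   only on a set meeting every cell in a proportion 2^s |d|, so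
   ||g - tau_d g||_p^p <= const 2^s |d| ||g||_p^p; this is the source of the
   summand pn.
   (b) The partial sum of order K is Lipschitz with constant const K^2, because
   the Fourier coefficients of F are bounded.
   (a) For h = 2^-m the Fejer mean of order N is within the modulus at scale h,
   up to the mass const / (N h) of the Fejer kernel at distance at least h
   from 0; N = 2^(m+n+C) makes that mass negligible.  Partial sums of order N
   fix Fejer means of order N, and they are bounded on L^p (M. Riesz).

   M. Riesz' theorem: let P be a polynomial, u = Re P > 0 and v = Im P on the
   unit circle, P(0) = a >= 0.  For s > 0 the mean of P^2 / (P + s) is
   a^2 / (a + s) >= 0; its real part compares the integral of
   s v^2 / ((u + s)^2 + v^2) with an integral controlled by u.  Multiplying by
   s^(p-1) and summing over dyadic s gives ||v||_p <= C ||u||_p for 1 < p < 2.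
   The case p = 2 follows from the mean of P^2, and p > 2 by duality.  Finally,
   the modulus of translation is finite because continuous functions are dense
   in L^p. *)

Require Import Defs.
From HB Require Import structures.
From mathcomp Require Import all_boot all_order all_algebra.
From mathcomp Require Import all_classical all_reals all_analysis.
From mathcomp Require Import complex.
From mathcomp Require Import measurable_realfun.
From mathcomp Require Import zify ring lra.
Set Implicit Arguments.
Unset Strict Implicit.
Unset Printing Implicit Defensive.
Import Order.TTheory GRing.Theory Num.Theory.
Import numFieldNormedType.Exports.
Local Open Scope classical_set_scope.
Local Open Scope ring_scope.

(** * Integration on the circle *)

(** The rates are values of [least], which returns 0 when no witness exists, so their inequalities
    need witnesses. Continuity of translation in L^p supplies them for the modulus, and the
    estimates behind (a) and (c) turn them into witnesses for the Fourier and step rates.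

    Bounds are carried by [Jp], the p-th power of the norm, with [JpD] and its factor 2^p in place
    of the triangle inequality. A loss A depending only on p costs a shift C with A 2^-C <= 1.

    Riesz' theorem is proved without complex powers or contour integrals: P^2 / (P + s) is rational
    in P, and its mean needs only the means of a polynomial and of 1 / (P + s). The weight s^(p-1)
    recovers |v|^p because the sum of s^a x^2 / (s^2 + x^2) over dyadic s is at most a multiple of
    x^a when 0 < a < 2; the exponents a = p and a = p - 1 both occur, whence the range 1 < p < 2.
    The comparison leaves half of the integral of |v|^p on the right, and subtracting it is
    legitimate because polynomials are bounded on the circle. *)

Section CircleMeasure.
Variable R : realType.
Implicit Types (t d : R).
Local Notation mu := (@lebesgue_measure R).

Lemma modT_ge0 t : 0 <= modT t.
Proof. by rewrite /modT subr_ge0 floor_le. Qed.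

Lemma modT_lt1 t : modT t < 1.
Proof. by rewrite /modT ltrBlDl; have := floorD1_gt t; rewrite intrD. Qed.

Lemma modT_dom t : Tdom (modT t).
Proof. by rewrite /Tdom/= in_itv/= modT_ge0 modT_lt1. Qed.

Lemma modT_id t : Tdom t -> modT t = t.
Proof.
rewrite /Tdom/= in_itv/= => /andP[t0 t1]; rewrite /modT.
by rewrite (@floor_def _ t 0) ?subr0// t0 add0r.
Qed.

Lemma modTDz t (k : int) : modT (t + k%:~R) = modT t.
Proof. by rewrite /modT floorDrz ?intr_int// intrKfloor intrD opprD addrACA subrr addr0. Qed.

Lemma modTDl t d : modT (modT t + d) = modT (t + d).
Proof.
rewrite {2}/modT (_ : t - _ + d = t + d + (- Num.floor t)%:~R) ?modTDz//.
by rewrite intrN addrAC.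
Qed.

Lemma measurable_Tdom : measurable (@Tdom R).
Proof. exact: measurable_itv. Qed.

Lemma lebesgue_Tdom : mu (@Tdom R) = 1%E.
Proof. by rewrite /Tdom lebesgue_measure_itv/= lte_fin ltr01 oppr0 adde0. Qed.

Lemma measurable_modT : measurable_fun setT (@modT R).
Proof.
apply: measurable_funB => //.
apply: nondecreasing_measurable => // x y xy.
by rewrite ler_int le_floor.
Qed.

(* Lebesgue measure of [0, 1) as a probability measure on the whole line:
   functions on the circle are treated as functions on R satisfying [per]. *)
Definition muT : set (measurableTypeR R) -> \bar R :=
  mrestr mu measurable_Tdom.

HB.instance Definition _ := Measure.on muT.

Let muT_setT : muT setT = 1%E.
Proof. by rewrite /muT /mrestr setTI lebesgue_Tdom. Qed.

HB.instance Definition _ := Measure_isProbability.Build _ _ _ muT muT_setT.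

Lemma integral_muT (f : R -> \bar R) : measurable_fun setT f ->
  (\int[muT]_t f t = \int[mu]_(t in @Tdom R) f t)%E.
Proof.
move=> mf.
have mE : (\int[mu]_(t in @Tdom R) f t = \int[muT]_(t in @Tdom R) f t)%E.
  by apply: eq_measure_integral => A mA AT; rewrite /= /muT /mrestr /= setIidl.
rewrite mE [RHS]integral_mkcond; apply: ae_eq_integral => //.
  by apply: (proj1 (measurable_restrictT f measurable_Tdom)); exact: measurable_funTS.
exists (~` (@Tdom R)); split.
- apply: measurableC; exact: measurable_Tdom.
- by rewrite /= /muT /mrestr /= setICl measure0.
- move=> t /= tf tT; apply: tf => _.
  by rewrite patchE mem_set.
Qed.

Let shift_by d : measurableTypeR R -> measurableTypeR R := fun t => t + d.

Let measurable_shift_by d : measurable_fun setT (shift_by d).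
Proof. exact: measurable_funD. Qed.

HB.instance Definition _ d :=
  isMeasurableFun.Build _ _ _ _ (shift_by d) (measurable_shift_by d).

Let lebesgue_shift d (A : set R) : measurable A ->
  pushforward mu (shift_by d) A = mu A.
Proof.
move=> mA; apply/esym/lebesgue_measure_unique => //= _ [[a b]] _ <-.
rewrite /pushforward (_ : _ @^-1` _ = `]a - d, b - d]%classic); last first.
  by apply/seteqP; split => x /=; rewrite !in_itv/= ltrBlDr lerBrDr.
by rewrite !lebesgue_measure_itv/= !lte_fin ltrD2r -!EFinB opprB addrA subrK.
Qed.

Lemma ge0_integral_shift d (D : set R) (f : R -> \bar R) : measurable D ->
  measurable_fun setT f -> (forall t, 0 <= f t)%E ->
  (\int[mu]_(t in (fun t => t + d)%R @^-1` D) f (t + d)%R =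
   \int[mu]_(t in D) f t)%E.
Proof.
move=> mD mf f0.
rewrite -(@ge0_integral_pushforward _ _ _ _ R _ (@measurable_shift_by d) mu D f)//.
  by apply: eq_measure_integral => A mA _; exact: lebesgue_shift.
exact: measurable_funTS.
Qed.

Definition per {V : Type} (f : R -> V) := forall t, f (modT t) = f t.

Lemma perDz V (f : R -> V) t (k : int) : per f -> f (t + k%:~R) = f t.
Proof. by move=> pf; rewrite -pf modTDz pf. Qed.

Lemma measurable_shift disp (V : measurableType disp) (f : R -> V) d :
  measurable_fun setT f -> measurable_fun setT (fun t => f (t + d)).
Proof. by move=> mf; apply: (measurableT_comp mf); exact: measurable_funD. Qed.

(** By periodicity d may be taken in [0, 1). Cutting [0, 1) at 1 - d, the translation by d moves the
    left piece to [d, 1) and, modulo 1, the right piece to [0, d). *)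
Lemma ge0_integralT_shift d (f : R -> \bar R) :
  measurable_fun setT f -> (forall t, 0 <= f t)%E -> per f ->
  (\int[muT]_t f (t + d)%R = \int[muT]_t f t)%E.
Proof.
move=> mf f0 pf.
wlog dT : d / 0 <= d < 1 => [hw|].
  rewrite -(hw (modT d)) ?modT_ge0 ?modT_lt1//; apply: eq_integral => t _.
  by rewrite -[LHS]pf -[RHS]pf [(t + modT d)%R]addrC modTDl addrC.
move: dT => /andP[d0 d1].
rewrite !integral_muT//; last exact: measurable_shift.
have split_itv (a b c : R) (g : R -> \bar R) : a <= b <= c ->
    measurable_fun setT g -> (forall t, 0 <= g t)%E ->
    (\int[mu]_(t in `[a, c[) g t =
     \int[mu]_(t in `[a, b[) g t + \int[mu]_(t in `[b, c[) g t)%E.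
  move=> /andP[ab bc] mg g0.
  rewrite -ge0_integral_setU//.
  - by rewrite -itv_bndbnd_setU// bnd_simp.
  - exact: measurable_funTS.
  - by apply: lt_disjoint => x y; rewrite !in_itv/= => /andP[_ xb] /andP[+ _]; exact: lt_le_trans.
pose c : R := 1 - d.
have E1 : (\int[mu]_(t in `[0%R, c[) f (t + d)%R = \int[mu]_(t in `[d, 1%R[) f t)%E.
  rewrite -[RHS](@ge0_integral_shift d)//.
  rewrite (_ : _ @^-1` _ = `[0, c[%classic)//.
  by apply/seteqP; split => x /=; rewrite !in_itv/= ltrBrDr lerDr.
have E2 : (\int[mu]_(t in `[c, 1%R[) f (t + d)%R = \int[mu]_(t in `[0%R, d[) f t)%E.
  rewrite -[RHS](@ge0_integral_shift (d - 1))//.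
  rewrite (_ : _ @^-1` _ = `[c, 1[%classic).
    apply: eq_integral => x _.
    by rewrite -(@perDz _ _ (x + (d - 1)) 1)//= addrA subrK.
  by apply/seteqP; split => x /=; rewrite !in_itv/= /c => /andP[h1 h2];
    apply/andP; split; lra.
rewrite (@split_itv 0 c 1); last 3 first.
- by apply/andP; split; rewrite /c; lra.
- exact: measurable_shift.
- by [].
rewrite E1 E2 addeC -split_itv//; apply/andP; split => //; exact: ltW.
Qed.

End CircleMeasure.

(** * Minkowski's inequality for integral kernels *)

Section KernelBound.
Variable R : realType.
Implicit Types (p q W B : R).
Local Notation muT := (@muT R).

Lemma measurable_powRT p (f : R -> R) : measurable_fun setT f ->
  measurable_fun setT (fun t => f t `^ p).
Proof. by move=> mf; apply: (measurableT_comp (measurable_powR _)). Qed.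

(** Hölder's inequality for the factors g k^(1/p) and k^(1/q); W^(p-1) is the p-th power of the
    bound W^(1/q) on the norm of the second. *)
Lemma hoelder_kernel p W (g k : R -> R) (F : R) : 1 < p -> 0 <= W -> 0 <= F ->
  measurable_fun setT g -> measurable_fun setT k ->
  (forall d, 0 <= g d) -> (forall d, 0 <= k d) ->
  (\int[muT]_d (k d)%:E <= W%:E)%E ->
  (F%:E <= \int[muT]_d (g d * k d)%:E)%E ->
  ((F `^ p)%:E <= (W `^ (p - 1))%:E * \int[muT]_d (g d `^ p * k d)%:E)%E.
Proof.
move=> p1 W0 F0 mg mk g0 k0 kW Fgk.
have p0 : 0 < p by lra.
have q0 : 0 < p / (p - 1) by apply: divr_gt0; lra.
set q := p / (p - 1) in q0.
have pq : p^-1 + q^-1 = 1 by rewrite /q; field; lra.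
pose u d := g d * k d `^ p^-1; pose v d := k d `^ q^-1.
have uv d : u d * v d = g d * k d.
  rewrite /u /v -mulrA -powRD ?pq ?oner_eq0// powRr1//.
have mu' : measurable_fun setT u.
  by apply: measurable_funM => //; exact: measurable_powRT.
have mv : measurable_fun setT v by exact: measurable_powRT.
have := hoelder muT mu' mv p0 q0 pq.
set A := (Lnorm _ _ _); set U := (Lnorm _ _ _); set V := (Lnorm _ _ _) => AUV.
have U0 : (0 <= U)%E by exact: Lnorm_ge0.
have V0 : (0 <= V)%E by exact: Lnorm_ge0.
have FA : (F%:E <= U * V)%E.
  apply: le_trans AUV; apply: (le_trans Fgk); rewrite /A Lnorm1 le_eqVlt.
  apply/orP; left; apply/eqP; apply: eq_integral => d _ /=.
  by rewrite uv ger0_norm// mulr_ge0.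
have UE : (U `^ p = \int[muT]_d (g d `^ p * k d)%:E)%E.
  rewrite /U poweR_Lnorm ?gt_eqF//; apply: eq_integral => d _ /=.
  rewrite ger0_norm ?mulr_ge0 ?powR_ge0// /u powRM ?powR_ge0//.
  by rewrite -powRrM mulVf ?gt_eqF// powRr1.
have VE : (V `^ p <= (W `^ (p - 1))%:E)%E.
  have -> : p = q * (p - 1) by rewrite /q; field; lra.
  rewrite poweRrM -poweR_EFin (_ : q * (p - 1) - 1 = p - 1); last first.
    by rewrite /q; field; lra.
  apply: gt0_ler_poweR; rewrite ?in_itv/= ?leey ?andbT ?poweR_ge0//; first lra.
  rewrite /V poweR_Lnorm ?gt_eqF//; apply: le_trans kW.
  rewrite le_eqVlt; apply/orP; left; apply/eqP; apply: eq_integral => d _ /=.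
  by rewrite ger0_norm ?powR_ge0// -powRrM mulVf ?gt_eqF// powRr1.
rewrite -poweR_EFin -UE muleC.
apply: (@le_trans _ _ ((U * V) `^ p)%E).
  by apply: gt0_ler_poweR; rewrite ?in_itv/= ?leey ?andbT ?mule_ge0// ?ltW.
rewrite poweRM//; apply: lee_pmul => //; exact: poweR_ge0.
Qed.

(* Minkowski's integral inequality for convolution-like kernels. *)
Lemma kernel_bound p W B (G : R * R -> R) (k F : R -> R) :
  1 < p -> 0 <= W -> 0 <= B ->
  measurable_fun setT G -> measurable_fun setT k -> measurable_fun setT F ->
  (forall z, 0 <= G z) -> (forall d, 0 <= k d) -> (forall t, 0 <= F t) ->
  (\int[muT]_d (k d)%:E <= W%:E)%E ->
  (forall d, k d != 0 -> (\int[muT]_t (G (t, d) `^ p)%:E <= B%:E)%E) ->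
  (forall t, (F t)%:E <= \int[muT]_d (G (t, d) * k d)%:E)%E ->
  (\int[muT]_t (F t `^ p)%:E <= (W `^ p * B)%:E)%E.
Proof.
move=> p1 W0 B0 mG mk mF G0 k0 F0 kW GB FG.
have mG1 t : measurable_fun setT (fun d => G (t, d)).
  by apply: (measurableT_comp mG); exact: measurable_pair1.
have mGp : measurable_fun setT (fun z : R * R => G z `^ p).
  by apply: (measurableT_comp (measurable_powR _)).
have mGk : measurable_fun setT (fun z : R * R => (G z `^ p * k z.2)%:E).
  apply/measurable_EFinP; apply: measurable_funM => //.
  exact: (measurableT_comp mk).
have Gk0 z : (0 <= (G z `^ p * k z.2)%:E)%E by rewrite lee_fin mulr_ge0 ?powR_ge0.
apply: (@le_trans _ _ (\int[muT]_t ((W `^ (p - 1))%:E *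
    \int[muT]_d (G (t, d) `^ p * k d)%:E))%E).
  apply: ge0_le_integral => //.
  - by move=> t _; rewrite lee_fin powR_ge0.
  - by apply/measurable_EFinP; exact: measurable_powRT.
  - apply: measurable_funeM.
    exact: (@measurable_fun_fubini_tonelli_F _ _ _ _ R muT (fun z => (G z `^ p * k z.2)%:E)).
  - by move=> t _; apply: hoelder_kernel.
rewrite ge0_integralZl//; last 3 first.
- exact: (@measurable_fun_fubini_tonelli_F _ _ _ _ R muT (fun z => (G z `^ p * k z.2)%:E)).
- by move=> t _; apply: integral_ge0 => d _; exact: (Gk0 (t, d)).
- by rewrite lee_fin powR_ge0.
rewrite (@fubini_tonelli _ _ _ _ R muT muT (fun z => (G z `^ p * k z.2)%:E))//=.
(* Hölder costs W^(p-1); the last factor W is the mass of [k] left after exchanging the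
   integrals. *)
have -> : W `^ p = W `^ (p - 1) * W by rewrite mulrC mulr_powRB1//; lra.
rewrite -mulrA EFinM; apply: lee_wpmul2l; first by rewrite lee_fin powR_ge0.
apply: (@le_trans _ _ (\int[muT]_d ((k d)%:E * B%:E))%E).
  apply: ge0_le_integral => //.
  - by move=> d _; apply: integral_ge0 => t _; exact: (Gk0 (t, d)).
  - exact: (@measurable_fun_fubini_tonelli_G _ _ _ _ R muT (fun z => (G z `^ p * k z.2)%:E)).
  - by apply: emeasurable_funM => //; exact/measurable_EFinP.
  - move=> d _; under eq_integral do rewrite mulrC EFinM.
    rewrite ge0_integralZl//; last 3 first.
    + apply/measurable_EFinP; apply: measurable_powRT.
      by apply: (measurableT_comp mG); exact: measurable_pair2.
    + by move=> t _; rewrite lee_fin powR_ge0.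
    + by rewrite lee_fin.
    have [->|kd] := eqVneq (k d) 0; first by rewrite !mul0e.
    by apply: lee_wpmul2l; rewrite ?lee_fin//; exact: GB.
rewrite ge0_integralZr//.
- by rewrite EFinM; apply: lee_wpmul2r; rewrite ?lee_fin.
- exact/measurable_EFinP.
- by move=> d _; rewrite lee_fin.
Qed.

End KernelBound.

(** * Complex-valued functions *)

Section ComplexFunctions.
Variable R : realType.
Implicit Types (p q : R) (z w : R[i]) (f g : R -> R[i]).
Local Notation muT := (@muT R).
Local Notation Re := (@complex.Re R).
Local Notation Im := (@complex.Im R).

Lemma cabsE z : cabs z = Num.sqrt (Re z ^+ 2 + Im z ^+ 2).
Proof. by case: z. Qed.

Lemma sqr_cabs z : cabs z ^+ 2 = Re z ^+ 2 + Im z ^+ 2.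
Proof. by rewrite cabsE sqr_sqrtr// addr_ge0// sqr_ge0. Qed.

Lemma cabs_ge0 z : 0 <= cabs z.
Proof. by rewrite cabsE sqrtr_ge0. Qed.

Lemma cabsD z w : cabs (z + w) <= cabs z + cabs w.
Proof. exact: le_normcD. Qed.

Lemma cabsM z w : cabs (z * w) = cabs z * cabs w.
Proof. exact: Normc.normcM. Qed.

Lemma cabsN z : cabs (- z) = cabs z.
Proof. exact: normcN. Qed.

Lemma cabsB z w : cabs (z - w) <= cabs z + cabs w.
Proof. by rewrite -(cabsN w); exact: cabsD. Qed.

Lemma cabs0 : cabs (0 : R[i]) = 0.
Proof. exact: Normc.normc0. Qed.

Lemma cabs1 : cabs (1 : R[i]) = 1.
Proof. exact: Normc.normc1. Qed.

Lemma cabsV z : cabs z^-1 = (cabs z)^-1.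
Proof. exact: Normc.normcV. Qed.

Lemma cabsX z n : cabs (z ^+ n) = cabs z ^+ n.
Proof. by elim: n => [|n ih]; rewrite ?expr0 ?cabs1// !exprS cabsM ih. Qed.

Lemma cabs_eq0 z : cabs z = 0 -> z = 0.
Proof. exact: Normc.eq0_normc. Qed.

Lemma cabs_conj z : cabs (conjc z) = cabs z.
Proof. by case: z => a b; rewrite !cabsE /= sqrrN. Qed.

Lemma cabs_real (x : R) : cabs x%:C%C = `|x|.
Proof. by rewrite cabsE /= expr0n addr0 sqrtr_sqr. Qed.

Lemma ler_abs_Re z : `|Re z| <= cabs z.
Proof.
rewrite -sqrtr_sqr cabsE ler_sqrt ?lerDl ?sqr_ge0//.
by rewrite addr_ge0// sqr_ge0.
Qed.

Lemma ler_abs_Im z : `|Im z| <= cabs z.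
Proof.
rewrite -sqrtr_sqr cabsE ler_sqrt ?lerDr ?sqr_ge0//.
by rewrite addr_ge0// sqr_ge0.
Qed.

Lemma cabs_le_ReIm z : cabs z <= `|Re z| + `|Im z|.
Proof.
rewrite -(ler_pXn2r (ltn0Sn 1)) ?nnegrE ?cabs_ge0 ?addr_ge0// sqr_cabs.
rewrite sqrrD !real_normK ?num_real// -addrA lerD2l lerDr.
by rewrite mulrn_wge0// mulr_ge0.
Qed.

Lemma ReD z w : Re (z + w) = Re z + Re w. Proof. by case: z; case: w. Qed.
Lemma ImD z w : Im (z + w) = Im z + Im w. Proof. by case: z; case: w. Qed.
Lemma ReN z : Re (- z) = - Re z. Proof. by case: z. Qed.
Lemma ImN z : Im (- z) = - Im z. Proof. by case: z. Qed.
Lemma ReB z w : Re (z - w) = Re z - Re w. Proof. by case: z; case: w. Qed.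
Lemma ImB z w : Im (z - w) = Im z - Im w. Proof. by case: z; case: w. Qed.
Lemma ReM z w : Re (z * w) = Re z * Re w - Im z * Im w.
Proof. by case: z; case: w. Qed.
Lemma ImM z w : Im (z * w) = Re z * Im w + Im z * Re w.
Proof. by case: z => a b; case: w. Qed.
Lemma ReJ z : Re (conjc z) = Re z. Proof. by case: z. Qed.
Lemma ImJ z : Im (conjc z) = - Im z. Proof. by case: z. Qed.

Lemma conjcM z w : conjc (z * w) = conjc z * conjc w.
Proof. exact: rmorphM. Qed.

Lemma conjc_sum (I : Type) (s : seq I) (F : I -> R[i]) :
  conjc (\sum_(i <- s) F i) = \sum_(i <- s) conjc (F i).
Proof. exact: rmorph_sum. Qed.

Lemma complex_eq z w : Re z = Re w -> Im z = Im w -> z = w.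
Proof. by case: z; case: w => a b c d /= -> ->. Qed.

Lemma cabs_complex_sum z : z * conjc z = (cabs z ^+ 2)%:C%C.
Proof. by apply: complex_eq; rewrite ?ReM ?ImM ReJ ImJ sqr_cabs/=; ring. Qed.

Definition cmeas f := measurable_fun setT (fun t => Re (f t)) /\
  measurable_fun setT (fun t => Im (f t)).

Lemma cmeas_cst z : cmeas (fun=> z).
Proof. by split; exact: measurable_cst. Qed.

Lemma cmeasD f g : cmeas f -> cmeas g -> cmeas (fun t => f t + g t).
Proof.
move=> [f1 f2] [g1 g2]; split.
- by under eq_fun do rewrite ReD; exact: measurable_funD.
- by under eq_fun do rewrite ImD; exact: measurable_funD.
Qed.

Lemma cmeasB f g : cmeas f -> cmeas g -> cmeas (fun t => f t - g t).
Proof.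
move=> [f1 f2] [g1 g2]; split.
- by under eq_fun do rewrite ReB; exact: measurable_funB.
- by under eq_fun do rewrite ImB; exact: measurable_funB.
Qed.

Lemma cmeasM f g : cmeas f -> cmeas g -> cmeas (fun t => f t * g t).
Proof.
move=> [f1 f2] [g1 g2]; split.
- under eq_fun do rewrite ReM.
  by apply: measurable_funB; exact: measurable_funM.
- under eq_fun do rewrite ImM.
  by apply: measurable_funD; exact: measurable_funM.
Qed.

Lemma cmeas_conj f : cmeas f -> cmeas (fun t => conjc (f t)).
Proof.
move=> [f1 f2]; split.
- by under eq_fun do rewrite ReJ.
- by under eq_fun do rewrite ImJ; exact: measurableT_comp.
Qed.

Lemma cmeas_real (h : R -> R) : measurable_fun setT h ->
  cmeas (fun t => (h t)%:C%C).
Proof. by move=> mh; split => //; exact: measurable_cst. Qed.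

Lemma cmeas_sum (I : Type) (s : seq I) (F : I -> R -> R[i]) :
  (forall i, cmeas (F i)) -> cmeas (fun t => \sum_(i <- s) F i t).
Proof.
move=> mF; elim: s => [|i s ih].
  by under eq_fun do rewrite big_nil; exact: cmeas_cst.
by under eq_fun do rewrite big_cons; exact: cmeasD.
Qed.

Lemma cmeas_shift f d : cmeas f -> cmeas (fun t => f (t + d)).
Proof.
by move=> [f1 f2]; split; [exact: (measurable_shift d f1)|exact: (measurable_shift d f2)].
Qed.

Lemma measurable_cabs f : cmeas f -> measurable_fun setT (fun t => cabs (f t)).
Proof.
move=> [f1 f2]; under eq_fun do rewrite cabsE -powR12_sqrt ?addr_ge0 ?sqr_ge0// !expr2.
by apply: measurable_powRT; apply: measurable_funD; exact: measurable_funM.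
Qed.

(** The sum is at most twice the larger term. The constant is cruder than the one from convexity,
    but it is valid for every p >= 0. *)
Lemma powR_le2 p (x y : R) : 0 <= p -> 0 <= x -> 0 <= y ->
  (x + y) `^ p <= 2 `^ p * (x `^ p + y `^ p).
Proof.
move=> p0 x0 y0.
wlog xy : x y x0 y0 / x <= y => [hw|].
  by have [|/ltW] := leP x y => h; [exact: hw|rewrite addrC [X in _ * X]addrC; exact: hw].
apply: (@le_trans _ _ ((2 * y) `^ p)).
  apply: ge0_ler_powR => //; rewrite ?nnegrE ?addr_ge0 ?mulr_ge0//; lra.
by rewrite powRM// ler_wpM2l ?powR_ge0// lerDr powR_ge0.
Qed.

Definition Jp p f : \bar R := (\int[muT]_t (cabs (f t) `^ p)%:E)%E.

Lemma Jp_ge0 p f : (0 <= Jp p f)%E.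
Proof. by apply: integral_ge0 => t _; rewrite lee_fin powR_ge0. Qed.

Lemma measurable_cabs_powR p f : cmeas f ->
  measurable_fun setT (fun t => (cabs (f t) `^ p)%:E).
Proof.
move=> mf; apply/measurable_EFinP; apply: measurable_powRT.
exact: measurable_cabs.
Qed.

Lemma le_Jp p f g : 0 <= p -> cmeas f -> cmeas g ->
  (forall t, cabs (f t) <= cabs (g t)) -> (Jp p f <= Jp p g)%E.
Proof.
move=> p0 mf mg fg; apply: ge0_le_integral => //.
- by move=> t _; rewrite lee_fin powR_ge0.
- exact: measurable_cabs_powR.
- exact: measurable_cabs_powR.
- by move=> t _; rewrite lee_fin ge0_ler_powR// ?nnegrE ?cabs_ge0.
Qed.

Lemma eq_Jp p f g : (forall t, cabs (f t) = cabs (g t)) -> Jp p f = Jp p g.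
Proof. by move=> fg; apply: eq_integral => t _; rewrite fg. Qed.

Lemma JpM p f (c : R[i]) : 0 <= p -> cmeas f ->
  Jp p (fun t => c * f t) = ((cabs c `^ p)%:E * Jp p f)%E.
Proof.
move=> p0 mf; rewrite /Jp -ge0_integralZl//.
- by apply: eq_integral => t _; rewrite cabsM powRM ?cabs_ge0.
- exact: measurable_cabs_powR.
- by move=> t _; rewrite lee_fin powR_ge0.
- by rewrite lee_fin powR_ge0.
Qed.

Lemma JpD p f g : 0 <= p -> cmeas f -> cmeas g ->
  (Jp p (fun t => f t + g t)%R <= (2 `^ p)%:E * (Jp p f + Jp p g))%E.
Proof.
move=> p0 mf mg; rewrite /Jp -ge0_integralD//; last 4 first.
- by move=> t _; rewrite lee_fin powR_ge0.
- exact: measurable_cabs_powR.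
- by move=> t _; rewrite lee_fin powR_ge0.
- exact: measurable_cabs_powR.
rewrite -ge0_integralZl//; last 2 first.
- by apply: emeasurable_funD; exact: measurable_cabs_powR.
- by move=> t _; rewrite -EFinD lee_fin addr_ge0// powR_ge0.
apply: ge0_le_integral => //.
- by move=> t _; rewrite lee_fin powR_ge0.
- by apply: measurable_cabs_powR; exact: cmeasD.
- apply: measurable_funeM.
  by apply: emeasurable_funD; exact: measurable_cabs_powR.
- move=> t _; rewrite -EFinD -EFinM lee_fin.
  apply: le_trans (powR_le2 _ _ _); rewrite ?cabs_ge0//.
  by apply: ge0_ler_powR; rewrite ?nnegrE ?addr_ge0 ?cabs_ge0// cabsD.
Qed.

Lemma JpB p f g : 0 <= p -> cmeas f -> cmeas g ->
  (Jp p (fun t => f t - g t)%R <= (2 `^ p)%:E * (Jp p f + Jp p g))%E.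
Proof.
move=> p0 mf mg.
have -> : Jp p g = Jp p (fun t => - g t) by apply: eq_Jp => t; rewrite cabsN.
apply: JpD => //; under eq_fun do rewrite -mulN1r.
by apply: cmeasM => //; exact: cmeas_cst.
Qed.

Lemma Jp_shift p f d : cmeas f -> per f -> Jp p (fun t => f (t + d)) = Jp p f.
Proof.
move=> mf pf.
rewrite /Jp (ge0_integralT_shift d (f := fun t => (cabs (f t) `^ p)%:E))//.
- exact: measurable_cabs_powR.
- by move=> t; rewrite lee_fin powR_ge0.
- by move=> t; rewrite pf.
Qed.

Lemma Jp_cst p z : Jp p (fun=> z) = (cabs z `^ p)%:E.
Proof. by rewrite /Jp integral_cst// [X in (_ * X)%E]probability_setT mule1. Qed.

Definition cint f := muT.-integrable setT (fun t => (Re (f t))%:E) /\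
  muT.-integrable setT (fun t => (Im (f t))%:E).

Definition Cint f : R[i] :=
  (Rintegral muT setT (fun t => Re (f t)) +i*
   Rintegral muT setT (fun t => Im (f t)))%C.

Lemma ReC f : Re (Cint f) = Rintegral muT setT (fun t => Re (f t)).
Proof. by []. Qed.

Lemma ImC f : Im (Cint f) = Rintegral muT setT (fun t => Im (f t)).
Proof. by []. Qed.

Lemma cintM z f : cint f -> cint (fun t => z * f t).
Proof.
move=> [i1 i2]; split.
- under eq_fun do rewrite ReM EFinB !EFinM.
  by apply: integrableB => //; exact: integrableZl.
- under eq_fun do rewrite ImM EFinD !EFinM.
  by apply: integrableD => //; exact: integrableZl.
Qed.

Lemma cintD f g : cint f -> cint g -> cint (fun t => f t + g t).
Proof.
move=> [f1 f2] [g1 g2]; split.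
- by under eq_fun do rewrite ReD EFinD; exact: integrableD.
- by under eq_fun do rewrite ImD EFinD; exact: integrableD.
Qed.

Lemma cint_sum (I : Type) (s : seq I) (F : I -> R -> R[i]) :
  (forall i, cint (F i)) -> cint (fun t => \sum_(i <- s) F i t).
Proof.
move=> iF; elim: s => [|i s ih].
  by under eq_fun do rewrite big_nil; split; apply: finite_measure_integrable_cst.
by under eq_fun do rewrite big_cons; exact: cintD.
Qed.

Lemma cintB f g : cint f -> cint g -> cint (fun t => f t - g t).
Proof.
move=> [f1 f2] [g1 g2]; split.
- by under eq_fun do rewrite ReB EFinB; exact: integrableB.
- by under eq_fun do rewrite ImB EFinB; exact: integrableB.
Qed.

Lemma cint_cst z : cint (fun=> z).
Proof. by split; apply: finite_measure_integrable_cst. Qed.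

Lemma cint_conj f : cint f -> cint (fun t => conjc (f t)).
Proof.
move=> [f1 f2]; split.
- by under eq_fun do rewrite ReJ.
- by under eq_fun do rewrite ImJ EFinN; exact: integrableN.
Qed.

Lemma CintM z f : cint f -> Cint (fun t => z * f t) = z * Cint f.
Proof.
move=> [i1 i2]; apply: complex_eq.
- rewrite ReM !ReC ImC; under eq_Rintegral do rewrite ReM.
  rewrite RintegralB//; first by rewrite !RintegralZl.
  + exact: (integrableZl measurableT (Re z) i1).
  + exact: (integrableZl measurableT (Im z) i2).
- rewrite ImM !ImC ReC; under eq_Rintegral do rewrite ImM.
  rewrite RintegralD//; first by rewrite !RintegralZl.
  + exact: (integrableZl measurableT (Re z) i2).
  + exact: (integrableZl measurableT (Im z) i1).
Qed.

Lemma CintD f g : cint f -> cint g -> Cint (fun t => f t + g t) = Cint f + Cint g.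
Proof.
move=> [f1 f2] [g1 g2]; apply: complex_eq.
- by rewrite ReD !ReC; under eq_Rintegral do rewrite ReD; exact: RintegralD.
- by rewrite ImD !ImC; under eq_Rintegral do rewrite ImD; exact: RintegralD.
Qed.

Lemma CintB f g : cint f -> cint g -> Cint (fun t => f t - g t) = Cint f - Cint g.
Proof.
move=> [f1 f2] [g1 g2]; apply: complex_eq.
- by rewrite ReB !ReC; under eq_Rintegral do rewrite ReB; exact: RintegralB.
- by rewrite ImB !ImC; under eq_Rintegral do rewrite ImB; exact: RintegralB.
Qed.

Lemma Cint_cst z : Cint (fun=> z) = z.
Proof.
apply: complex_eq; rewrite ?ReC ?ImC Rintegral_cst//.
  by rewrite [X in fine X]probability_setT mulr1.
by rewrite [X in fine X]probability_setT mulr1.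
Qed.

Lemma Cint_sum (I : Type) (s : seq I) (F : I -> R -> R[i]) :
  (forall i, cint (F i)) ->
  Cint (fun t => \sum_(i <- s) F i t) = \sum_(i <- s) Cint (F i).
Proof.
move=> iF; elim: s => [|i s ih].
  by rewrite big_nil; under eq_fun do rewrite big_nil; exact: Cint_cst.
rewrite big_cons; under eq_fun do rewrite big_cons.
by rewrite CintD ?ih//; exact: cint_sum.
Qed.

Lemma Cint_conj f : cint f -> Cint (fun t => conjc (f t)) = conjc (Cint f).
Proof.
move=> [f1 f2]; apply: complex_eq.
- by rewrite ReJ !ReC; apply: eq_Rintegral => t _; rewrite ReJ.
- rewrite ImJ !ImC -mulN1r -RintegralZl//.
  by apply: eq_Rintegral => t _; rewrite ImJ mulN1r.
Qed.

Lemma cint_cmeas f : cint f -> cmeas f.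
Proof. by move=> [/integrableP[/measurable_EFinP ? _] /integrableP[/measurable_EFinP ? _]]. Qed.

Lemma cintP f : cmeas f -> (\int[muT]_t (cabs (f t))%:E < +oo)%E -> cint f.
Proof.
move=> mf foo; have mc := measurable_cabs mf; case: mf => m1 m2.
split; apply/integrableP; split; try exact/measurable_EFinP;
  apply: le_lt_trans foo; apply: ge0_le_integral => //.
- by do 2 apply: measurableT_comp => //.
- exact/measurable_EFinP.
- by move=> t _; rewrite lee_fin ler_abs_Re.
- by do 2 apply: measurableT_comp => //.
- exact/measurable_EFinP.
- by move=> t _; rewrite lee_fin ler_abs_Im.
Qed.

Lemma cint_bounded f (M : R) : cmeas f -> (forall t, cabs (f t) <= M) -> cint f.
Proof.
move=> mf fM; apply: cintP => //.
apply: (@le_lt_trans _ _ (\int[muT]_t M%:E)%E); last first.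
  by rewrite integral_cst// [X in (_ * X)%E]probability_setT mule1 ltry.
apply: ge0_le_integral => //.
- by move=> t _; rewrite lee_fin cabs_ge0.
- by apply/measurable_EFinP; exact: measurable_cabs.
- by move=> t _; rewrite lee_fin.
Qed.

(** |f| <= 1 + |f|^p pointwise, and the circle has finite measure. *)
Lemma Jp_cint p f : 1 <= p -> cmeas f -> (Jp p f < +oo)%E -> cint f.
Proof.
move=> p1 mf foo; apply: cintP => //.
apply: (@le_lt_trans _ _ (\int[muT]_t (1%:E + (cabs (f t) `^ p)%:E))%E).
  apply: ge0_le_integral => //.
  - by move=> t _; rewrite lee_fin cabs_ge0.
  - by apply/measurable_EFinP; exact: measurable_cabs.
  - by apply: emeasurable_funD => //; exact: measurable_cabs_powR.
  - move=> t _; rewrite -EFinD lee_fin.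
    have [c1|c1] := leP (cabs (f t)) 1.
      by apply: (le_trans c1); rewrite lerDl powR_ge0.
    by apply: ler_wpDl => //; apply: le1r_powR => //; exact: ltW.
rewrite ge0_integralD//.
- by rewrite integral_cst// [X in (_ * X)%E]probability_setT mule1 lte_add_pinfty// ltry.
- by move=> t _; rewrite lee_fin powR_ge0.
- exact: measurable_cabs_powR.
Qed.

(** The real and imaginary parts are estimated separately, which costs the factor 2. *)
Lemma cabs_Cint f : cint f ->
  ((cabs (Cint f))%:E <= 2%:E * \int[muT]_t (cabs (f t))%:E)%E.
Proof.
move=> cf; have mf := cint_cmeas cf; case: cf => i1 i2.
have mc := measurable_cabs mf.
apply: (@le_trans _ _ (`|Re (Cint f)|%:E + `|Im (Cint f)|%:E)%E).
  by rewrite -EFinD lee_fin cabs_le_ReIm.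
rewrite (_ : 2%:E = 1 + 1)%E// ge0_muleDl// !mul1e ReC ImC.
apply: leeD; rewrite EFin_normr_Rintegral//; apply: (le_trans (le_abse_integral _ _ _)) => //.
- by apply/measurable_EFinP; case: mf.
- apply: ge0_le_integral => //.
  + by do 2 apply: measurableT_comp => //; case: mf.
  + exact/measurable_EFinP.
  + by move=> t _; rewrite lee_fin ler_abs_Re.
- by apply/measurable_EFinP; case: mf.
- apply: ge0_le_integral => //.
  + by do 2 apply: measurableT_comp => //; case: mf.
  + exact/measurable_EFinP.
  + by move=> t _; rewrite lee_fin ler_abs_Im.
Qed.

End ComplexFunctions.

(** * Trigonometric polynomials and mean values *)

Section Trigonometric.
Variable R : realType.
Implicit Types (p q : R) (z w : R[i]) (f g : R -> R[i]).
Local Notation muT := (@muT R).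
Local Notation Re := (@complex.Re R).
Local Notation Im := (@complex.Im R).

(** Reduces to [ge0_integralT_shift] for the positive and negative parts of the real and imaginary
    parts. *)
Lemma Cint_shift f d : cint f -> per f -> Cint (fun t => f (t + d)) = Cint f.
Proof.
move=> [i1 i2] pf.
have H (h : R -> R) : muT.-integrable setT (EFin \o h) -> per h ->
    Rintegral muT setT (fun t => h (t + d)) = Rintegral muT setT h.
  move=> ih ph; have /integrableP[mh _] := ih.
  rewrite /Rintegral integralE [in RHS]integralE; congr (fine (_ - _))%E.
  - rewrite -[RHS](@ge0_integralT_shift _ d)//; last first.
    + by move=> t; rewrite !funeposE ph.
    + exact: measurable_funepos.
    + by apply: eq_integral => t _; rewrite !funeposE.
  - rewrite -[RHS](@ge0_integralT_shift _ d)//; last first.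
    + by move=> t; rewrite !funenegE ph.
    + exact: measurable_funeneg.
    + by apply: eq_integral => t _; rewrite !funenegE.
apply: complex_eq; rewrite ?ReC ?ImC.
- by apply: (H (fun t => Re (f t))) => // t; rewrite pf.
- by apply: (H (fun t => Im (f t))) => // t; rewrite pf.
Qed.

Lemma cabs_Cint_le f (B : R) : cint f -> (forall t, cabs (f t) <= B) ->
  cabs (Cint f) <= 2 * B.
Proof.
move=> cf fB; rewrite -lee_fin; apply: le_trans (cabs_Cint cf) _.
rewrite EFinM; apply: lee_wpmul2l => //.
apply: (@le_trans _ _ (\int[muT]_t B%:E)%E).
  apply: ge0_le_integral => //.
  - by move=> t _; rewrite lee_fin cabs_ge0.
  - by apply/measurable_EFinP; apply: measurable_cabs; exact: cint_cmeas.
  - by move=> t _; rewrite lee_fin.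
by rewrite integral_cst// [X in (_ * X)%E]probability_setT mule1.
Qed.

Lemma expi0 : expi (0 : R) = 1.
Proof. by rewrite /expi cos0 sin0. Qed.

Lemma expiD (a b : R) : expi (a + b) = expi a * expi b.
Proof.
by rewrite /expi cosD sinD; apply: complex_eq => /=; rewrite addrC//.
Qed.

Lemma expiN (a : R) : expi (- a) = conjc (expi a).
Proof. by rewrite /expi cosN sinN. Qed.

Lemma cabs_expi (a : R) : cabs (expi a) = 1.
Proof. by rewrite cabsE /= cos2Dsin2 sqrtr1. Qed.

Lemma expi_int (k : int) : expi (2 * pi * k%:~R : R) = 1.
Proof.
have Hn n : expi (2 * pi * n%:R : R) = 1.
  elim: n => [|n ih]; first by rewrite mulr0 expi0.
  rewrite -[n.+1%:R]natr1 mulrDr mulr1 expiD ih mul1r /expi mulr_natl cos2pi sin2pi//.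
case: k => n; first exact: Hn.
by rewrite NegzE intrN mulrN -pmulrn expiN Hn conjc1.
Qed.

Definition Ek (k : int) (t : R) : R[i] := expi (2 * pi * k%:~R * t).

Lemma Ek0 t : Ek 0 t = 1.
Proof. by rewrite /Ek mulr0 mul0r expi0. Qed.

Lemma EkD k l t : Ek (k + l) t = Ek k t * Ek l t.
Proof. by rewrite /Ek intrD mulrDr mulrDl expiD. Qed.

Lemma EkN k t : Ek (- k) t = conjc (Ek k t).
Proof. by rewrite /Ek intrN mulrN mulNr expiN. Qed.

Lemma EkDt k t d : Ek k (t + d) = Ek k t * Ek k d.
Proof. by rewrite /Ek mulrDr expiD. Qed.

Lemma EkNt k t : Ek k (- t) = conjc (Ek k t).
Proof. by rewrite /Ek mulrN expiN. Qed.

Lemma cabs_Ek k t : cabs (Ek k t) = 1.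
Proof. exact: cabs_expi. Qed.

Lemma Ek_conj_mul k t : Ek k t * conjc (Ek k t) = 1.
Proof. by rewrite cabs_complex_sum cabs_Ek expr1n. Qed.

Lemma EkX (n : nat) t : Ek n t = Ek 1 t ^+ n.
Proof.
by elim: n => [|n ih]; rewrite ?expr0 ?Ek0// exprS -ih -EkD -PoszD add1n.
Qed.

Lemma per_Ek k : per (Ek k).
Proof.
move=> t; rewrite /modT EkDt EkNt {2}/Ek -[_ * _ * _]mulrA -intrM expi_int.
by rewrite conjc1 mulr1.
Qed.

Lemma cmeas_Ek k : cmeas (Ek k).
Proof.
have mt : measurable_fun setT (fun t : R => 2 * pi * k%:~R * t).
  exact: measurable_funM.
by split; apply: measurableT_comp mt; apply: continuous_measurable_fun;
  [exact: continuous_cos|exact: continuous_sin].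
Qed.

Lemma cint_Ek k : cint (Ek k).
Proof. by apply: (@cint_bounded _ _ 1); [exact: cmeas_Ek|move=> t; rewrite cabs_Ek]. Qed.

(** Translation by 1 / (2k), half a period, changes the sign of [Ek k] and preserves its mean, which
    therefore vanishes. *)
Lemma Cint_Ek k : Cint (Ek k) = (k == 0)%:R.
Proof.
have [->|k0] := eqVneq k 0.
  by rewrite (_ : Ek 0 = fun=> 1) ?Cint_cst//; apply/funext => t; rewrite Ek0.
have kR : k%:~R != 0 :> R by rewrite intr_eq0.
have := Cint_shift (1 / (2 * k%:~R)) (cint_Ek k) (per_Ek k).
under eq_fun do rewrite EkDt mulrC.
rewrite CintM; last exact: cint_Ek.
rewrite {1}/Ek (_ : 2 * pi * k%:~R * (1 / (2 * k%:~R)) = pi :> R); last by field.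
rewrite /expi cospi sinpi.
have -> : ((-1 : R) +i* 0)%C = -1 by apply: complex_eq => //=; rewrite oppr0.
rewrite mulN1r => /eqP; rewrite eq_sym -subr_eq0 opprK -mulr2n mulrn_eq0 /=.
by move/eqP.
Qed.

Lemma cint_cabs f : cint f -> (\int[muT]_t (cabs (f t))%:E < +oo)%E.
Proof.
move=> cf; have mf := cint_cmeas cf; case: cf => /integrableP[m1 i1] /integrableP[m2 i2].
apply: (@le_lt_trans _ _ (\int[muT]_t (`|(Re (f t))%:E| + `|(Im (f t))%:E|))%E).
  apply: ge0_le_integral => //.
  - by move=> t _; rewrite lee_fin cabs_ge0.
  - by apply/measurable_EFinP; exact: measurable_cabs.
  - by apply: emeasurable_funD; exact: measurableT_comp.
  - by move=> t _; rewrite -EFinD lee_fin cabs_le_ReIm.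
rewrite ge0_integralD//; first exact: lte_add_pinfty.
- exact: measurableT_comp.
- exact: measurableT_comp.
Qed.

Lemma cint_EkM k f : cint f -> cint (fun t => f t * Ek k t).
Proof.
move=> cf; apply: cintP; first by apply: cmeasM; [exact: cint_cmeas|exact: cmeas_Ek].
under eq_integral do rewrite cabsM cabs_Ek mulr1.
exact: cint_cabs.
Qed.

Lemma cint_shift f d : cint f -> per f -> cint (fun t => f (t + d)).
Proof.
move=> cf pf; have mf := cint_cmeas cf.
apply: cintP; first exact: cmeas_shift.
rewrite (@ge0_integralT_shift _ d (fun t => (cabs (f t))%:E)).
- exact: cint_cabs.
- by apply/measurable_EFinP; exact: measurable_cabs.
- by move=> t; rewrite lee_fin cabs_ge0.
- by move=> t; rewrite pf.
Qed.

Lemma fourier_coefE f k : cmeas f ->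
  fourier_coef f k = Cint (fun t => f t * Ek (- k) t).
Proof.
move=> mf; rewrite /fourier_coef /Cint /Rintegral.
have E t : f t * expi (- (2 * pi * k%:~R * t)) = f t * Ek (- k) t.
  by rewrite /Ek intrN mulrN mulNr.
have [m1 m2] : cmeas (fun t => f t * Ek (- k) t).
  by apply: cmeasM => //; exact: cmeas_Ek.
congr (Complex (fine _) (fine _)).
- rewrite -integral_muT; first by apply: eq_integral => t _; rewrite E.
  by apply/measurable_EFinP; under eq_fun do rewrite E.
- rewrite -integral_muT; first by apply: eq_integral => t _; rewrite E.
  by apply/measurable_EFinP; under eq_fun do rewrite E.
Qed.

Local Notation e1 := (Ek 1).

Lemma cmeas_horner (P : {poly R[i]}) : cmeas (fun t => P.[e1 t]).
Proof.
under eq_fun do rewrite horner_coef; apply: cmeas_sum => i.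
apply: cmeasM; first exact: cmeas_cst.
by under eq_fun do rewrite -EkX; exact: cmeas_Ek.
Qed.

Definition coef_sum (P : {poly R[i]}) : R := \sum_(i < size P) cabs P`_i.

Lemma cabs_sum (I : Type) (s : seq I) (F : I -> R[i]) :
  cabs (\sum_(i <- s) F i) <= \sum_(i <- s) cabs (F i).
Proof.
elim: s => [|i s ih]; first by rewrite !big_nil cabs0.
by rewrite !big_cons (le_trans (cabsD _ _))// lerD2l.
Qed.

Lemma cabs_horner (P : {poly R[i]}) t : cabs P.[e1 t] <= coef_sum P.
Proof.
rewrite horner_coef (le_trans (cabs_sum _ _))// ler_sum// => i _.
by rewrite cabsM -EkX cabs_Ek mulr1.
Qed.

Lemma cint_horner (P : {poly R[i]}) : cint (fun t => P.[e1 t]).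
Proof. by apply: (cint_bounded (cmeas_horner P)) => t; exact: cabs_horner. Qed.

(** Mean value property at the centre of the disc: every nonconstant monomial has mean 0. *)
Lemma Cint_horner (P : {poly R[i]}) : Cint (fun t => P.[e1 t]) = P.[0].
Proof.
have E t : P.[e1 t] = \sum_(i < size P) P`_i * Ek i t.
  by rewrite horner_coef; apply: eq_bigr => i _; rewrite -EkX.
under eq_fun do rewrite E.
rewrite Cint_sum; last by move=> i; apply: cintM; exact: cint_Ek.
rewrite horner_coef; apply: eq_bigr => i _.
by rewrite (CintM _ (cint_Ek i)) Cint_Ek expr0n.
Qed.

Lemma le0_expr_bound (x c th : R) : 0 <= th < 1 ->
  (forall n, x <= c * th ^+ n) -> x <= 0.
Proof.
move=> /andP[th0 th1] H.
have cv : (fun n => c * th ^+ n) @ \oo --> (0 : R).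
  rewrite -[X in _ --> X](mulr0 c); apply: cvgMr; apply: cvg_expr.
  by rewrite ger0_norm.
rewrite -(cvg_lim (@Rhausdorff R) cv); apply: limr_ge; first exact: cvgP cv.
exact: nearW.
Qed.

Lemma cmeasV f : cmeas f -> cmeas (fun t => (f t)^-1).
Proof.
move=> mf; have mc := measurable_cabs mf.
have ReV z : Re z^-1 = Re z * cabs z `^ (- 2%:R).
  by rewrite powR_invn ?cabs_ge0// sqr_cabs; case: z.
have ImV z : Im z^-1 = - Im z * cabs z `^ (- 2%:R).
  by rewrite powR_invn ?cabs_ge0// sqr_cabs; case: z => a b /=; rewrite mulNr.
case: mf => m1 m2; split.
- under eq_fun do rewrite ReV.
  by apply: measurable_funM => //; exact: measurable_powRT.
- under eq_fun do rewrite ImV.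
  by apply: measurable_funM; [exact: measurableT_comp|exact: measurable_powRT].
Qed.

(* The mean value property of 1 / H, by a Neumann series for H around a large
   positive constant. *)
Lemma Cint_horner_inv (H : {poly R[i]}) (eps : R) : 0 < eps ->
  (forall t, eps <= Re H.[e1 t]) -> Cint (fun t => (H.[e1 t])^-1) = H.[0]^-1.
Proof.
move=> eps0 He; set M := coef_sum H.
have HM t : cabs H.[e1 t] <= M by exact: cabs_horner.
have eH t : eps <= cabs H.[e1 t].
  by apply: le_trans (He t) _; apply: le_trans (ler_norm _) (ler_abs_Re _).
have eM : eps <= M by exact: le_trans (eH 0) (HM 0).
have M0 : 0 < M by exact: lt_le_trans eM.
(* With Re H >= eps and |H| <= M on the circle, |1 - H / rho|^2 = 1 - 2 Re H / rho + |H|^2 / rho^2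
   <= 1 - (eps / M)^2 = th^2. *)
pose rho := M ^+ 2 / eps; pose th := Num.sqrt (1 - (eps / M) ^+ 2).
have rho0 : 0 < rho by rewrite divr_gt0// exprn_gt0.
have q1 : 0 < (eps / M) ^+ 2 <= 1.
  by rewrite exprn_gt0 ?divr_gt0// expr_le1// ?ler_pdivrMr ?mul1r// divr_ge0 ?ltW.
have thb : 0 <= th < 1.
  rewrite sqrtr_ge0 -(sqrtr1 R) ltr_sqrt ?ltr01//; lra.
pose Z : {poly R[i]} := 1 - (rho^-1)%:C%C *: H.
have Zt t : Z.[e1 t] = 1 - (rho^-1)%:C%C * H.[e1 t].
  by rewrite !hornerE.
have Zth t : cabs Z.[e1 t] <= th.
  rewrite cabsE /th ler_sqrt; last by lra.
  rewrite Zt ReB ImB ReM ImM /= !mul0r subr0 addr0 sub0r sqrrN.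
  have := sqr_cabs H.[e1 t]; have := He t; have := HM t.
  have := cabs_ge0 H.[e1 t].
  set x := Re _; set y := Im _; set c := cabs _ => c0 cM ex cE.
  have -> : (1 - rho^-1 * x) ^+ 2 + (rho^-1 * y) ^+ 2 =
      1 - 2 * x / rho + c ^+ 2 / rho ^+ 2.
    by rewrite cE; field; rewrite gt_eqF.
  have h1 : 2 * (eps / M) ^+ 2 <= 2 * x / rho.
    rewrite (_ : 2 * (eps / M) ^+ 2 = 2 * eps / rho); last by rewrite /rho; field; rewrite !gt_eqF.
    by rewrite ler_pM2r ?invr_gt0// ler_pM2l.
  have h2 : c ^+ 2 / rho ^+ 2 <= (eps / M) ^+ 2.
    rewrite (_ : (eps / M) ^+ 2 = M ^+ 2 / rho ^+ 2); last by rewrite /rho; field; rewrite !gt_eqF.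
    by rewrite ler_pM2r ?invr_gt0 ?exprn_gt0// lerXn2r// nnegrE ltW.
  lra.
(* A partial sum of the Neumann series of 1 / H. It is a polynomial, so its mean is its value at 0,
   and the remainder Z^n / H is at most th^n / eps on the circle. *)
pose Q n : {poly R[i]} := (rho^-1)%:C%C *: \sum_(k < n) Z ^+ k.
have HQ n x : H.[x] * (Q n).[x] = 1 - Z.[x] ^+ n.
  have hH : H.[x] = rho%:C%C * (1 - Z.[x]).
    rewrite !hornerE opprB addrC subrK mulrA -[_ * _%:C%C]rmorphM/= mulfV ?gt_eqF//.
    by rewrite rmorph1 mul1r.
  rewrite /Q hornerZ horner_sum hH mulrACA -rmorphM/= mulfV ?gt_eqF// rmorph1 mul1r.
  under eq_bigr do rewrite horner_exp.
  by apply: oppr_inj; rewrite -mulNr !opprB -subrX1.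
have cV : cmeas (fun t => (H.[e1 t])^-1) by apply: cmeasV; exact: cmeas_horner.
have iZH n : cint (fun t => (Z ^+ n).[e1 t] / H.[e1 t]) /\
    cabs (Cint (fun t => (Z ^+ n).[e1 t] / H.[e1 t])) <= 2 * (th ^+ n / eps).
  have bd t : cabs ((Z ^+ n).[e1 t] / H.[e1 t]) <= th ^+ n / eps.
    rewrite cabsM cabsV horner_exp cabsX ler_pM ?exprn_ge0 ?invr_ge0 ?cabs_ge0//.
      by rewrite lerXn2r// nnegrE ?cabs_ge0//; case/andP: thb.
    by rewrite lef_pV2// posrE (lt_le_trans eps0).
  split; last apply: cabs_Cint_le => //;
    by apply: (cint_bounded _ bd); apply: cmeasM => //; exact: cmeas_horner.
(* The bound |Z| <= th is known on the circle only; the value of Z^n at 0 inherits it as the mean of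
   Z^n. *)
have Z0 n : cabs (Z.[0] ^+ n) <= 2 * th ^+ n.
  rewrite -horner_exp -Cint_horner; apply: cabs_Cint_le.
    by apply: cint_horner.
  move=> t; rewrite horner_exp cabsX lerXn2r// nnegrE ?cabs_ge0//.
  by case/andP: thb.
suff : H.[0] * Cint (fun t => (H.[e1 t])^-1) = 1.
  by move=> h; apply: (mulfI (_ : H.[0] != 0)); rewrite ?h ?mulfV//;
    apply/eqP => H0; move: h; rewrite H0 mul0r => /esym/eqP; rewrite oner_eq0.
apply/eqP; rewrite -subr_eq0; apply/eqP/cabs_eq0/le_anti.
rewrite cabs_ge0 andbT.
apply: (@le0_expr_bound _ (2 + cabs H.[0] * (2 / eps)) th) => // n.
have -> : (fun t => (H.[e1 t])^-1) =
    (fun t => (Q n).[e1 t] + (Z ^+ n).[e1 t] / H.[e1 t]).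
  apply/funext => t; have Hn0 : H.[e1 t] != 0.
    by apply/eqP => H0; have := eH t; rewrite H0 cabs0 leNgt eps0.
  apply: (mulfI Hn0); rewrite mulfV// mulrDr HQ horner_exp mulrCA mulfV// mulr1.
  by rewrite subrK.
rewrite CintD; [|exact: cint_horner|exact: (iZH n).1].
rewrite Cint_horner mulrDr HQ.
set C := Cint _; have -> : 1 - Z.[0] ^+ n + H.[0] * C - 1 = H.[0] * C - Z.[0] ^+ n by ring.
apply: le_trans (cabsB _ _) _; rewrite cabsM addrC mulrDl.
apply: lerD; first exact: Z0.
rewrite -mulrA ler_wpM2l ?cabs_ge0// (le_trans (iZH n).2)//.
by rewrite mulrA mulrAC.
Qed.

Lemma ReV z : Re z^-1 = Re z / (Re z ^+ 2 + Im z ^+ 2).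
Proof. by case: z. Qed.

Lemma ImV z : Im z^-1 = - Im z / (Re z ^+ 2 + Im z ^+ 2).
Proof. by case: z => a b /=; rewrite mulNr. Qed.

(* With z = u + i v, Re (z^2 / (z + s)) = resolvent_re s u v - resolvent_im s u v. *)
Definition resolvent_im (s u v : R) := s * v ^+ 2 / ((u + s) ^+ 2 + v ^+ 2).
Definition resolvent_re (s u v : R) :=
  (s * u ^+ 2 + u ^+ 3 + u * v ^+ 2) / ((u + s) ^+ 2 + v ^+ 2).

Lemma resolventE s z : 0 < s -> 0 < Re z ->
  Re (z ^+ 2 / (z + s%:C%C)) =
    resolvent_re s (Re z) (Im z) - resolvent_im s (Re z) (Im z).
Proof.
move=> s0 z0; rewrite expr2 ReM ReV ImV !ReM !ImM !ReD !ImD /= addr0.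
rewrite /resolvent_re /resolvent_im; field.
by rewrite gt_eqF// ltr_wpDr ?sqr_ge0// exprn_gt0// addr_gt0.
Qed.

Lemma measurable_resolvent s (u v : R -> R) : 0 < s ->
  (forall t, 0 < u t) -> measurable_fun setT u -> measurable_fun setT v ->
  measurable_fun setT (fun t => resolvent_im s (u t) (v t)) /\
  measurable_fun setT (fun t => resolvent_re s (u t) (v t)).
Proof.
move=> s0 u0 mu mv.
have mX (h : R -> R) n : measurable_fun setT h -> measurable_fun setT (fun t => h t ^+ n).
  by move=> mh; exact: (measurableT_comp (exprn_measurable n)).
have md : measurable_fun setT (fun t => ((u t + s) ^+ 2 + v t ^+ 2)^-1).
  have E t : ((u t + s) ^+ 2 + v t ^+ 2)^-1 = ((u t + s) ^+ 2 + v t ^+ 2) `^ (-1).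
    by rewrite powR_inv1// addr_ge0 ?sqr_ge0.
  under eq_fun do rewrite E; apply: measurable_powRT.
  by apply: measurable_funD; apply: (mX _ 2%N) => //; exact: measurable_funD.
split; apply: measurable_funM => //.
  by apply: measurable_funM => //; exact: mX.
apply: measurable_funD; last by apply: measurable_funM => //; exact: mX.
by apply: measurable_funD; [apply: measurable_funM => //|]; exact: mX.
Qed.

Lemma resolvent_im_ge0 s u v : 0 < s -> 0 <= resolvent_im s u v.
Proof.
by move=> s0; rewrite divr_ge0 ?addr_ge0 ?sqr_ge0// mulr_ge0 ?sqr_ge0// ltW.
Qed.

Lemma resolvent_re_ge0 s u v : 0 < s -> 0 <= u -> 0 <= resolvent_re s u v.
Proof.
move=> s0 u0; apply: divr_ge0; last by rewrite addr_ge0// sqr_ge0.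
apply: addr_ge0; last by rewrite mulr_ge0 ?sqr_ge0.
by apply: addr_ge0; [rewrite mulr_ge0 ?sqr_ge0 ?ltW|exact: exprn_ge0].
Qed.

Lemma resolvent_inequality (P : {poly R[i]}) (a eps s : R) :
  P.[0] = a%:C%C -> 0 <= a -> 0 < eps -> (forall t, eps <= Re P.[e1 t]) ->
  0 < s ->
  (\int[muT]_t (resolvent_im s (Re P.[e1 t]) (Im P.[e1 t]))%:E <=
   \int[muT]_t (resolvent_re s (Re P.[e1 t]) (Im P.[e1 t]))%:E)%E.
Proof.
move=> P0 a0 eps0 Pe s0.
have Pgt0 t : 0 < Re P.[e1 t] by exact: lt_le_trans (Pe t).
have [mP1 mP2] := cmeas_horner P.
have [mi mr] := measurable_resolvent s0 Pgt0 mP1 mP2.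
pose H : {poly R[i]} := P + (s%:C%C)%:P.
have Ht x : H.[x] = P.[x] + s%:C%C by rewrite /H !hornerE.
have He t : eps <= Re H.[e1 t] by rewrite Ht ReD /= ler_wpDr// ltW.
have Hn0 t : H.[e1 t] != 0.
  by apply/eqP => h; have := He t; rewrite h /= leNgt eps0.
(* Division of P^2 by P + s with remainder: only the means of a polynomial and of 1 / (P + s) are
   then needed. *)
pose w t := P.[e1 t] - s%:C%C + (s ^+ 2)%:C%C * (H.[e1 t])^-1.
have wE t : w t = P.[e1 t] ^+ 2 / (P.[e1 t] + s%:C%C).
  apply: (mulIf (Hn0 t)); rewrite -Ht divfK// mulrDl -mulrA mulVf// mulr1 Ht.
  by rewrite rmorphXn /=; ring.
have iV : cint (fun t => (H.[e1 t])^-1).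
  apply: (@cint_bounded _ _ eps^-1); first by apply: cmeasV; exact: cmeas_horner.
  move=> t; rewrite cabsV lef_pV2 ?posrE//.
    by apply: le_trans (He t) _; apply: le_trans (ler_norm _) (ler_abs_Re _).
  rewrite lt_neqAle cabs_ge0 andbT eq_sym; apply/eqP => /cabs_eq0 h.
  by have := Hn0 t; rewrite h eqxx.
have iPs : cint (fun t => P.[e1 t] - s%:C%C).
  by apply: cintB; [exact: cint_horner|exact: cint_cst].
have iw : cint w by apply: cintD => //; exact: cintM.
have Cw : 0 <= Re (Cint w).
  rewrite CintD//; last exact: cintM.
  rewrite CintB; [|exact: cint_horner|exact: cint_cst].
  rewrite Cint_cst CintM// (Cint_horner_inv eps0 He) Cint_horner Ht P0.
  rewrite -rmorphD -fmorphV -rmorphB -rmorphM -rmorphD /=.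
  have as0 : 0 < a + s by lra.
  rewrite (_ : a - s + s ^+ 2 / (a + s) = a ^+ 2 / (a + s)).
    by rewrite divr_ge0 ?sqr_ge0// ltW.
  by field; rewrite gt_eqF.
(* The integrand is at most s, because v^2 is at most its denominator. *)
have ii : muT.-integrable setT (fun t => (resolvent_im s (Re P.[e1 t]) (Im P.[e1 t]))%:E).
  apply: (@le_integrable _ _ _ _ _ _ _ (cst s%:E)) => //.
  - exact/measurable_EFinP.
  - move=> t _; rewrite lee_fin !ger0_norm ?resolvent_im_ge0//; last exact: ltW.
    have d0 : 0 < (Re P.[e1 t] + s) ^+ 2 + Im P.[e1 t] ^+ 2.
      by rewrite ltr_wpDr ?sqr_ge0// exprn_gt0// addr_gt0.
    by rewrite /resolvent_im ler_pdivrMr// ler_pM2l// lerDr sqr_ge0.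
  - exact: finite_measure_integrable_cst.
have -> : (\int[muT]_t (resolvent_re s (Re P.[e1 t]) (Im P.[e1 t]))%:E =
    \int[muT]_t ((resolvent_im s (Re P.[e1 t]) (Im P.[e1 t]))%:E + (Re (w t))%:E))%E.
  by apply: eq_integral => t _; rewrite wE resolventE// -EFinD addrC subrK.
rewrite integralD//; last by case: iw.
rewrite leeDl// -[leRHS]fineK; first by rewrite lee_fin.
by apply: integrable_fin_num => //; case: iw.
Qed.

End Trigonometric.

(** * M. Riesz' theorem *)

Section DyadicResolvents.
Variable R : realType.
Implicit Types (p a s u v x y : R).

(** With r = s / x, a summand divided by x^a is r^a / (1 + r^2), which decays like a power of r at
    both ends. It is dominated by an increment phi(2 s) - phi(s) of a bounded function, so the
    dyadic sum telescopes. *)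
Lemma dyadic_sum_bound a : 0 < a < 2 -> exists2 C : R, 0 < C &
  forall (s0 x : R) n, 0 < s0 -> 0 <= x ->
  \sum_(i < n) (s0 * 2 ^+ i) `^ a * (x ^+ 2 / ((s0 * 2 ^+ i) ^+ 2 + x ^+ 2)) <=
    C * x `^ a.
Proof.
move=> /andP[a0 a2].
(* One exponent for both ends: r^a / (1 + r^2) is at most r^b for r <= 1 and at most r^(-b) for r >=
   1. *)
pose b := Num.min a (2 - a).
have b0 : 0 < b by rewrite lt_min a0 subr_gt0.
have ba : b <= a by rewrite ge_min lexx.
have ba2 : b <= 2 - a by rewrite ge_min lexx orbT.
have p1b : (1 : R) `^ b = 1 by rewrite powR1.
have b21 : 1 < (2 : R) `^ b.
  by rewrite -[ltLHS]p1b gt0_ltr_powR// ?nnegrE//; lra.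
(* With y = r^b and B = 2^b, the increment of phi is (B - 1) y / ((1 + y) (1 + B y)), at least (B -
   1) / B times y / (1 + y)^2, while min(y, 1 / y) <= 4 y / (1 + y)^2. *)
pose K := 4 * (2 : R) `^ b / (2 `^ b - 1).
have K0 : 0 < K by rewrite divr_gt0 ?mulr_gt0 ?subr_gt0// powR_gt0.
exists K => // s0 x n s00; rewrite le_eqVlt => /orP[/eqP<-|x0].
  rewrite powR0 ?gt_eqF// mulr0 big1// => i _.
  by rewrite expr0n/= mul0r mulr0.
pose phi s : R := (s / x) `^ b / (1 + (s / x) `^ b).
have phi_ge0 s : 0 <= phi s by rewrite divr_ge0 ?addr_ge0 ?powR_ge0.
have phi_le1 s : phi s <= 1.
  by rewrite ler_pdivrMr ?mul1r ?lerDr ?ltr_wpDr ?powR_ge0.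
have key s : 0 < s ->
    s `^ a * (x ^+ 2 / (s ^+ 2 + x ^+ 2)) <= x `^ a * (K * (phi (2 * s) - phi s)).
  move=> s_gt0; pose r := s / x; pose y := r `^ b.
  have r0 : 0 < r by rewrite divr_gt0.
  have y0 : 0 < y by rewrite powR_gt0.
  have sE : s = r * x by rewrite /r divfK// gt_eqF.
  have -> : phi (2 * s) = 2 `^ b * y / (1 + 2 `^ b * y).
    by rewrite /phi -mulrA powRM ?ltW.
  have -> : phi s = y / (1 + y) by [].
  have -> : s `^ a * (x ^+ 2 / (s ^+ 2 + x ^+ 2)) = x `^ a * (r `^ a / (1 + r ^+ 2)).
    rewrite sE powRM ?ltW//; field.
    have h1 := exprn_gt0 2 x0; have h2 := sqr_ge0 (r * x); have h3 := sqr_ge0 r.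
    by rewrite !gt_eqF//; lra.
  rewrite ler_wpM2l ?powR_ge0//.
  apply: (@le_trans _ _ (4 * y / (1 + y) ^+ 2)).
    rewrite ler_pdivlMr ?exprn_gt0 ?addr_gt0//.
    have [r1|r1] := leP r 1.
      have y1 : y <= 1 by rewrite -[leRHS]p1b ge0_ler_powR// ?nnegrE ?ltW.
      have ray : r `^ a / (1 + r ^+ 2) <= y.
        rewrite ler_pdivrMr ?ltr_wpDr ?sqr_ge0//.
        apply: (@le_trans _ _ y); last by rewrite ler_peMr ?lerDl ?sqr_ge0// ltW.
        by apply: ger_powR; rewrite ?r0.
      apply: (@le_trans _ _ (y * 4)); last by rewrite mulrC.
      apply: ler_pM => //; first by rewrite divr_ge0 ?powR_ge0 ?addr_ge0 ?sqr_ge0.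
        exact: sqr_ge0.
      nra.
    have y1 : 1 <= y by rewrite -[leLHS]p1b ge0_ler_powR// ?nnegrE ?ltW.
    have ray : r `^ a / (1 + r ^+ 2) <= y^-1.
      rewrite ler_pdivrMr ?ltr_wpDr ?sqr_ge0//.
      apply: (@le_trans _ _ (y^-1 * r ^+ 2)).
        have -> : y^-1 * r ^+ 2 = r `^ (- b + 2).
          by rewrite powRD ?(gt_eqF r0) ?implybT// powRN powR_mulrn ?ltW.
        by apply: ler_powR; [exact: ltW|lra].
      by apply: ler_wpM2l; [rewrite invr_ge0 ltW|rewrite lerDr].
    apply: (@le_trans _ _ (y^-1 * (4 * y ^+ 2))).
      apply: ler_pM; rewrite ?divr_ge0 ?powR_ge0 ?addr_ge0 ?sqr_ge0//; nra.
    by rewrite le_eqVlt; apply/orP; left; apply/eqP; field; rewrite gt_eqF.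
  rewrite /K; set B := 2 `^ b in b21 *.
  have -> : 4 * B / (B - 1) * (B * y / (1 + B * y) - y / (1 + y)) =
      4 * y / (1 + y) * (B / (1 + B * y)).
    by field; rewrite !gt_eqF//; nra.
  have yn0 : 1 + y != 0 by rewrite gt_eqF// addr_gt0.
  have By0 : 0 < B * y by rewrite mulr_gt0//; lra.
  rewrite (_ : 4 * y / (1 + y) ^+ 2 = 4 * y / (1 + y) * (1 + y)^-1); last by field.
  apply: ler_wpM2l; first by rewrite divr_ge0 ?addr_ge0 ?mulr_ge0 ?ltW.
  rewrite ler_pdivlMr; last by rewrite addr_gt0.
  rewrite mulrC ler_pdivrMr; last by rewrite addr_gt0.
  by rewrite mulrDr mulr1 lerD2r ltW.
apply: (@le_trans _ _ (\sum_(i < n) x `^ a * (K * (phi (s0 * 2 ^+ i.+1) - phi (s0 * 2 ^+ i))))).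
  apply: ler_sum => i _.
  by rewrite [2 ^+ i.+1]exprS (mulrCA s0); apply: key; rewrite mulr_gt0// exprn_gt0.
rewrite -mulr_sumr -mulr_sumr mulrC ler_wpM2r ?powR_ge0//.
rewrite -(big_mkord xpredT (fun i => phi (s0 * 2 ^+ i.+1) - phi (s0 * 2 ^+ i))).
rewrite (@telescope_sumr _ 0 n (fun i => phi (s0 * 2 ^+ i)))//.
apply: ler_piMr; first exact: ltW.
by have := phi_le1 (s0 * 2 ^+ n); have := phi_ge0 (s0 * 2 ^+ 0); lra.
Qed.

(* Only the term with s0 2^i comparable to |v| is kept. *)
Lemma powR_le_resolvent_im p (s0 u v : R) n : 1 < p -> 0 < s0 -> 0 < u ->
  `|v| <= s0 * 2 ^+ n ->
  `|v| `^ p <= 5 * 2 `^ p * (\sum_(i < n.+1)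
      (s0 * 2 ^+ i) `^ (p - 1) * resolvent_im (s0 * 2 ^+ i) u v) + u `^ p + s0 `^ p.
Proof.
move=> p1 s00 u0 vn.
have p0 : 0 <= p by lra.
have S0 : 0 <= \sum_(i < n.+1)
    (s0 * 2 ^+ i) `^ (p - 1) * resolvent_im (s0 * 2 ^+ i) u v.
  apply: sumr_ge0 => i _; rewrite mulr_ge0 ?powR_ge0// resolvent_im_ge0//.
  by rewrite mulr_gt0// exprn_gt0.
have CS0 : 0 <= 5 * 2 `^ p * (\sum_(i < n.+1)
    (s0 * 2 ^+ i) `^ (p - 1) * resolvent_im (s0 * 2 ^+ i) u v).
  by rewrite !mulr_ge0 ?powR_ge0.
(* If |v| <= u or |v| <= s0, one of the last two terms suffices; otherwise some scale s = s0 2^i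
   satisfies s <= |v| <= 2 s. *)
have [vu|uv] := leP `|v| u.
  apply: (@le_trans _ _ (u `^ p)); first by rewrite ge0_ler_powR// ?nnegrE// ltW.
  by rewrite -addrA addrCA lerDl addr_ge0 ?powR_ge0.
have [vs|sv] := leP `|v| s0.
  apply: (@le_trans _ _ (s0 `^ p)); first by rewrite ge0_ler_powR// ?nnegrE// ltW.
  by rewrite lerDr addr_ge0 ?powR_ge0.
have [i [ilt iv vi]] : exists i : nat, [/\ (i <= n)%N, s0 * 2 ^+ i <= `|v| & `|v| <= 2 * (s0 * 2 ^+ i)].
  elim: n vn {S0 CS0} => [|n ih] vn.
    by rewrite expr0 mulr1 leNgt sv in vn.
  have [/ih [i [h1 h2 h3]]|nv] := leP `|v| (s0 * 2 ^+ n).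
    by exists i; split => //; exact: leqW.
  by exists n; split; [exact: leqnSn|exact: ltW|rewrite mulrCA -exprS].
set s := s0 * 2 ^+ i in iv vi.
have s_gt0 : 0 < s by rewrite mulr_gt0// exprn_gt0.
apply: (@le_trans _ _ (5 * 2 `^ p * (s `^ (p - 1) * resolvent_im s u v))); last first.
  rewrite -addrA; apply: ler_wpDr; first by rewrite addr_ge0 ?powR_ge0.
  rewrite ler_wpM2l ?mulr_ge0 ?powR_ge0//.
  rewrite (bigD1 (Ordinal (ilt : (i < n.+1)%N)))//= lerDl sumr_ge0// => j _.
  by rewrite mulr_ge0 ?powR_ge0// resolvent_im_ge0// mulr_gt0// exprn_gt0.
(* |v| <= 2 s accounts for 2^p; u <= |v| and s <= |v| bound the denominator by 5 v^2. *)
have -> : 5 * 2 `^ p * (s `^ (p - 1) * resolvent_im s u v) =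
    (2 * s) `^ p * (5 * v ^+ 2 / ((u + s) ^+ 2 + v ^+ 2)).
  rewrite powRM ?ltW// -[s `^ p](mulr_powRB1 (ltW s_gt0)); last lra.
  by rewrite /resolvent_im; ring.
rewrite -[leLHS]mulr1 ler_pM ?powR_ge0//.
  by rewrite ge0_ler_powR ?nnegrE// mulr_ge0// ltW.
rewrite ler_pdivlMr ?mul1r; last by rewrite ltr_wpDr ?sqr_ge0// exprn_gt0// addr_gt0.
have : (u + s) ^+ 2 <= (`|v| + `|v|) ^+ 2.
  by apply: lerXn2r; rewrite ?nnegrE; lra.
have := real_normK (num_real v); set w := `|v|; nra.
Qed.

(** For u > 0 the denominator dominates both s^2 + u^2 and s^2 + v^2, so the three terms of the
    numerator give dyadic sums with exponents p, p - 1 and p - 1. [dyadic_sum_bound] covers them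
    precisely when 1 < p < 2. *)
Lemma resolvent_re_sum p : 1 < p < 2 -> exists2 C : R, 0 < C &
  forall (s0 u v : R) n, 0 < s0 -> 0 < u ->
  \sum_(i < n) (s0 * 2 ^+ i) `^ (p - 1) * resolvent_re (s0 * 2 ^+ i) u v <=
    C * (u `^ p + u * `|v| `^ (p - 1)).
Proof.
move=> /andP[p1 p2].
have [|C C0 HC] := @dyadic_sum_bound p; first by apply/andP; split; lra.
have [|D D0 HD] := @dyadic_sum_bound (p - 1); first by apply/andP; split; lra.
exists (C + D); first exact: addr_gt0.
move=> s0 u v n s00 u0.
have up : u `^ p = u * u `^ (p - 1) by rewrite mulr_powRB1 ?ltW//; lra.
apply: (@le_trans _ _ (C * u `^ p + u * (D * u `^ (p - 1)) + u * (D * `|v| `^ (p - 1)))); last first.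
  have h1 : 0 <= C * (u * `|v| `^ (p - 1)) by rewrite !mulr_ge0 ?powR_ge0 ?ltW.
  rewrite up; nra.
have H1 := HC s0 u n s00 (ltW u0).
have H2 := ler_wpM2l (ltW u0) (HD s0 u n s00 (ltW u0)).
have H3 := ler_wpM2l (ltW u0) (HD s0 `|v| n s00 (normr_ge0 v)).
apply: le_trans (lerD (lerD H1 H2) H3).
rewrite !mulr_sumr -!big_split/=; apply: ler_sum => i _.
set s := s0 * 2 ^+ i.
have s_gt0 : 0 < s by rewrite mulr_gt0// exprn_gt0.
have sp : s `^ p = s `^ (p - 1) * s by rewrite mulrC mulr_powRB1 ?ltW//; lra.
rewrite sp real_normK ?num_real//.
have -> : s `^ (p - 1) * s * (u ^+ 2 / (s ^+ 2 + u ^+ 2)) +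
    u * (s `^ (p - 1) * (u ^+ 2 / (s ^+ 2 + u ^+ 2))) +
    u * (s `^ (p - 1) * (v ^+ 2 / (s ^+ 2 + v ^+ 2))) =
    s `^ (p - 1) * (s * u ^+ 2 / (s ^+ 2 + u ^+ 2) +
      u ^+ 3 / (s ^+ 2 + u ^+ 2) + u * v ^+ 2 / (s ^+ 2 + v ^+ 2)).
  by rewrite (exprS u 2); ring.
rewrite ler_wpM2l ?powR_ge0// /resolvent_re !mulrDl.
have v0 := sqr_ge0 v.
have d0 : 0 < (u + s) ^+ 2 + v ^+ 2 by rewrite ltr_wpDr// exprn_gt0// addr_gt0.
have h t c e : 0 <= t -> 0 < e -> e <= (u + s) ^+ 2 + v ^+ 2 -> c = t ->
    c / ((u + s) ^+ 2 + v ^+ 2) <= t / e.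
  by move=> t0 e0 he ->; rewrite ler_wpM2l// lef_pV2// posrE.
have us : 0 < u * s by exact: mulr_gt0.
have e1 : 0 < s ^+ 2 + u ^+ 2 by rewrite addr_gt0 ?exprn_gt0.
have e2 : 0 < s ^+ 2 + v ^+ 2 by rewrite ltr_wpDr// exprn_gt0.
have e3 : s ^+ 2 + u ^+ 2 <= (u + s) ^+ 2 + v ^+ 2 by nra.
have e4 : s ^+ 2 + v ^+ 2 <= (u + s) ^+ 2 + v ^+ 2 by nra.
apply: lerD; first apply: lerD; apply: h => //.
- by rewrite mulr_ge0 ?sqr_ge0// ltW.
- by rewrite exprn_ge0// ltW.
- by rewrite mulr_ge0// ltW.
Qed.

(** If y >= 2 K u, the left side is at most half of y^p; otherwise y is controlled by u. This
    removes the mixed term of [resolvent_re_sum]. *)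
Lemma powR_absorb p K : 1 < p -> 0 < K -> exists2 C : R, 0 < C &
  forall u y, 0 < u -> 0 <= y -> K * (u * y `^ (p - 1)) <= 2^-1 * y `^ p + C * u `^ p.
Proof.
move=> p1 K0; exists (K * (2 * K) `^ (p - 1)).
  by rewrite mulr_gt0// powR_gt0// mulr_gt0.
move=> u y u0 y0.
have [h|h] := leP (2 * K * u) y.
  rewrite -[y `^ p](mulr_powRB1 y0); last lra.
  apply: (@le_trans _ _ (2^-1 * (y * y `^ (p - 1)))).
    rewrite !mulrA ler_wpM2r ?powR_ge0//; lra.
  by rewrite lerDl mulr_ge0 ?powR_ge0// mulr_ge0 ?powR_ge0// ltW.
apply: ler_wpDl; first by rewrite mulr_ge0 ?powR_ge0.
rewrite -[u `^ p](mulr_powRB1 (ltW u0)); last lra.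
rewrite -mulrA ler_pM2l// mulrCA ler_pM2l//.
rewrite -powRM; [|by rewrite mulr_ge0// ltW|exact: ltW].
apply: ge0_ler_powR; rewrite ?nnegrE//; [lra| |exact: ltW].
by rewrite !mulr_ge0// ltW.
Qed.

End DyadicResolvents.

(** * Conjugate functions of polynomials with positive real part *)

Section ConjugateFunction.
Variable R : realType.
Implicit Types (p : R).
Local Notation muT := (@muT R).
Local Notation Re := (@complex.Re R).
Local Notation Im := (@complex.Im R).
Local Notation e1 := (Ek 1).

Lemma ge0_integral_scale (c : R) (g : R -> R) : 0 <= c ->
  measurable_fun setT g -> (forall t, 0 <= g t) ->
  (\int[muT]_t (c * g t)%:E = c%:E * \int[muT]_t (g t)%:E)%E.
Proof.
move=> c0 mg g0; under eq_integral do rewrite EFinM.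
rewrite ge0_integralZl//; first by apply/measurable_EFinP.
by move=> t _; rewrite lee_fin.
Qed.

Lemma ge0_integral_add (f g : R -> R) : measurable_fun setT f ->
  measurable_fun setT g -> (forall t, 0 <= f t) -> (forall t, 0 <= g t) ->
  (\int[muT]_t (f t + g t)%:E = \int[muT]_t (f t)%:E + \int[muT]_t (g t)%:E)%E.
Proof.
move=> mf mg f0 g0; under eq_integral do rewrite EFinD.
rewrite ge0_integralD//.
- by move=> t _; rewrite lee_fin.
- exact/measurable_EFinP.
- by move=> t _; rewrite lee_fin.
- exact/measurable_EFinP.
Qed.

Lemma ge0_integral_wsum n (w : 'I_n -> R) (g : 'I_n -> R -> R) :
  (forall i, 0 <= w i) -> (forall i, measurable_fun setT (g i)) ->
  (forall i t, 0 <= g i t) ->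
  (\int[muT]_t (\sum_(i < n) w i * g i t)%:E =
   \sum_(i < n) (w i)%:E * \int[muT]_t (g i t)%:E)%E.
Proof.
move=> w0 mg g0.
under eq_integral do rewrite -sumEFin.
rewrite ge0_integral_sum//.
- by apply: eq_bigr => i _; exact: ge0_integral_scale.
- by move=> i; apply/measurable_EFinP; apply: measurable_funM => //; exact: mg.
- by move=> i t _; rewrite lee_fin mulr_ge0.
Qed.

Lemma ge0_integral_wadd (a b c : R) (f g : R -> R) : 0 <= a -> 0 <= b -> 0 <= c ->
  measurable_fun setT f -> measurable_fun setT g ->
  (forall t, 0 <= f t) -> (forall t, 0 <= g t) ->
  (\int[muT]_t (a * f t + b * g t + c)%:E =
   a%:E * \int[muT]_t (f t)%:E + b%:E * \int[muT]_t (g t)%:E + c%:E)%E.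
Proof.
move=> a0 b0 c0 mf mg f0 g0.
have h1 t : 0 <= a * f t + b * g t by rewrite addr_ge0// mulr_ge0.
have m1 : measurable_fun setT (fun t => a * f t + b * g t).
  by apply: measurable_funD; exact: measurable_funM.
rewrite (@ge0_integral_add _ (fun=> c))//.
rewrite integral_cst// [X in (_ * X)%E]probability_setT mule1; congr (_ + _)%E.
rewrite ge0_integral_add ?ge0_integral_scale//.
- exact: measurable_funM.
- exact: measurable_funM.
- by move=> t; rewrite mulr_ge0.
- by move=> t; rewrite mulr_ge0.
Qed.

Lemma ge0_le_integralT (f g : R -> R) :
  measurable_fun setT f -> measurable_fun setT g ->
  (forall t, 0 <= f t) -> (forall t, f t <= g t) ->
  (\int[muT]_t (f t)%:E <= \int[muT]_t (g t)%:E)%E.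
Proof.
move=> mf mg f0 fg; apply: ge0_le_integral => //.
- by move=> t _; rewrite lee_fin.
- exact/measurable_EFinP.
- exact/measurable_EFinP.
- by move=> t _; rewrite lee_fin.
Qed.

Lemma conjugate_bound_lt2 p : 1 < p < 2 -> exists2 C : R, 0 <= C &
  forall (P : {poly R[i]}) (a eps : R),
  P.[0] = a%:C%C -> 0 <= a -> 0 < eps -> (forall t, eps <= Re P.[e1 t]) ->
  (\int[muT]_t (`|Im P.[e1 t]| `^ p)%:E <=
   C%:E * \int[muT]_t (Re P.[e1 t] `^ p)%:E)%E.
Proof.
move=> p12; have /andP[p1 p2] := p12.
have p0 : 0 < p by lra.
have [C1 C10 HC1] := resolvent_re_sum p12.
pose A := 5 * (2 : R) `^ p; have A0 : 0 < A by rewrite mulr_gt0 ?powR_gt0.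
pose K := A * C1; have K0 : 0 < K by rewrite mulr_gt0.
have [D D0 HD] := powR_absorb p1 K0.
(* K + D + 1 collects the u^p terms of the pointwise estimates; the factor 2 comes from absorbing
   half of the left side. *)
exists (2 * (K + D + 1)); first by rewrite mulr_ge0// !addr_ge0// ltW.
move=> P a eps P0 a0 eps0 Pe.
set u := fun t => Re P.[e1 t]; set v := fun t => Im P.[e1 t].
have u0 t : 0 < u t by exact: lt_le_trans (Pe t).
have [mu mv] : measurable_fun setT u /\ measurable_fun setT v.
  by case: (cmeas_horner P).
have mup : measurable_fun setT (fun t => u t `^ p) by exact: measurable_powRT.
have mvp : measurable_fun setT (fun t => `|v t| `^ p).
  by apply: measurable_powRT; exact: measurableT_comp.
have vM t : `|v t| <= coef_sum P.
  by apply: le_trans (ler_abs_Im _) _; exact: cabs_horner.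
set X := (\int[muT]_t (`|v t| `^ p)%:E)%E.
set U := (\int[muT]_t (u t `^ p)%:E)%E.
have X0 : (0 <= X)%E by apply: integral_ge0 => t _; rewrite lee_fin powR_ge0.
have U0 : (0 <= U)%E by apply: integral_ge0 => t _; rewrite lee_fin powR_ge0.
have finb (h : R -> R) (M : R) : measurable_fun setT h -> (forall t, 0 <= h t <= M) ->
    (\int[muT]_t (h t `^ p)%:E)%E \is a fin_num.
  move=> mh hM; rewrite ge0_fin_numE; last first.
    by apply: integral_ge0 => t _; rewrite lee_fin powR_ge0.
  apply: (@le_lt_trans _ _ (\int[muT]_t (M `^ p)%:E)%E).
    apply: (@ge0_le_integralT _ (fun=> M `^ p)) => //.
    - exact: measurable_powRT.
    - by move=> t; exact: powR_ge0.
    - move=> t; have /andP[h0 hm] := hM t.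
      by apply: ge0_ler_powR; rewrite ?nnegrE//; [exact: ltW|exact: le_trans hm].
  by rewrite integral_cst// [X in (_ * X)%E]probability_setT mule1 ltry.
(* Half of X can be subtracted only if X is finite, which holds since polynomials are bounded on the
   circle. *)
have Xfin : X \is a fin_num.
  apply: (finb (fun t => `|v t|) (coef_sum P)); first exact: measurableT_comp.
  by move=> t; rewrite normr_ge0 vM.
have Ufin : U \is a fin_num.
  apply: (finb u (coef_sum P)) => // t; rewrite ltW//=.
  by apply: le_trans (cabs_horner P t); apply: le_trans (ler_norm _) (ler_abs_Re _).
(* The smallest dyadic scale s0 is arbitrary, and the error s0^p vanishes with it. *)
suff main s0 : 0 < s0 -> (X <= 2^-1%:E * X + (K + D + 1)%:E * U + (s0 `^ p)%:E)%E.
  rewrite -(fineK Xfin) -(fineK Ufin) in main *.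
  rewrite -EFinM; apply/lee_addgt0Pr => e e0.
  have e20 : 0 < e / 2 by rewrite divr_gt0.
  have := main ((e / 2) `^ p^-1) (powR_gt0 _ e20).
  rewrite -powRrM mulVf ?gt_eqF// powRr1 ?(ltW e20)// -!EFinM -!EFinD !lee_fin.
  by rewrite -mulrA; move: (fine X) ((K + D + 1) * fine U) => x y; clear; lra.
move=> s00.
(* The largest scale s0 2^n is at least |v| everywhere on the circle. *)
have [n vn] : exists n, coef_sum P <= s0 * 2 ^+ n.
  exists (Num.bound (coef_sum P / s0)); rewrite mulrC -ler_pdivrMr//.
  apply: le_trans (ltW (archi_boundP _)) _.
    apply: divr_ge0; last exact: ltW.
    by apply: sumr_ge0 => i _; exact: cabs_ge0.
  by rewrite -natrX ler_nat ltnW// ltn_expl.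
pose S i : R := s0 * 2 ^+ i.
have S0 i : 0 < S i by rewrite mulr_gt0// exprn_gt0.
pose w (i : 'I_n.+1) : R := S i `^ (p - 1).
have w0 i : 0 <= w i by exact: powR_ge0.
have mres (i : 'I_n.+1) := measurable_resolvent (S0 i) u0 mu mv.
pose im (i : 'I_n.+1) t := resolvent_im (S i) (u t) (v t).
pose re (i : 'I_n.+1) t := resolvent_re (S i) (u t) (v t).
have im0 i t : 0 <= im i t by exact: resolvent_im_ge0.
have re0 i t : 0 <= re i t by apply: resolvent_re_ge0 => //; exact: ltW.
have mim i : measurable_fun setT (im i) by exact: (mres i).1.
have mre i : measurable_fun setT (re i) by exact: (mres i).2.
have mws (g : 'I_n.+1 -> R -> R) : (forall i, measurable_fun setT (g i)) ->
    measurable_fun setT (fun t => \sum_(i < n.+1) w i * g i t).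
  by move=> mg; apply: measurable_sum => i; apply: measurable_funM => //; exact: mg.
have ws0 (g : 'I_n.+1 -> R -> R) t : (forall i t, 0 <= g i t) ->
    0 <= \sum_(i < n.+1) w i * g i t.
  by move=> g0; apply: sumr_ge0 => i _; exact: mulr_ge0.
apply: (@le_trans _ _ (\int[muT]_t
   (A * (\sum_(i < n.+1) w i * im i t) + 1 * u t `^ p + s0 `^ p)%:E)%E).
  apply: (@ge0_le_integralT (fun t => `|v t| `^ p)) => //.
  - apply: measurable_funD => //; apply: measurable_funD.
      by apply: measurable_funM => //; exact: mws.
    exact: measurable_funM.
  - move=> t; rewrite mul1r; apply: powR_le_resolvent_im => //.
    exact: le_trans (vM t) vn.
rewrite ge0_integral_wadd ?powR_ge0 ?(ltW A0)//; last 3 first.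
- exact: mws.
- by move=> t; exact: ws0.
- by move=> t; exact: powR_ge0.
(* The mean of P^2 / (P + s) is used here, once per scale: it trades [resolvent_im] for
   [resolvent_re]. *)
apply: (@le_trans _ _ (A%:E * (\int[muT]_t (\sum_(i < n.+1) w i * re i t)%:E) +
  1%:E * U + (s0 `^ p)%:E)%E).
  apply: leeD => //; apply: leeD => //.
  apply: lee_wpmul2l; first by rewrite lee_fin ltW.
  rewrite !ge0_integral_wsum//; apply: lee_sum => i _.
  by apply: lee_wpmul2l; [rewrite lee_fin|exact: (resolvent_inequality P0 a0 eps0 Pe (S0 i))].
rewrite -ge0_integral_wadd ?powR_ge0 ?(ltW A0)//; last 3 first.
- exact: mws.
- by move=> t; exact: ws0.
- by move=> t; exact: powR_ge0.
rewrite -ge0_integral_wadd ?powR_ge0 ?invr_ge0 ?addr_ge0 ?(ltW K0) ?(ltW D0)//; last first.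
  by move=> t; exact: powR_ge0.
apply: ge0_le_integralT.
- apply: measurable_funD => //; apply: measurable_funD.
    by apply: measurable_funM => //; exact: mws.
  exact: measurable_funM.
- by apply: measurable_funD => //; apply: measurable_funD; exact: measurable_funM.
- move=> t; rewrite !addr_ge0 ?mulr_ge0 ?powR_ge0 ?ws0// ltW//.
- move=> t; have := HC1 s0 (u t) (v t) n.+1 s00 (u0 t).
  have := HD (u t) `|v t| (u0 t) (normr_ge0 _).
  set Sg := \sum_(i < _) _ => h1 h2.
  have h3 : A * Sg <= K * u t `^ p + K * (u t * `|v t| `^ (p - 1)).
    by rewrite -mulrDr /K -mulrA ler_pM2l.
  rewrite !mulrDl mul1r.
  move: h1 h3; move: (u t `^ p) (D * _) (K * _ `^ _) (2^-1 * _) (K * (_ * _)) (A * _).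
  by clear => x1 x2 x3 x4 x5 x6; lra.
Qed.

Lemma conjugate_bound2 (P : {poly R[i]}) (a : R) : P.[0] = a%:C%C ->
  (\int[muT]_t (`|Im P.[e1 t]| `^ 2)%:E <= \int[muT]_t (`|Re P.[e1 t]| `^ 2)%:E)%E.
Proof.
move=> P0.
have [mu mv] := cmeas_horner P.
have sq (x : R) : `|x| `^ 2 = x ^+ 2 by rewrite powR_mulrn// real_normK ?num_real.
have iP := cint_horner (P ^+ 2).
have iv : muT.-integrable setT (fun t => (Im P.[e1 t] ^+ 2)%:E).
  apply: (@le_integrable _ _ _ _ _ _ _ (cst (coef_sum P ^+ 2)%:E)) => //.
  - by apply/measurable_EFinP; exact: (measurableT_comp (exprn_measurable 2)).
  - move=> t _; rewrite lee_fin !ger0_norm ?sqr_ge0// -real_normK ?num_real//.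
    apply: lerXn2r; rewrite ?nnegrE//; last first.
      by apply: le_trans (ler_abs_Im _) (cabs_horner _ _).
    by apply: le_trans (cabs_ge0 _) (cabs_horner P 0).
  - exact: finite_measure_integrable_cst.
under eq_integral do rewrite sq.
under [leRHS]eq_integral do rewrite sq.
have -> : (\int[muT]_t (Re P.[e1 t] ^+ 2)%:E =
    \int[muT]_t ((Im P.[e1 t] ^+ 2)%:E + (Re (P ^+ 2).[e1 t])%:E))%E.
  apply: eq_integral => t _; rewrite -EFinD; congr EFin.
  by rewrite horner_exp expr2 ReM; ring.
rewrite integralD//; last by case: iP.
rewrite leeDl// -[leRHS]fineK; last by apply: integrable_fin_num => //; case: iP.
rewrite lee_fin -/(Rintegral _ _ _) -ReC Cint_horner horner_exp P0 -rmorphXn/=.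
exact: sqr_ge0.
Qed.

Lemma conjugate_bound p : 1 < p <= 2 -> exists2 C : R, 0 <= C &
  forall (P : {poly R[i]}) (a eps : R),
  P.[0] = a%:C%C -> 0 <= a -> 0 < eps -> (forall t, eps <= Re P.[e1 t]) ->
  (\int[muT]_t (`|Im P.[e1 t]| `^ p)%:E <=
   C%:E * \int[muT]_t (Re P.[e1 t] `^ p)%:E)%E.
Proof.
move=> /andP[p1]; rewrite le_eqVlt => /orP[/eqP->|p2]; last first.
  by apply: conjugate_bound_lt2; rewrite p1.
exists 1 => // P a eps P0 a0 eps0 Pe; rewrite mul1e.
have := conjugate_bound2 P0; set X := (\int[_]_t _)%E; set Y := (\int[_]_t _)%E.
suff -> : Y = (\int[muT]_t (Re P.[e1 t] `^ 2)%:E)%E by [].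
by apply: eq_integral => t _; rewrite ger0_norm// (le_trans _ (Pe t))// ltW.
Qed.

End ConjugateFunction.

(** * One-sided Fourier multipliers and the Fejer kernel *)

Section FejerOperators.
Variable R : realType.
Implicit Types (p : R) (f g : R -> R[i]) (h : R -> R).
Local Notation Re := (@complex.Re R).

Lemma fourier_coefD f g k : cint f -> cint g ->
  fourier_coef (fun t => f t + g t) k = fourier_coef f k + fourier_coef g k.
Proof.
move=> cf cg; have mf := cint_cmeas cf; have mg := cint_cmeas cg.
rewrite !fourier_coefE//; last exact: cmeasD.
by under eq_fun do rewrite mulrDl; rewrite CintD//; exact: cint_EkM.
Qed.

Lemma fourier_coefM f (z : R[i]) k : cint f ->
  fourier_coef (fun t => z * f t) k = z * fourier_coef f k.
Proof.
move=> cf; have mf := cint_cmeas cf.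
rewrite !fourier_coefE//; last by apply: cmeasM => //; exact: cmeas_cst.
by under eq_fun do rewrite -mulrA; rewrite CintM//; exact: cint_EkM.
Qed.

Lemma fourier_coef_sum (I : Type) (s : seq I) (F : I -> R -> R[i]) k :
  (forall i, cint (F i)) ->
  fourier_coef (fun t => \sum_(i <- s) F i t) k = \sum_(i <- s) fourier_coef (F i) k.
Proof.
move=> cF; have mF i := cint_cmeas (cF i).
rewrite fourier_coefE; last exact: cmeas_sum.
under eq_fun do rewrite mulr_suml.
rewrite Cint_sum; last by move=> i; exact: cint_EkM.
by apply: eq_bigr => i _; rewrite fourier_coefE.
Qed.

Lemma fourier_coef_conj f k : cint f ->
  fourier_coef (fun t => conjc (f t)) k = conjc (fourier_coef f (- k)).
Proof.
move=> cf; have mf := cint_cmeas cf.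
rewrite !fourier_coefE//; last exact: cmeas_conj.
rewrite -Cint_conj; last exact: cint_EkM.
by congr Cint; apply/funext => t; rewrite opprK conjcM EkN.
Qed.

Lemma fourier_coef_shift f l k : cmeas f ->
  fourier_coef (fun t => Ek l t * f t) k = fourier_coef f (k - l).
Proof.
move=> mf; rewrite !fourier_coefE//; last first.
  by apply: cmeasM => //; exact: cmeas_Ek.
congr Cint; apply/funext => t.
by rewrite opprB mulrAC mulrC EkD mulrA.
Qed.

Lemma fourier_coef_Ek k l : fourier_coef (Ek l) k = (k == l)%:R :> R[i].
Proof.
rewrite fourier_coefE; last exact: cmeas_Ek.
under eq_fun do rewrite -EkD.
by rewrite Cint_Ek subr_eq0 eq_sym.
Qed.

(** A Fourier multiplier restricted to the frequencies 0, ..., n - 1. One-sidedness makes the result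
    a polynomial in [Ek 1], to which mean value arguments apply. *)
Definition trig_mult (m : nat -> R) n f (t : R) : R[i] :=
  \sum_(k < n) (m k)%:C%C * fourier_coef f k%:Z * Ek k t.

Lemma cmeas_trig_mult m n f : cmeas (trig_mult m n f).
Proof.
by apply: cmeas_sum => k; apply: cmeasM; [exact: cmeas_cst|exact: cmeas_Ek].
Qed.

Lemma per_trig_mult m n f : per (trig_mult m n f).
Proof. by move=> t; apply: eq_bigr => k _; rewrite per_Ek. Qed.

Lemma trig_multD m n f g t : cint f -> cint g ->
  trig_mult m n (fun t => f t + g t) t = trig_mult m n f t + trig_mult m n g t.
Proof.
move=> cf cg; rewrite /trig_mult -big_split/=; apply: eq_bigr => k _.
by rewrite fourier_coefD// mulrDr mulrDl.
Qed.

Lemma trig_multM m n f z t : cint f ->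
  trig_mult m n (fun t => z * f t) t = z * trig_mult m n f t.
Proof.
move=> cf; rewrite /trig_mult mulr_sumr; apply: eq_bigr => k _.
by rewrite fourier_coefM//; ring.
Qed.

(** Substituting s = t + d in the integrals of the coefficients turns the multiplier into an
    integral of translates of f against a kernel in d. *)
Lemma trig_mult_conv m n f t : cint f -> per f ->
  trig_mult m n f t =
  Cint (fun d => f (t + d) * \sum_(k < n) (m k)%:C%C * Ek k (- d)).
Proof.
move=> cf pf; have mf := cint_cmeas cf.
under eq_fun do rewrite mulr_sumr.
have E (k : int) d : f (t + d) * Ek k (- d) = Ek k t * (f (d + t) * Ek (- k) (d + t)).
  by rewrite (addrC d) EkDt !EkN EkNt [RHS]mulrCA [Ek k t * _]mulrA Ek_conj_mul mul1r.
have cg k : cint (fun s => f s * Ek (- k) s) by exact: cint_EkM.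
have pg k : per (fun s => f s * Ek (- k) s) by move=> s; rewrite pf per_Ek.
have ci k : cint (fun d => f (t + d) * Ek k (- d)).
  by under eq_fun do rewrite E; apply: cintM; exact: (cint_shift t (cg k) (pg k)).
rewrite Cint_sum; last by move=> k; under eq_fun do rewrite mulrCA; exact: cintM.
apply: eq_bigr => k _; under eq_fun do rewrite mulrCA.
rewrite CintM// -mulrA; congr (_ * _).
under eq_fun do rewrite E.
rewrite CintM; last exact: (cint_shift t (cg k) (pg k)).
rewrite (Cint_shift t (cg k) (pg k)) mulrC fourier_coefE//.
Qed.

(* The factor 2 makes the real part of the one-sided Fejer sum of a real
   function equal to its Fejer mean. *)
Definition fejer_coef N k : R :=
  (if k == 0%N then 1 else 2) * (1 - k%:R / N.+1%:R).

(** As a squared modulus the Fejer kernel is visibly nonnegative; [Re_fejer_kernel] connects it with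
    the weights. *)
Definition fejer N (t : R) : R := cabs (\sum_(j < N.+1) Ek j t) ^+ 2 / N.+1%:R.

Lemma fejer_ge0 N t : 0 <= fejer N t.
Proof. by rewrite divr_ge0 ?sqr_ge0. Qed.

Lemma fejerN N t : fejer N (- t) = fejer N t.
Proof.
rewrite /fejer -[in LHS]cabs_conj conjc_sum.
by under eq_bigr do rewrite -EkNt opprK.
Qed.

Lemma measurable_fejer N : measurable_fun setT (fejer N).
Proof.
apply: measurable_funM => //; apply: (measurableT_comp (exprn_measurable 2)).
by apply: measurable_cabs; apply: cmeas_sum => j; exact: cmeas_Ek.
Qed.

Lemma sqr_cabsD (z w : R[i]) :
  cabs (z + w) ^+ 2 = cabs z ^+ 2 + 2 * Re (z * conjc w) + cabs w ^+ 2.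
Proof. by rewrite !sqr_cabs ReM ReJ ImJ ReD ImD; ring. Qed.

Lemma Re_sum (I : Type) (s : seq I) (F : I -> R[i]) :
  Re (\sum_(i <- s) F i) = \sum_(i <- s) Re (F i).
Proof.
by elim: s => [|i s ih]; rewrite ?big_nil// !big_cons ReD ih.
Qed.

(** Induction on N: one more exponential in the squared modulus adds 1 plus twice the real parts of
    its products with the earlier ones, and on the other side every coefficient N + 1 - k grows by
    1. *)
Lemma Re_fejer_kernel N t :
  Re (\sum_(k < N.+1) (fejer_coef N k)%:C%C * Ek k t) = fejer N t.
Proof.
pose c k : R := if k == 0%N then 1 else 2.
have ReC (x : R) z : Re (x%:C%C * z) = x * Re z.
  by rewrite ReM /= mul0r subr0.
rewrite Re_sum /fejer.
have -> : \sum_(k < N.+1) Re ((fejer_coef N k)%:C%C * Ek k t) =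
    (\sum_(k < N.+1) c k * (N.+1%:R - k%:R) * Re (Ek k t)) / N.+1%:R.
  rewrite mulr_suml; apply: eq_bigr => k _; rewrite ReC /fejer_coef -/(c k).
  have : N.+1%:R != 0 :> R by rewrite pnatr_eq0.
  by move: (N.+1%:R : R) => x x0; field.
congr (_ / _); elim: N => [|N ih].
  by rewrite !big_ord1 Ek0 cabs1 expr1n /c/= subr0 !mul1r.
rewrite [in RHS]big_ord_recr/= sqr_cabsD -ih cabs_Ek expr1n.
have -> : \sum_(k < N.+2) c k * (N.+2%:R - k%:R) * Re (Ek k t) =
    \sum_(k < N.+1) c k * (N.+1%:R - k%:R) * Re (Ek k t) +
    \sum_(k < N.+2) c k * Re (Ek k t).
  rewrite [X in _ = X + _](_ : _ =
      \sum_(k < N.+2) c k * (N.+1%:R - k%:R) * Re (Ek k t)); last first.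
    by rewrite [RHS]big_ord_recr/= subrr mulr0 mul0r addr0.
  by rewrite -big_split/=; apply: eq_bigr => k _; rewrite -[N.+2%:R]natr1; ring.
rewrite -addrA; congr (_ + _).
rewrite big_ord_recl (_ : c ord0 * _ = 1); last by rewrite [Ek _ t]Ek0 /c/= mul1r.
rewrite addrC; congr (_ + _).
(* The frequency differences N + 1 - j run through 1, ..., N + 1 in reverse order. *)
rewrite mulr_suml Re_sum mulr_sumr [RHS](reindex_inj rev_ord_inj).
apply: eq_bigr => k _; congr (_ * _).
rewrite -EkN -EkD -ReJ -EkN; congr (Re (Ek _ _)).
have := ltn_ord k; rewrite lift0 /=; lia.
Qed.

End FejerOperators.

(** * The analytic Fejer operators on L^p *)

Section RieszProjection.
Variable R : realType.
Implicit Types (p : R) (f g : R -> R[i]) (h : R -> R).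
Local Notation muT := (@muT R).
Local Notation Re := (@complex.Re R).
Local Notation Im := (@complex.Im R).
Local Notation e1 := (Ek 1).

Lemma powR1E p : (1 : R) `^ p = 1.
Proof. by rewrite powR1. Qed.

Lemma cint_mul_bounded f g (M : R) : cint f -> cmeas g ->
  (forall t, cabs (g t) <= M) -> cint (fun t => f t * g t).
Proof.
move=> cf mg gM; have mf := cint_cmeas cf.
have M0 : 0 <= M by apply: le_trans (gM 0); exact: cabs_ge0.
apply: cintP; first exact: cmeasM.
apply: (@le_lt_trans _ _ (\int[muT]_t (M * cabs (f t))%:E)%E).
  apply: ge0_le_integralT.
  - by apply: measurable_cabs; exact: cmeasM.
  - by apply: measurable_funM => //; exact: measurable_cabs.
  - by move=> t; exact: cabs_ge0.
  - by move=> t; rewrite cabsM mulrC ler_wpM2r ?cabs_ge0.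
rewrite ge0_integral_scale//; last 2 first.
- exact: measurable_cabs.
- by move=> t; exact: cabs_ge0.
apply: lte_mul_pinfty => //; exact: cint_cabs.
Qed.

Definition fejer_kernel N t : R[i] := \sum_(k < N.+1) (fejer_coef R N k)%:C%C * Ek k t.

Lemma cabs_fejer_kernel N t :
  cabs (fejer_kernel N t) <= \sum_(k < N.+1) `|fejer_coef R N k|.
Proof.
apply: (le_trans (cabs_sum _ _)); apply: ler_sum => k _.
by rewrite cabsM cabs_real cabs_Ek mulr1.
Qed.

Lemma cmeas_fejer_kernel N : cmeas (fejer_kernel N).
Proof.
by apply: cmeas_sum => k; apply: cmeasM; [exact: cmeas_cst|exact: cmeas_Ek].
Qed.

Lemma integral_fejer N : (\int[muT]_t (fejer N t)%:E = 1)%E.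
Proof.
have cK : cint (fejer_kernel N).
  exact: cint_bounded (cmeas_fejer_kernel N) (@cabs_fejer_kernel N).
have CK : Cint (fejer_kernel N) = 1.
  rewrite Cint_sum; last by move=> k; apply: cintM; exact: cint_Ek.
  rewrite big_ord_recl big1 => [|k _].
    rewrite CintM; last exact: cint_Ek.
    by rewrite Cint_Ek /fejer_coef/= mul0r subr0 !mulr1 addr0.
  by rewrite CintM ?Cint_Ek ?mulr0//; exact: cint_Ek.
have : Re (Cint (fejer_kernel N)) = 1 by rewrite CK.
rewrite ReC /Rintegral => <-.
rewrite fineK; last by apply: integrable_fin_num => //; case: cK.
by apply: eq_integral => t _; rewrite Re_fejer_kernel.
Qed.

(** The real part of the one-sided sum is the Fejer mean of h, hence nonnegative for h >= 0; this is
    what brings the conjugate function bound within reach. *)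
Lemma Re_trig_fejer N h t : cint (fun s => (h s)%:C%C) -> per h ->
  ((Re (trig_mult (fejer_coef R N) N.+1 (fun s => (h s)%:C%C) t))%:E =
   \int[muT]_d (h (t + d)%R * fejer N d)%:E)%E.
Proof.
move=> ch ph; rewrite trig_mult_conv//; last by move=> s; rewrite ph.
have E d : Re ((h (t + d))%:C%C * fejer_kernel N (- d)) = h (t + d) * fejer N d.
  by rewrite ReM /= mul0r subr0 Re_fejer_kernel fejerN.
rewrite ReC /Rintegral fineK; first by apply: eq_integral => d _; rewrite E.
apply: integrable_fin_num => //.
have : cint (fun d => (h (t + d))%:C%C * fejer_kernel N (- d)).
  apply: (@cint_mul_bounded _ _ (\sum_(k < N.+1) `|fejer_coef R N k|)).
  - under eq_fun do rewrite addrC.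
    by apply: (cint_shift t ch) => s; rewrite ph.
  - have [m1 m2] := cmeas_fejer_kernel N; split.
      exact: (measurableT_comp m1 (@oppr_measurable R setT)).
    exact: (measurableT_comp m2 (@oppr_measurable R setT)).
  - by move=> d; exact: cabs_fejer_kernel.
by case.
Qed.

Lemma measurable_add2 h : measurable_fun setT h ->
  measurable_fun setT (fun z : R * R => h (z.1 + z.2)).
Proof.
move=> mh; apply: (measurableT_comp mh).
by apply: measurable_funD.
Qed.

Lemma lee_powR_eps p (D : R) (X Y : \bar R) : 0 < p -> 0 <= D ->
  Y \is a fin_num ->
  (forall e : R, 0 < e -> (X <= D%:E * (Y + (e `^ p)%:E))%E) -> (X <= D%:E * Y)%E.
Proof.
move=> p0 D0 Yfin H.
rewrite -(fineK Yfin) -EFinM; apply/lee_addgt0Pr => e e0.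
have e1 : 0 < e / (D + 1) by rewrite divr_gt0// ltr_wpDl.
apply: (le_trans (H ((e / (D + 1)) `^ p^-1) (powR_gt0 _ e1))).
rewrite -powRrM mulVf ?gt_eqF// powRr1 ?(ltW e1)//.
rewrite -[in leLHS](fineK Yfin) -EFinD -EFinM -EFinD lee_fin mulrDr lerD2l.
rewrite mulrA ler_pdivrMr; last by rewrite ltr_wpDl.
by rewrite mulrC ler_pM2l// lerDl.
Qed.

(* The constant e moves the real part away from 0, as required by the bound on
   conjugate functions. *)
Lemma fejer_poly N h (e : R) : cint (fun t => (h t)%:C%C) ->
  (forall t, 0 <= h t) -> 0 <= e -> exists (P : {poly R[i]}) (a : R),
  [/\ P.[0] = a%:C%C, 0 <= a & forall t,
    P.[e1 t] = trig_mult (fejer_coef R N) N.+1 (fun t => (h t)%:C%C) t + e%:C%C].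
Proof.
move=> chc h0 e0; set hc := fun t => (h t)%:C%C.
exists (\poly_(k < N.+1) ((fejer_coef R N k)%:C%C * fourier_coef hc k%:Z) + (e%:C%C)%:P).
exists (Rintegral muT setT h + e); split.
- rewrite !hornerE horner_poly big_ord_recl big1 ?addr0.
    rewrite expr0 mulr1 /fejer_coef/= mul0r subr0 mulr1 mul1r.
    rewrite fourier_coefE; last exact: cint_cmeas.
    rewrite oppr0; under eq_fun do rewrite Ek0 mulr1.
    rewrite rmorphD; congr (_ + _); apply: complex_eq; rewrite ?ReC ?ImC//=.
    by rewrite Rintegral_cst// mul0r.
  by move=> k _; rewrite expr0n/= mulr0.
- by apply: addr_ge0 => //; exact: Rintegral_ge0.
- move=> t; rewrite !hornerE; congr (_ + _); rewrite horner_poly.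
  by apply: eq_bigr => k _; rewrite -EkX.
Qed.

Lemma Jp_real p h : (forall t, 0 <= h t) ->
  Jp p (fun t => (h t)%:C%C) = (\int[muT]_t (h t `^ p)%:E)%E.
Proof. by move=> h0; apply: eq_integral => t _; rewrite cabs_real ger0_norm. Qed.

(** The real part is an average of translates of h, hence bounded on L^p with constant 1; the
    imaginary part is controlled by the real part through [conjugate_bound]. *)
Lemma analytic_fejer_ge0 p : 1 < p <= 2 -> exists2 C : R, 0 <= C &
  forall N h, measurable_fun setT h -> per h -> (forall t, 0 <= h t) ->
  (Jp p (fun t => (h t)%:C%C) < +oo)%E ->
  (Jp p (trig_mult (fejer_coef R N) N.+1 (fun t => (h t)%:C%C)) <=
   C%:E * Jp p (fun t => (h t)%:C%C))%E.
Proof.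
move=> p12; have [C C0 HC] := conjugate_bound p12.
have /andP[p1 p2] := p12; have p0 : 0 < p by lra.
exists (2 `^ p * (1 + C * 2 `^ p)).
  by rewrite mulr_ge0 ?powR_ge0// addr_ge0// mulr_ge0// powR_ge0.
move=> N h mh ph h0 Jh; set hc := fun t => (h t)%:C%C.
have mhc : cmeas hc by exact: cmeas_real.
have chc : cint hc by apply: (Jp_cint _ mhc Jh); exact: ltW.
have phc : per hc by move=> t; rewrite /hc ph.
set F := trig_mult _ _ _.
have mF : cmeas F by exact: cmeas_trig_mult.
pose u t := Re (F t); pose v t := Im (F t).
have [mu mv] : measurable_fun setT u /\ measurable_fun setT v by [].
have uE t : ((u t)%:E = \int[muT]_d (h (t + d)%R * fejer N d)%:E)%E.
  exact: Re_trig_fejer.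
have u0 t : 0 <= u t.
  rewrite -lee_fin uE; apply: integral_ge0 => d _.
  by rewrite lee_fin mulr_ge0// fejer_ge0.
have Jfin : Jp p hc \is a fin_num by rewrite ge0_fin_numE// Jp_ge0.
have Ju : (\int[muT]_t (u t `^ p)%:E <= Jp p hc)%E.
  rewrite -[leRHS]fineK//.
  rewrite -[X in (_ <= X%:E)%E]mul1r -[X in (_ <= (X * _)%:E)%E](powR1E p).
  apply: (@kernel_bound R p 1 _ (fun z => h (z.1 + z.2)) (fejer N) u p1 ler01).
  - by rewrite fine_ge0// Jp_ge0.
  - exact: measurable_add2.
  - exact: measurable_fejer.
  - exact: mu.
  - by move=> z; exact: h0.
  - by move=> d; exact: fejer_ge0.
  - exact: u0.
  - by rewrite integral_fejer.
  - move=> d _; rewrite fineK; last exact: Jfin.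
    rewrite (Jp_real p h0) (@ge0_integralT_shift _ d (fun t => (h t `^ p)%:E)); first exact: lexx.
    + by apply/measurable_EFinP; exact: measurable_powRT.
    + by move=> t; rewrite lee_fin powR_ge0.
    + by move=> t; rewrite ph.
  - by move=> t; rewrite uE lexx.
have mup : measurable_fun setT (fun t => u t `^ p) by exact: measurable_powRT.
have mvp : measurable_fun setT (fun t => `|v t| `^ p).
  by apply: measurable_powRT; exact: measurableT_comp.
have upfin : (\int[muT]_t (u t `^ p)%:E)%E \is a fin_num.
  rewrite ge0_fin_numE; first exact: le_lt_trans Ju Jh.
  by apply: integral_ge0 => t _; rewrite lee_fin powR_ge0.
have Jv : (\int[muT]_t (`|v t| `^ p)%:E <= (C * 2 `^ p)%:E * Jp p hc)%E.
  apply: (lee_powR_eps p0 _ Jfin); first by rewrite mulr_ge0// powR_ge0.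
  move=> e e0; have [P [a [P0 a0 Pt]]] := fejer_poly N chc h0 (ltW e0).
  have Pe t : e <= Re P.[e1 t] by rewrite Pt ReD/= lerDr u0.
  have := HC P a e P0 a0 e0 Pe.
  rewrite (_ : (\int[muT]_t (`|Im P.[e1 t]| `^ p)%:E)%E = (\int[muT]_t (`|v t| `^ p)%:E)%E); last first.
    by apply: eq_integral => t _; rewrite Pt ImD/= addr0.
  move=> /le_trans; apply; rewrite EFinM -muleA; apply: lee_wpmul2l; first by rewrite lee_fin.
  apply: (@le_trans _ _ (\int[muT]_t (2 `^ p * (u t `^ p + e `^ p))%:E)%E).
    apply: ge0_le_integralT.
    - by apply: measurable_powRT; under eq_fun do rewrite Pt ReD; exact: measurable_funD.
    - by apply: measurable_funM => //; exact: measurable_funD.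
    - by move=> t; exact: powR_ge0.
    - by move=> t; rewrite Pt ReD/=; exact: powR_le2 (ltW p0) (u0 t) (ltW e0).
  rewrite ge0_integral_scale ?powR_ge0//; last 2 first.
  - exact: measurable_funD.
  - by move=> t; rewrite addr_ge0// powR_ge0.
  apply: lee_wpmul2l; first by rewrite lee_fin powR_ge0.
  have -> : (\int[muT]_t (u t `^ p + e `^ p)%:E = \int[muT]_t (1 * u t `^ p + 0 * 0 + e `^ p)%:E)%E.
    by apply: eq_integral => t _; rewrite mul1r mul0r addr0.
  rewrite (@ge0_integral_wadd _ 1 0 _ _ (fun=> 0)) ?powR_ge0//; last first.
    by move=> t; exact: powR_ge0.
  by rewrite mul1e mul0e adde0; apply: leeD2r; exact: Ju.
apply: (@le_trans _ _ (\int[muT]_t (2 `^ p * (u t `^ p + `|v t| `^ p))%:E)%E).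
  apply: ge0_le_integralT.
  - by apply: measurable_powRT; exact: measurable_cabs.
  - by apply: measurable_funM => //; exact: measurable_funD.
  - by move=> t; exact: powR_ge0.
  - move=> t; apply: le_trans (powR_le2 (ltW p0) (u0 t) (normr_ge0 (v t))).
    apply: (ge0_ler_powR (ltW p0)); rewrite ?nnegrE ?cabs_ge0 ?(addr_ge0 (u0 t))//.
    by apply: (le_trans (cabs_le_ReIm _)); rewrite -/(u t) -/(v t) (ger0_norm (u0 t)).
rewrite ge0_integral_scale ?powR_ge0//; last 2 first.
- exact: measurable_funD.
- by move=> t; rewrite addr_ge0// powR_ge0.
rewrite EFinM -muleA; apply: lee_wpmul2l; first by rewrite lee_fin powR_ge0.
rewrite ge0_integral_add//; last by move=> t; exact: powR_ge0.
rewrite EFinD ge0_muleDl ?lee_fin ?mulr_ge0 ?powR_ge0// mul1e.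
exact: leeD.
Qed.

End RieszProjection.

(** * From Fejer operators to partial sums for p <= 2 *)

Section PartialSums.
Variable R : realType.
Implicit Types (p : R) (f g : R -> R[i]) (h : R -> R).
Local Notation Re := (@complex.Re R).
Local Notation Im := (@complex.Im R).

Lemma JpD_le p f g (x y : R) : 0 <= p -> cmeas f -> cmeas g ->
  (Jp p f <= x%:E)%E -> (Jp p g <= y%:E)%E ->
  (Jp p (fun t => (f t + g t)%R) <= (2 `^ p * (x + y))%:E)%E.
Proof.
move=> p0 mf mg fx gy; apply: (le_trans (JpD p0 mf mg)).
rewrite EFinM EFinD; apply: lee_wpmul2l; first by rewrite lee_fin powR_ge0.
exact: leeD.
Qed.

Lemma JpM_le p f z (x : R) : 0 <= p -> cmeas f -> (Jp p f <= x%:E)%E ->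
  (Jp p (fun t => (z * f t)%R) <= (cabs z `^ p * x)%:E)%E.
Proof.
move=> p0 mf fx; rewrite JpM// EFinM.
by apply: lee_wpmul2l; rewrite ?lee_fin ?powR_ge0.
Qed.

(** f is split into the positive and negative parts of its real and imaginary parts. Two layers of
    [JpD] over four terms give the constant 4 * 2^p * 2^p. *)
Lemma trig_mult_le (m : nat -> R) n p (C : R) : 1 < p -> 0 <= C ->
  (forall h, measurable_fun setT h -> per h -> (forall t, 0 <= h t) ->
    (Jp p (fun t => (h t)%:C%C) < +oo)%E ->
    (Jp p (trig_mult m n (fun t => (h t)%:C%C)) <=
      C%:E * Jp p (fun t => (h t)%:C%C))%E) ->
  forall f (x : R), cmeas f -> per f -> (Jp p f <= x%:E)%E ->
  (Jp p (trig_mult m n f) <= (4 * 2 `^ p * 2 `^ p * C * x)%:E)%E.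
Proof.
move=> p1 C0 H f x mf pf fx.
have p0 : 0 <= p by lra.
pose pos (u : R -> R) t : R := Num.max (u t) 0.
have part (u : R -> R) : measurable_fun setT u -> per u ->
    (forall t, `|u t| <= cabs (f t)) ->
    [/\ cmeas (fun t => (pos u t)%:C%C),
        cint (fun t => (pos u t)%:C%C) &
    (Jp p (trig_mult m n (fun t => (pos u t)%:C%C)) <= (C * x)%:E)%E].
  move=> mu pu uf.
  have mm : measurable_fun setT (pos u) by exact: measurable_maxr.
  have mc := cmeas_real mm.
  have m0 t : 0 <= pos u t by rewrite le_max lexx orbT.
  have Jm : (Jp p (fun t => (pos u t)%:C%C) <= x%:E)%E.
    apply: le_trans fx; apply: le_Jp => // t; rewrite cabs_real ger0_norm//.
    by rewrite ge_max cabs_ge0 andbT (le_trans (ler_norm _)).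
  have Jlt := le_lt_trans Jm (ltry x).
  split=> //; first exact: Jp_cint (ltW p1) mc Jlt.
  apply: (le_trans (H _ mm _ m0 Jlt)); first by move=> t; rewrite /pos pu.
  by rewrite EFinM; apply: lee_wpmul2l => //; rewrite lee_fin.
have [mR mI] := mf.
have [m1 i1 J1] := part (fun t => Re (f t)) mR
  ltac:(by move=> t; rewrite pf) (fun t => ler_abs_Re (f t)).
have [m2 i2 J2] := part (fun t => - Re (f t)) (measurable_funN mR)
  ltac:(by move=> t; rewrite pf)
  (fun t => ltac:(by rewrite normrN ler_abs_Re)).
have [m3 i3 J3] := part (fun t => Im (f t)) mI
  ltac:(by move=> t; rewrite pf) (fun t => ler_abs_Im (f t)).
have [m4 i4 J4] := part (fun t => - Im (f t)) (measurable_funN mI)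
  ltac:(by move=> t; rewrite pf)
  (fun t => ltac:(by rewrite normrN ler_abs_Im)).
set f1 := fun t => _ in m1 i1 J1; set f2 := fun t => _ in m2 i2 J2.
set f3 := fun t => _ in m3 i3 J3; set f4 := fun t => _ in m4 i4 J4.
have maxE (y : R) : Num.max y 0 - Num.max (- y) 0 = y.
  by have [y0|y0] := leP 0 y; [rewrite !maxEge oppr_ge0|rewrite !maxEge oppr_ge0];
     case: ltgtP y0 => //; lra.
pose N1 : R[i] := -1; pose I1 : R[i] := ('i)%C; pose I2 : R[i] := - I1.
have fE : f = (fun t => (f1 t + N1 * f2 t) + (I1 * f3 t + I2 * f4 t)).
  apply/funext => t; apply: complex_eq; rewrite /f1 /f2 /f3 /f4 /pos.
    by rewrite !(ReD, ReM, ImM, ReN, ImN)/= -[LHS](maxE (Re (f t))); ring.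
  by rewrite !(ImD, ReM, ImM, ReN, ImN)/= -[LHS](maxE (Im (f t))); ring.
have z1 (z : R[i]) g : (z = N1 \/ z = I1 \/ z = I2) -> cmeas g -> (Jp p g <= (C * x)%:E)%E ->
    (Jp p (fun t => (z * g t)%R) <= (C * x)%:E)%E.
  move=> hz mg Jg; rewrite JpM// (_ : cabs z = 1) ?powR1 ?mul1e//.
  by case: hz => [->|[->|->]]; rewrite ?cabsN ?cabs1// cabsE/= expr1n expr0n add0r sqrtr1.
have TE : trig_mult m n f = (fun t => (trig_mult m n f1 t + N1 * trig_mult m n f2 t) +
    (I1 * trig_mult m n f3 t + I2 * trig_mult m n f4 t)).
  apply/funext => t; rewrite fE.
  rewrite (@trig_multD _ _ _ (fun t => f1 t + N1 * f2 t) (fun t => I1 * f3 t + I2 * f4 t)); last 2 first.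
  - by apply: cintD => //; exact: cintM.
  - by apply: cintD; exact: cintM.
  rewrite (@trig_multD _ _ _ f1 (fun t => N1 * f2 t))//; last exact: cintM.
  rewrite (@trig_multD _ _ _ (fun t => I1 * f3 t) (fun t => I2 * f4 t)); last 2 first.
  - exact: cintM.
  - exact: cintM.
  by rewrite !trig_multM.
have mt g : cmeas (trig_mult m n g) by exact: cmeas_trig_mult.
have mz (z : R[i]) g : cmeas (fun t => z * trig_mult m n g t).
  by apply: cmeasM => //; exact: cmeas_cst.
rewrite TE (_ : 4 * _ * _ * _ * _ = 2 `^ p * (2 `^ p * (C * x + C * x) + 2 `^ p * (C * x + C * x))); last by ring.
apply: (JpD_le p0 (cmeasD (mt _) (mz _ _)) (cmeasD (mz _ _) (mz _ _))).
- exact: (JpD_le p0 (mt _) (mz _ _) J1 (z1 _ _ (or_introl erefl) (mt _) J2)).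
- exact: (JpD_le p0 (mz _ _) (mz _ _) (z1 _ _ (or_intror (or_introl erefl)) (mt _) J3)
    (z1 _ _ (or_intror (or_intror erefl)) (mt _) J4)).
Qed.

Lemma trig_mult_lin (a b : R) (m1 m2 : nat -> R) n f t :
  trig_mult (fun k => a * m1 k + b * m2 k) n f t =
  a%:C%C * trig_mult m1 n f t + b%:C%C * trig_mult m2 n f t.
Proof.
rewrite /trig_mult !mulr_sumr -big_split/=; apply: eq_bigr => k _.
by rewrite rmorphD !rmorphM/=; ring.
Qed.

(** Weights continued by 0, so that sums of different orders can be combined over one range of
    frequencies. *)
Definition fejer_cut N k : R := if (k < N.+1)%N then fejer_coef R N k else 0.

Lemma trig_mult_cut N n f t : (N < n)%N ->
  trig_mult (fejer_cut N) n f t = trig_mult (fejer_coef R N) N.+1 f t.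
Proof.
move=> Nn; rewrite /trig_mult.
rewrite (big_ord_widen n (fun k => (fejer_coef R N k)%:C%C * fourier_coef f k%:Z * Ek k t))//.
rewrite [RHS]big_mkcond; apply: eq_bigr => k _; rewrite /fejer_cut.
by case: ifP => //; rewrite rmorph0 !mul0r.
Qed.

(* The combination of Fejer weights that is constant on k <= 2 K; the order-0
   term corrects k = 0, where [fejer_coef] lacks the factor 2. *)
Definition proj_weight K k : R :=
  1 * (1 * fejer_cut (4 * K).+1 k + - 2^-1 * fejer_cut (2 * K) k) + 2^-1 * fejer_cut 0 k.

(** The device of de la Vallee-Poussin: for k >= 1, 2 (1 - k / (4K + 2)) - (1 - k / (2K + 1)) = 1,
    because 4K + 2 = 2 (2K + 1). For k = 0 the weight is 1 - 1/2 + 1/2. *)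
Lemma proj_weight1 K k : (k <= 2 * K)%N -> proj_weight K k = 1.
Proof.
move=> kK; rewrite /proj_weight /fejer_cut ltnS leqW ?ltnS ?kK; last lia.
rewrite /fejer_coef; case: k kK => [|k] kK /=.
  by rewrite !mul0r !subr0; lra.
have -> : (4 * K).+2%:R = 2 * (2 * K).+1%:R :> R by rewrite -natrM; congr _%:R; lia.
have : (2 * K).+1%:R != 0 :> R by rewrite pnatr_eq0.
by move: ((2 * K).+1%:R : R) => y y0; field.
Qed.

(** Not an exact projection: frequencies above 2 K are only damped. The second application in
    [fourier_partial_proj] removes them, since they have become negative by then. *)
Definition riesz_proj K := trig_mult (proj_weight K) (4 * K).+2.

(** The Fejer bound does not depend on the order, so a fixed combination of three orders is bounded
    uniformly in K. *)
Lemma riesz_proj_le p : 1 < p <= 2 -> exists2 C : R, 0 <= C &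
  forall K f (x : R), cmeas f -> per f -> (Jp p f <= x%:E)%E ->
  (Jp p (riesz_proj K f) <= (C * x)%:E)%E.
Proof.
move=> p12; have [B B0 HB] := analytic_fejer_ge0 p12; have /andP[p1 _] := p12.
have p0 : 0 <= p by lra.
pose D := 4 * 2 `^ p * 2 `^ p * B.
have HD N f x mf pf fx := @trig_mult_le (fejer_coef R N) N.+1 p B p1 B0 (HB N) f x mf pf fx.
pose c1 := cabs (1%:C : R[i])%C `^ p; pose c2 := cabs ((- 2^-1)%:C : R[i])%C `^ p.
pose c3 := cabs ((2^-1)%:C : R[i])%C `^ p.
exists (2 `^ p * (c1 * (2 `^ p * (c1 * D + c2 * D)) + c3 * D)).
  by rewrite !(mulr_ge0, addr_ge0, powR_ge0).
move=> K f x mf pf fx.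
have PE : riesz_proj K f = (fun t => (1%:C)%C *
    ((1%:C)%C * trig_mult (fejer_coef R (4 * K).+1) (4 * K).+2 f t +
    ((- 2^-1)%:C)%C * trig_mult (fejer_coef R (2 * K)) (2 * K).+1 f t) +
    ((2^-1)%:C)%C * trig_mult (fejer_coef R 0) 1 f t).
  apply/funext => t; rewrite /riesz_proj /proj_weight !trig_mult_lin.
  by rewrite !trig_mult_cut//; lia.
have mt m n g : cmeas (trig_mult m n g) by exact: cmeas_trig_mult.
have mz (z : R[i]) g : cmeas g -> cmeas (fun t => z * g t).
  by move=> mg; apply: cmeasM => //; exact: cmeas_cst.
rewrite PE (_ : _ * x = 2 `^ p * (c1 * (2 `^ p * (c1 * (D * x) + c2 * (D * x))) + c3 * (D * x))); last by ring.
have JD N z : (Jp p (fun t => (z * trig_mult (fejer_coef R N) N.+1 f t)%R) <=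
    (cabs z `^ p * (D * x))%:E)%E.
  by apply: (JpM_le z p0 (mt _ _ _)); exact: HD.
have m12 := cmeasD (mz 1%:C%C _ (mt (fejer_coef R (4 * K).+1) (4 * K).+2 f))
  (mz (- 2^-1)%:C%C _ (mt (fejer_coef R (2 * K)) (2 * K).+1 f)).
apply: (JpD_le p0 (mz _ _ m12) (mz _ _ (mt _ _ _)) _ (JD _ _)).
apply: (JpM_le _ p0 m12).
exact: (JpD_le p0 (mz _ _ (mt _ _ _)) (mz _ _ (mt _ _ _)) (JD _ _) (JD _ _)).
Qed.

Lemma cint_fourier_partial K f : cint (fourier_partial K f).
Proof. by apply: cint_sum => k; apply: cintM; exact: cint_Ek. Qed.

Lemma fourier_partialE K f t : fourier_partial K f t =
  \sum_(i < (K + K).+1) fourier_coef f (i%:Z - K%:Z) * Ek (i%:Z - K%:Z) t.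
Proof. by []. Qed.

(* The frequency window [-K, K] is cut out by two one-sided projections, each
   after shifting and reflecting frequencies. *)
Lemma fourier_partial_proj K f t : cint f ->
  fourier_partial K f t = Ek (- K%:Z) t *
    riesz_proj K (fun s => Ek (2 * K%:Z) s *
      conjc (riesz_proj K (fun r => Ek K%:Z r * conjc (f r)) s)) t.
Proof.
move=> cf; have mf := cint_cmeas cf.
have c1 j : fourier_coef (fun r => Ek K%:Z r * conjc (f r)) j =
    conjc (fourier_coef f (K%:Z - j)).
  rewrite fourier_coef_shift; last exact: cmeas_conj.
  by rewrite fourier_coef_conj// opprB.
pose a := proj_weight K; pose n := (4 * K).+2.
have c2 l : fourier_coef (fun s => Ek (2 * K%:Z) s *
      conjc (riesz_proj K (fun r => Ek K%:Z r * conjc (f r)) s)) l =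
    \sum_(j < n) (a j)%:C%C * fourier_coef f (K%:Z - j%:Z) * (l == 2 * K%:Z - j%:Z)%:R.
  rewrite (_ : (fun s => _) = (fun s => \sum_(j < n)
      ((a j)%:C%C * fourier_coef f (K%:Z - j%:Z)) * Ek (2 * K%:Z - j%:Z) s)); last first.
    apply/funext => s; rewrite /riesz_proj /trig_mult conjc_sum mulr_sumr.
    apply: eq_bigr => j _; rewrite !conjcM c1 conjcK conjc_real EkD EkN -/a.
    by ring.
  rewrite fourier_coef_sum; last by move=> j; apply: cintM; exact: cint_Ek.
  apply: eq_bigr => j _; rewrite fourier_coefM; last exact: cint_Ek.
  by rewrite fourier_coef_Ek.
rewrite /riesz_proj {1}/trig_mult mulr_sumr fourier_partialE.
rewrite (big_ord_widen n (fun i : nat => fourier_coef f (i%:Z - K%:Z) * Ek (i%:Z - K%:Z) t)); last first.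
  by rewrite /n; lia.
rewrite big_mkcond; apply: eq_bigr => l _; rewrite c2 -/a.
(* For l <= 2 K only j = 2 K - l contributes, and both weights are 1 there; for l > 2 K no j
   does. *)
case: ifPn => lK.
  have jn : (2 * K - l < n)%N by rewrite /n; lia.
  rewrite (bigD1 (Ordinal jn))//= big1 => [|j jl].
    have -> : (l%:Z == 2 * K%:Z - (2 * K - l)%N%:Z) by lia.
    have h1 : (l <= 2 * K)%N by rewrite mul2n -addnn -ltnS.
    rewrite /a (proj_weight1 h1) (proj_weight1 (leq_subr l (2 * K))).
    rewrite (_ : K%:Z - (2 * K - l)%N%:Z = l%:Z - K%:Z); last by lia.
    rewrite (addrC l%:Z) EkD rmorph1 (_ : true%:R = 1 :> R[i])//.
    by move: (fourier_coef _ _) (Ek _ _) (Ek _ _) => x1 x2 x3; ring.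
  have /negbTE-> : l%:Z != 2 * K%:Z - j%:Z.
    apply: contraNneq jl => h; apply/eqP/val_inj => /=; lia.
  by rewrite mulr0.
rewrite big1 ?mulr0 ?mul0r ?mulr0// => j _.
have /negbTE-> : l%:Z != 2 * K%:Z - j%:Z by apply/eqP; lia.
by rewrite mulr0.
Qed.

(** Modulation and conjugation preserve the modulus, so [fourier_partial_proj] costs just two
    applications of the projection bound. *)
Lemma fourier_partial_le2 p : 1 < p <= 2 -> exists2 C : R, 0 <= C &
  forall K f (x : R), cmeas f -> per f -> (Jp p f <= x%:E)%E ->
  (Jp p (fourier_partial K f) <= (C * x)%:E)%E.
Proof.
move=> p12; have [B B0 HB] := riesz_proj_le p12; have /andP[p1 _] := p12.
exists (B * B); first exact: mulr_ge0.
move=> K f x mf pf fx.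
have cf : cint f by apply: (Jp_cint (ltW p1) mf); exact: le_lt_trans fx (ltry x).
pose g1 r := Ek K%:Z r * conjc (f r).
pose g2 s := Ek (2 * K%:Z) s * conjc (riesz_proj K g1 s).
have m1 : cmeas g1 by apply: cmeasM; [exact: cmeas_Ek|exact: cmeas_conj].
have m2 : cmeas g2.
  by apply: cmeasM; [exact: cmeas_Ek|apply: cmeas_conj; exact: cmeas_trig_mult].
have p1' : per g1 by move=> t; rewrite /g1 per_Ek pf.
have p2' : per g2 by move=> t; rewrite /g2 per_Ek [in LHS]/riesz_proj per_trig_mult.
have J1 : (Jp p g1 <= x%:E)%E.
  by apply: le_trans fx; rewrite (@eq_Jp _ _ g1 f)// => t; rewrite cabsM cabs_Ek mul1r cabs_conj.
have J2 : (Jp p g2 <= (B * x)%:E)%E.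
  apply: le_trans (HB K g1 x m1 p1' J1).
  rewrite (@eq_Jp _ _ g2 (riesz_proj K g1))// => t.
  by rewrite cabsM cabs_Ek mul1r cabs_conj.
rewrite -mulrA; apply: le_trans (HB K g2 _ m2 p2' J2).
rewrite (@eq_Jp _ _ (fourier_partial K f) (riesz_proj K g2))// => t.
by rewrite fourier_partial_proj// cabsM cabs_Ek mul1r.
Qed.

End PartialSums.

(** * Partial sums for p > 2 by duality *)

Section Duality.
Variable R : realType.
Implicit Types (p q : R) (f g : R -> R[i]).
Local Notation muT := (@muT R).
Local Notation Re := (@complex.Re R).

(** Young's inequality for lam x and y / lam, with the factors 1/p and 1/q dropped. The parameter
    later makes the dual term small enough to absorb. *)
Lemma young_scaled p q (lam x y : R) : 0 < p -> 0 < q -> p^-1 + q^-1 = 1 ->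
  0 < lam -> 0 <= x -> 0 <= y ->
  x * y <= lam `^ p * x `^ p + (lam^-1) `^ q * y `^ q.
Proof.
move=> p0 q0 pq l0 x0 y0.
have l0' : 0 <= lam^-1 by rewrite invr_ge0 ltW.
have := @conjugate_powR R (lam * x) (lam^-1 * y) p q (mulr_ge0 (ltW l0) x0)
  (mulr_ge0 l0' y0) p0 q0 pq.
rewrite !powRM ?(ltW l0)// mulrACA mulfV ?gt_eqF// mul1r.
have h1 : p^-1 <= 1 by rewrite -pq lerDl invr_ge0 ltW.
have h2 : q^-1 <= 1 by rewrite -pq lerDr invr_ge0 ltW.
move=> /le_trans; apply; apply: lerD; apply: ler_piMr => //;
  by rewrite mulr_ge0 ?powR_ge0.
Qed.

(** Partial sums are self-adjoint: both sides equal the sum of [fourier_coef f k * conjc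
    (fourier_coef g k)] over |k| <= K. *)
Lemma Cint_fourier_partial K f g : cint f -> cint g ->
  Cint (fun t => fourier_partial K f t * conjc (g t)) =
  Cint (fun t => f t * conjc (fourier_partial K g t)).
Proof.
move=> cf cg; have mf := cint_cmeas cf; have mg := cint_cmeas cg.
have cgE k : cint (fun t => conjc (g t) * Ek k t).
  by apply: cint_EkM; exact: cint_conj.
transitivity (\sum_(i < (K + K).+1) fourier_coef f (i%:Z - K%:Z) *
    conjc (fourier_coef g (i%:Z - K%:Z))).
  under eq_fun do rewrite fourier_partialE mulr_suml.
  rewrite Cint_sum => [|i]; last first.
    by under eq_fun do rewrite -mulrA [Ek _ _ * _]mulrC; exact: cintM.
  apply: eq_bigr => i _; under eq_fun do rewrite -mulrA [Ek _ _ * _]mulrC.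
  rewrite CintM//; congr (_ * _).
  rewrite (fourier_coefE _ mg) -Cint_conj; last exact: cint_EkM.
  by congr Cint; apply/funext => t; rewrite conjcM -EkN opprK.
under [in RHS]eq_fun do rewrite fourier_partialE conjc_sum mulr_sumr.
have E (i : 'I_(K + K).+1) t :
    f t * conjc (fourier_coef g (i%:Z - K%:Z) * Ek (i%:Z - K%:Z) t) =
    conjc (fourier_coef g (i%:Z - K%:Z)) * (f t * Ek (- (i%:Z - K%:Z)) t).
  by rewrite conjcM -EkN mulrCA.
rewrite Cint_sum => [|i]; last first.
  by under eq_fun do rewrite E; apply: cintM; exact: cint_EkM.
apply: eq_bigr => i _; under [in RHS]eq_fun do rewrite E.
by rewrite CintM ?(fourier_coefE _ mf) 1?mulrC//; exact: cint_EkM.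
Qed.

Lemma Re_Cint_le f : cint f ->
  ((Re (Cint f))%:E <= \int[muT]_t (cabs (f t))%:E)%E.
Proof.
move=> cf; have mf := cint_cmeas cf; case: cf => i1 _.
apply: (@le_trans _ _ (`|Re (Cint f)|%:E)%E); first by rewrite lee_fin ler_norm.
rewrite ReC EFin_normr_Rintegral//.
apply: (le_trans (le_abse_integral _ _ _)) => //.
  by apply/measurable_EFinP; case: mf.
apply: ge0_le_integral => //.
- by do 2 apply: measurableT_comp => //; case: mf.
- by apply/measurable_EFinP; exact: measurable_cabs.
- by move=> t _; rewrite lee_fin ler_abs_Re.
Qed.

Lemma cabs_fourier_partial K f t : cabs (fourier_partial K f t) <=
  \sum_(i < (K + K).+1) cabs (fourier_coef f (i%:Z - K%:Z)).
Proof.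
rewrite fourier_partialE; apply: (le_trans (cabs_sum _ _)); apply: ler_sum => i _.
by rewrite cabsM cabs_Ek mulr1.
Qed.

Lemma per_fourier_partial K f : per (fourier_partial K f).
Proof. by move=> t; rewrite !fourier_partialE; apply: eq_bigr => i _; rewrite per_Ek. Qed.

Lemma Jp_bounded p f (M : R) : 0 <= p -> cmeas f -> (forall t, cabs (f t) <= M) ->
  (Jp p f <= (M `^ p)%:E)%E.
Proof.
move=> p0 mf fM; have M0 : 0 <= M by apply: le_trans (fM 0); exact: cabs_ge0.
have -> : (M `^ p)%:E = Jp p (fun=> M%:C%C) by rewrite Jp_cst cabs_real ger0_norm.
apply: (le_Jp p0 mf (cmeas_cst _)) => t.
by rewrite cabs_real ger0_norm.
Qed.

(** Duality with the extremal function phi = |g|^(p-2) g for g the partial sum of f: the product of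
    g and the conjugate of phi is |g|^p, which also equals |phi|^q. Moving the partial sum onto phi
    makes the bound for q <= 2 applicable. *)
Lemma fourier_partial_gt2 p : 2 < p -> exists2 C : R, 0 <= C &
  forall K f (x : R), cmeas f -> per f -> (Jp p f <= x%:E)%E ->
  (Jp p (fourier_partial K f) <= (C * x)%:E)%E.
Proof.
move=> p2; pose q := p / (p - 1).
have p0 : 0 < p by lra. have p1 : 0 < p - 1 by lra.
have q0 : 0 < q by rewrite divr_gt0.
have q12 : 1 < q <= 2.
  by rewrite /q ltr_pdivlMr// ler_pdivrMr//; apply/andP; split; lra.
have pq : p^-1 + q^-1 = 1 by rewrite /q; field; rewrite !gt_eqF.
have [B B0 HB] := fourier_partial_le2 q12.
(* Chosen so that lam^(-q) B <= 1/2; the term in phi is then absorbed by half of [Jp p g]. *)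
pose lam := (2 * B + 1) `^ q^-1.
have B1 : 0 < 2 * B + 1 by rewrite ltr_wpDl// mulr_ge0.
have l0 : 0 < lam by rewrite powR_gt0.
have lq : (lam^-1) `^ q * B <= 2^-1.
  have -> : lam^-1 `^ q = (2 * B + 1)^-1.
    rewrite -powR_inv1 ?(ltW l0)// /lam -!powRrM.
    have -> : q^-1 * (-1 * q) = -1 by field; rewrite gt_eqF.
    by rewrite powR_inv1// ltW.
  by rewrite mulrC ler_pdivrMr//; lra.
exists (2 * lam `^ p); first by rewrite mulr_ge0 ?powR_ge0.
move=> K f x mf pf fx.
have cf : cint f.
  by apply: (@Jp_cint _ p f _ mf); [lra|exact: le_lt_trans fx (ltry x)].
set g := fourier_partial K f.
have cg : cint g by exact: cint_fourier_partial.
have mg : cmeas g by exact: cint_cmeas.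
pose M := \sum_(i < (K + K).+1) cabs (fourier_coef f (i%:Z - K%:Z)).
have gM t : cabs (g t) <= M by exact: cabs_fourier_partial.
pose phi t := ((cabs (g t) `^ (p - 2))%:C%C * g t).
have mphi : cmeas phi.
  apply: cmeasM => //; apply: cmeas_real; apply: measurable_powRT.
  exact: measurable_cabs.
have cphi t : cabs (phi t) = cabs (g t) `^ (p - 1).
  rewrite /phi cabsM cabs_real ger0_norm ?powR_ge0// mulrC.
  have -> : p - 2 = (p - 1) - 1 by ring.
  by rewrite mulr_powRB1 ?cabs_ge0.
have phiM t : cabs (phi t) <= M `^ (p - 1).
  rewrite cphi; apply: ge0_ler_powR; rewrite ?nnegrE ?cabs_ge0//; first exact: ltW.
  by apply: le_trans (gM t); exact: cabs_ge0.
have cp : cint phi by exact: cint_bounded mphi phiM.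
have gphi t : g t * conjc (phi t) = (cabs (g t) `^ p)%:C%C.
  rewrite /phi conjcM conjc_real mulrCA cabs_complex_sum -rmorphM/=; congr (_%:C%C).
  rewrite -[RHS](mulr_powRB1 (cabs_ge0 (g t)) p0).
  rewrite -[_ `^ (p - 1)](mulr_powRB1 (cabs_ge0 (g t)) p1).
  by rewrite (_ : p - 1 - 1 = p - 2); ring.
have pphi : per phi by move=> t; rewrite /phi /g per_fourier_partial.
(* Absorption needs finiteness, which holds because g is a trigonometric polynomial. *)
have Jfin : Jp p g \is a fin_num.
  rewrite ge0_fin_numE ?Jp_ge0//; apply: le_lt_trans (ltry (M `^ p)).
  by apply: Jp_bounded => //; exact: ltW.
have JX : (Jp q phi <= (fine (Jp p g))%:E)%E.
  rewrite (fineK Jfin) (_ : Jp q phi = Jp p g); first exact: lexx.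
  apply: eq_integral => t _; rewrite cphi -powRrM; congr (_ `^ _)%:E.
  by rewrite /q; field; rewrite gt_eqF.
have H1 := HB K phi _ mphi pphi JX.
have mFp : cmeas (fourier_partial K phi) by exact/cint_cmeas/cint_fourier_partial.
have JRe : (Jp p g <= (Re (Cint (fun t => g t * conjc (phi t))))%:E)%E.
  have E : (\int[muT]_t (Re (g t * conjc (phi t)))%:E)%E = Jp p g.
    by apply: eq_integral => t _; rewrite gphi.
  by rewrite ReC /Rintegral fineK E.
have cfF : cint (fun t => f t * conjc (fourier_partial K phi t)).
  apply: (cint_mul_bounded cf) (cmeas_conj mFp) _ => t.
  by rewrite cabs_conj; exact: cabs_fourier_partial.
have : (Jp p g <= (lam `^ p)%:E * Jp p f +
    ((lam^-1) `^ q)%:E * Jp q (fourier_partial K phi))%E.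
  apply: (le_trans JRe); rewrite (Cint_fourier_partial K cf cp).
  apply: (le_trans (Re_Cint_le cfF)).
  have mc1 : measurable_fun setT (fun t => cabs (f t) `^ p).
    by apply: measurable_powRT; exact: measurable_cabs.
  have mc2 : measurable_fun setT (fun t => cabs (fourier_partial K phi t) `^ q).
    by apply: measurable_powRT; exact: measurable_cabs.
  rewrite /Jp -!ge0_integral_scale ?powR_ge0//; last 2 first.
  - by move=> t; exact: powR_ge0.
  - by move=> t; exact: powR_ge0.
  rewrite -ge0_integral_add; last 4 first.
  - exact: measurable_funM.
  - exact: measurable_funM.
  - by move=> t; rewrite mulr_ge0 ?powR_ge0.
  - by move=> t; rewrite mulr_ge0 ?powR_ge0.
  apply: ge0_le_integralT.
  - by apply: measurable_cabs; exact: cint_cmeas cfF.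
  - by apply: measurable_funD; exact: measurable_funM.
  - by move=> t; exact: cabs_ge0.
  - by move=> t; rewrite cabsM cabs_conj; apply: young_scaled; rewrite ?cabs_ge0.
have pa : (0 <= (lam `^ p)%:E)%E by rewrite lee_fin powR_ge0.
have pb : (0 <= (lam^-1 `^ q)%:E)%E by rewrite lee_fin powR_ge0.
rewrite -(fineK Jfin).
move=> /le_trans/(_ (leeD (lee_wpmul2l pa fx) (lee_wpmul2l pb H1))).
rewrite -!EFinM -EFinD !lee_fin.
rewrite (mulrA (lam^-1 `^ q)) -[2 * _ * x]mulrA.
have X0 : 0 <= fine (Jp p g) by rewrite fine_ge0// Jp_ge0.
have := ler_wpM2r X0 lq.
by move: (fine _) (lam `^ p * x) (_ * B * _) => ? ? ?; lra.
Qed.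

Lemma fourier_partial_le p : 1 < p -> exists2 C : R, 0 <= C &
  forall K f (x : R), cmeas f -> per f -> (Jp p f <= x%:E)%E ->
  (Jp p (fourier_partial K f) <= (C * x)%:E)%E.
Proof.
move=> p1; have [p2|p2] := leP p 2; last exact: fourier_partial_gt2.
by apply: fourier_partial_le2; rewrite p1.
Qed.

End Duality.

(** * Continuity of translation in L^p *)

Section TranslationContinuity.
Variable R : realType.
Implicit Types (p e : R) (f g : R -> R[i]).
Local Notation muT := (@muT R).
Local Notation Re := (@complex.Re R).
Local Notation Im := (@complex.Im R).

(** Convergence is required only in the open interval: the point 0, where a periodized function may
    jump, is a null set. *)
Lemma Jp_dominated p (fs : nat -> R -> R[i]) (g : R -> R) : 0 < p ->
  (forall n, cmeas (fs n)) -> measurable_fun setT g ->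
  (\int[muT]_t (g t)%:E < +oo)%E ->
  (forall n t, cabs (fs n t) `^ p <= g t) ->
  (forall t, 0 < t < 1 -> forall e, 0 < e ->
    exists n0, forall n, (n0 <= n)%N -> cabs (fs n t) <= e) ->
  forall e, 0 < e -> exists n, (Jp p (fs n) <= e%:E)%E.
Proof.
move=> p0 mfs mg goo fg fcv e e0.
have g0 t : 0 <= g t by apply: le_trans (fg 0%N t); exact: powR_ge0.
have mf n : measurable_fun setT (fun t => (cabs (fs n t) `^ p)%:E).
  exact: measurable_cabs_powR.
have ig : muT.-integrable setT (EFin \o g).
  apply/integrableP; split; first exact/measurable_EFinP.
  by under eq_integral do rewrite /= ger0_norm//.
have cv : {ae muT, forall t, setT t ->
    (fun n => (cabs (fs n t) `^ p)%:E) @ \oo --> (cst 0%E : R -> \bar R) t}.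
  exists (~` `]0, 1[%classic); split.
  - by apply: measurableC; exact: measurable_itv.
  - rewrite /= /muT /mrestr /= (_ : ~` _ `&` _ = [set 0]).
      by rewrite lebesgue_measure_set1.
    apply/seteqP; split => t /=; rewrite /Tdom/= !in_itv/=.
      move=> [/negP h /andP[t0 t1]]; apply/eqP; rewrite eq_le t0 andbT leNgt.
      by apply/negP => t0'; move: h; rewrite t0' t1.
    by move=> ->; rewrite ltxx lexx ltr01.
  - move=> t /= H tin; apply: H => _; move: tin; rewrite /= in_itv/= => t01.
    apply: cvg_EFin; first by near=> n.
    apply/cvgrPdist_le => d d0 /=.
    have [n0 Hn] := fcv t t01 _ (powR_gt0 p^-1 d0).
    exists n0 => // n /= nn; rewrite sub0r normrN ger0_norm ?powR_ge0//.
    rewrite -[leRHS](powRr1 (ltW d0)) -(mulVf (lt0r_neq0 p0)) powRrM.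
    by apply: (ge0_ler_powR (ltW p0)); rewrite ?nnegrE ?cabs_ge0 ?powR_ge0// Hn.
have dom : {ae muT, forall t n, setT t -> (`|(cabs (fs n t) `^ p)%:E| <= (EFin \o g) t)%E}.
  by apply: aeW => t n _ /=; rewrite lee_fin ger0_norm ?powR_ge0.
have [_ _] := @dominated_convergence _ _ R muT setT measurableT (fun n t => (cabs (fs n t) `^ p)%:E) (cst 0%E) (EFin \o g) mf (measurable_cst _) cv ig dom.
rewrite integral0 => /fine_cvgP[_ /cvgrPdist_le/(_ e e0)[n0 _ Hn]].
exists n0; have := Hn n0 (leqnn _); rewrite /= sub0r normrN.
rewrite ger0_norm ?fine_ge0 ?Jp_ge0// => h.
rewrite -[leLHS]fineK ?lee_fin// ge0_fin_numE ?Jp_ge0//.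
apply: le_lt_trans goo; apply: ge0_le_integralT => //.
- by apply: measurable_powRT; exact: measurable_cabs.
- by move=> t; exact: powR_ge0.
Unshelve. all: by end_near. Qed.

Definition Lp_continuous p f := forall e, 0 < e -> exists m : nat,
  forall d : R, `|d| <= 2 ^- m -> (Jp p (fun t => (f t - f (t + d))%R) <= e%:E)%E.

(** f minus its translate is split into f - g, g minus its translate, and the translate of f - g,
    whose integral is that of f - g. *)
Lemma Lp_continuous_approx p f : 0 < p -> cmeas f -> per f ->
  (forall e, 0 < e -> exists g, [/\ cmeas g, per g, Lp_continuous p g &
    (Jp p (fun t => (f t - g t)%R) <= e%:E)%E]) ->
  Lp_continuous p f.
Proof.
move=> p0 mf pf H e e0; pose D : R := 2 `^ p.
have D0 : 0 < D by rewrite powR_gt0.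
(* Two nested uses of [JpD] bound the three terms by D (2 D + 1) e'. *)
pose e' := e / (D * (D * 2 + 1)).
have den : 0 < D * (D * 2 + 1) by rewrite mulr_gt0// ltr_wpDl// mulr_ge0// ltW.
have e'0 : 0 < e' by rewrite divr_gt0.
have [g [mg pg /(_ e' e'0)[m cg] fg]] := H e' e'0.
exists m => d dm.
have mfg : cmeas (fun t => f t - g t) by exact: cmeasB.
have pfg : per (fun t => f t - g t) by move=> t; rewrite pf pg.
have mgg : cmeas (fun t => g t - g (t + d)).
  by apply: cmeasB => //; exact: cmeas_shift.
have Js : (Jp p (fun t => (-1 * (f (t + d) - g (t + d)))%R) <= e'%:E)%E.
  rewrite (@eq_Jp _ p _ (fun t => f (t + d) - g (t + d))).
    by rewrite (Jp_shift p d mfg pfg).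
  by move=> t; rewrite mulN1r cabsN.
have ms : cmeas (fun t => -1 * (f (t + d) - g (t + d))).
  by apply: cmeasM; [exact: cmeas_cst|exact: (cmeas_shift d mfg)].
rewrite (_ : (fun t => _) = (fun t => ((f t - g t) + (g t - g (t + d))) +
    -1 * (f (t + d) - g (t + d)))); last by apply/funext => t; ring.
have := JpD_le (ltW p0) (cmeasD mfg mgg) ms (JpD_le (ltW p0) mfg mgg fg (cg d dm)) Js.
move=> /le_trans; apply; rewrite lee_fin -/D.
rewrite (_ : D * _ = e' * (D * (D * 2 + 1))); last by ring.
by rewrite divfK// gt_eqF.
Qed.

Definition clamp (M y : R) : R := Num.max (- M) (Num.min y M).

Lemma clamp_bound M y : 0 <= M -> `|clamp M y| <= M.
Proof.
move=> M0; rewrite ler_norml /clamp le_max lexx/= ge_max ge_min lexx orbT andbT.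
by rewrite (le_trans _ M0)// oppr_le0.
Qed.

Lemma clamp_id M y : `|y| <= M -> clamp M y = y.
Proof.
rewrite ler_norml => /andP[h1 h2]; rewrite /clamp min_l//.
by rewrite max_r.
Qed.

Lemma clamp_lip M y z : 0 <= M -> `|clamp M y - clamp M z| <= `|y - z|.
Proof.
move=> M0.
have cE x : [\/ x <= - M /\ clamp M x = - M, M <= x /\ clamp M x = M |
    clamp M x = x /\ - M <= x <= M].
  have [h1|h1] := leP x (- M).
    by apply: Or31; split => //; rewrite /clamp max_l// ge_min h1.
  have [h2|h2] := leP M x.
    by apply: Or32; split => //; rewrite /clamp min_r// max_r//; lra.
  apply: Or33; rewrite clamp_id; first by rewrite !ltW.
  by rewrite ler_norml !ltW.
have h5 := ler_norm (y - z); have := ler_norm (z - y); rewrite distrC => h6.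
rewrite ler_norml.
by case: (cE y) => [[h1 ->]|[h1 ->]|[-> /andP[h1 h1']]];
  case: (cE z) => [[h2 ->]|[h2 ->]|[-> /andP[h2 h2']]];
  apply/andP; split; move: h5 h6; set w := `|_|; lra.
Qed.

(** Truncated functions on [0, 1) continued with period 1: even for continuous [g1] and [g2] the
    result may jump at the integers. *)
Definition clamped (M : R) (g1 g2 : R -> R) (t : R) : R[i] :=
  (clamp M (g1 (modT t)) +i* clamp M (g2 (modT t)))%C.

Lemma measurable_clamp M : measurable_fun setT (clamp M).
Proof. by apply: measurable_maxr => //; exact: measurable_minr. Qed.

Lemma measurable_clamp_cont M (g : R -> R) : continuous g ->
  measurable_fun setT (fun t => clamp M (g (modT t))).
Proof.
move=> cg; apply: (measurableT_comp (measurable_clamp M)).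
apply: (measurableT_comp _ (@measurable_modT R)).
exact: continuous_measurable_fun.
Qed.

(** If continuity failed at some e, there would be bad translations d m with |d m| <= 2^-m;
    dominated convergence along them gives a contradiction. *)
Lemma Lp_continuous_clamp p (M : R) (g1 g2 : R -> R) : 0 < p -> 0 <= M ->
  continuous g1 -> continuous g2 ->
  Lp_continuous p (clamped M g1 g2).
Proof.
move=> p0 M0 c1 c2 e e0; set G := clamped M g1 g2.
have mG : cmeas G by split; exact: measurable_clamp_cont.
apply: contrapT => H.
have Hd m : exists d : R, `|d| <= 2 ^- m /\
    (e%:E < Jp p (fun t => (G t - G (t + d))%R))%E.
  apply: contrapT => nd; apply: H; exists m => d dm; rewrite leNgt.
  by apply/negP => h; apply: nd; exists d.
pose d m := projT1 (cid (Hd m)).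
have dm m : `|d m| <= 2 ^- m by have [] := projT2 (cid (Hd m)).
have Jd m : (e%:E < Jp p (fun t => (G t - G (t + d m))%R))%E.
  by have [] := projT2 (cid (Hd m)).
have GM t : cabs (G t) <= 2 * M.
  apply: (le_trans (cabs_le_ReIm _)) => /=.
  by have := clamp_bound (g1 (modT t)) M0; have := clamp_bound (g2 (modT t)) M0; lra.
have Mfin : (\int[muT]_t ((4 * M) `^ p)%:E < +oo)%E.
  by rewrite integral_cst// [X in (_ * X)%E]probability_setT mule1 ltry.
have dom n t : cabs (G t - G (t + d n)) `^ p <= (4 * M) `^ p.
  apply: (ge0_ler_powR (ltW p0)); rewrite ?nnegrE ?cabs_ge0 ?(mulr_ge0 _ M0)//.
  by apply: (le_trans (cabsB _ _)); have := GM t; have := GM (t + d n); lra.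
suff cv0 : forall t, 0 < t < 1 -> forall a, 0 < a -> exists n0, forall n,
    (n0 <= n)%N -> cabs (G t - G (t + d n)) <= a.
  have [n] := @Jp_dominated p (fun m t => G t - G (t + d m)) (fun=> (4 * M) `^ p) p0
    (fun n => cmeasB mG (cmeas_shift (d n) mG)) (measurable_cst _) Mfin dom cv0 e e0.
  by rewrite leNgt Jd.
move=> t /andP[t0 t1] a a0.
have cvg_d (g : R -> R) : continuous g -> exists n0, forall n, (n0 <= n)%N ->
    `|g t - g (t + d n)| <= a / 2.
  move=> cg; have a2 : 0 < a / 2 by rewrite divr_gt0.
  have := cg t; move=> /cvgrPdist_le/(_ _ a2) /= /nbhs_ballP[b /= b0 Hb].
  have [n0 Hn0] : exists n0, 2 ^- n0 < b.
    exists (Num.bound b^-1); rewrite invf_plt ?posrE ?exprn_gt0//.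
    apply: lt_le_trans (archi_boundP _) _; first by rewrite invr_ge0 ltW.
    by rewrite -natrX ler_nat ltnW// ltn_expl.
  exists n0 => n nn; apply: Hb; rewrite /ball/= opprD addNKr normrN.
  apply: le_lt_trans Hn0; apply: (le_trans (dm n)).
  by rewrite lef_pV2 ?posrE ?exprn_gt0// ler_weXn2l// ler1n.
have [n1 H1] := cvg_d g1 c1; have [n2 H2] := cvg_d g2 c2.
(* Small translations of an interior point do not wrap around, so continuity of [g1] and [g2] on the
   line applies. *)
have [n3 H3] : exists n0, forall n, (n0 <= n)%N -> modT (t + d n) = t + d n.
  have mn : 0 < Num.min t (1 - t) by rewrite lt_min t0 subr_gt0.
  exists (Num.bound (Num.min t (1 - t))^-1) => n nn; apply: modT_id.
  have : `|d n| < Num.min t (1 - t).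
    apply: (le_lt_trans (dm n)); rewrite invf_plt ?posrE ?exprn_gt0//.
    apply: lt_le_trans (archi_boundP _) _; first by rewrite invr_ge0 ltW.
    rewrite -natrX ler_nat (leq_trans nn)// ltnW// ltn_expl//.
  rewrite lt_min !ltr_norml => /andP[/andP[h1 h2] /andP[h3 h4]].
  by rewrite /Tdom/= in_itv/=; apply/andP; split; lra.
exists (maxn n1 (maxn n2 n3)) => n; rewrite !geq_max => /and3P[h1 h2 h3].
have tT : modT t = t by apply: modT_id; rewrite /Tdom/= in_itv/= (ltW t0) t1.
apply: (le_trans (cabs_le_ReIm _)); rewrite ReB ImB /G /= (H3 n h3) tT.
have := le_trans (clamp_lip _ _ M0) (H1 n h1).
have := le_trans (clamp_lip _ _ M0) (H2 n h2); lra.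
Qed.

(** Turns L^1 closeness into L^p closeness for uniformly bounded functions. *)
Lemma powR_le_bounded p (B y : R) : 1 <= p -> 0 <= y <= B ->
  y `^ p <= B `^ (p - 1) * y.
Proof.
move=> p1 /andP[y0 yB]; rewrite -(mulr_powRB1 y0) ?(lt_le_trans ltr01)// mulrC.
apply: ler_wpM2r => //; apply: ge0_ler_powR; rewrite ?nnegrE ?subr_ge0//.
exact: le_trans yB.
Qed.

(** The real and imaginary parts are approximated in L^1 by continuous functions. Clamping these at
    M does not increase the distance, since it is 1-Lipschitz and fixes the values of f; with
    everything bounded, L^1 closeness gives L^p closeness. *)
Lemma Lp_continuous_bounded p f (M : R) : 1 < p -> 0 <= M -> cmeas f -> per f ->
  (forall t, `|Re (f t)| <= M) -> (forall t, `|Im (f t)| <= M) ->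
  Lp_continuous p f.
Proof.
move=> p1 M0 mf pf RM IM; have p0 : 0 < p by lra.
apply: Lp_continuous_approx => // e e0.
have approx (u : R -> R) (a : R) : 0 < a -> measurable_fun setT u ->
    (forall t, `|u t| <= M) -> exists2 g, continuous g &
    (\int[muT]_t (`|u t - clamp M (g (modT t))| )%:E <= a%:E)%E.
  move=> a0 mu uM.
  have iu : (@lebesgue_measure R).-integrable (@Tdom R) (EFin \o u).
    have mTu : measurable_fun (@Tdom R) (EFin \o u).
      by apply/measurable_EFinP; exact: measurable_funTS.
    apply/integrableP; split => //.
    apply: (@le_lt_trans _ _ (\int[@lebesgue_measure R]_(t in @Tdom R) (cst M%:E) t)%E).
      apply: ge0_le_integral => //.
      - exact: measurable_Tdom.
      - exact: measurableT_comp.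
      - by move=> t _ /=; rewrite lee_fin.
    rewrite integral_cst; last exact: measurable_Tdom.
    by rewrite [X in (_ * X)%E]lebesgue_Tdom mule1 ltry.
  have foo : (@lebesgue_measure R (@Tdom R) < +oo)%E by rewrite lebesgue_Tdom ltry.
  have [g [cg ig /fine_cvgP[_ /cvgrPdist_le/(_ a a0)[n _ Hn]]]] :=
    @approximation_continuous_integrable R (@Tdom R) u (@measurable_Tdom R) foo iu.
  have cgn := cg n; exists (g n) => //.
  have mgn := measurable_clamp_cont M cgn.
  have mabs : measurable_fun setT (fun t => `|u t - clamp M (g n (modT t))|).
    by apply: measurableT_comp => //; exact: measurable_funB.
  rewrite integral_muT; last exact/measurable_EFinP.
  have mTg : measurable_fun (@Tdom R) (g n).
    by apply: measurable_funTS; exact: continuous_measurable_fun.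
  apply: (@le_trans _ _ (\int[@lebesgue_measure R]_(t in @Tdom R) `|(u t - g n t)%:E|)%E).
    apply: ge0_le_integral => //; first exact: measurable_Tdom.
    - by apply/measurable_EFinP; exact: measurable_funTS.
    - apply: measurableT_comp => //; apply/measurable_EFinP.
      by apply: measurable_funB => //; exact: measurable_funTS.
    - move=> t Tt; rewrite lee_fin (modT_id Tt) -[u t in leLHS](clamp_id (uM t)).
      exact: clamp_lip.
  have := Hn n (leqnn n); rewrite /= sub0r normrN.
  rewrite ger0_norm; last by apply: fine_ge0; apply: integral_ge0 => t _; rewrite lee_fin.
  rewrite -lee_fin fineK// ge0_fin_numE; last by apply: integral_ge0 => t _; rewrite lee_fin.
  have : (@lebesgue_measure R).-integrable (@Tdom R) (fun t => (u t - g n t)%:E).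
    under eq_fun do rewrite EFinB.
    by apply: integrableB; [exact: measurable_Tdom|exact: iu|exact: ig].
  by move=> /integrableP[].
(* 2^p comes from [powR_le2] and the power of 2 M + 1 from [powR_le_bounded]; the added 1 keeps D
   positive when M = 0. *)
pose D : R := 2 `^ p * (2 * M + 1) `^ (p - 1).
have D0 : 0 < D by rewrite mulr_gt0// powR_gt0//; lra.
pose a := e / (2 * D); have a0 : 0 < a by rewrite divr_gt0// mulr_gt0.
have [mR mI] := mf.
have [g1 c1 H1] := approx _ a a0 mR RM.
have [g2 c2 H2] := approx _ a a0 mI IM.
have m1 := measurable_clamp_cont M c1; have m2 := measurable_clamp_cont M c2.
exists (clamped M g1 g2); split; [by split| | exact: Lp_continuous_clamp|].
  by move=> t; rewrite /clamped -[t in modT (modT t)]addr0 -[modT t in RHS]addr0 ?modTDl ?addr0 modT_id//; exact: modT_dom.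
set A := fun t => `|Re (f t) - clamp M (g1 (modT t))|.
set B := fun t => `|Im (f t) - clamp M (g2 (modT t))|.
have mA : measurable_fun setT A by apply: measurableT_comp => //; exact: measurable_funB.
have mB : measurable_fun setT B by apply: measurableT_comp => //; exact: measurable_funB.
have A0 t : 0 <= A t by exact: normr_ge0.
have B0 t : 0 <= B t by exact: normr_ge0.
have Ab t : A t <= 2 * M + 1.
  by apply: (le_trans (ler_normB _ _)); have := RM t; have := clamp_bound (g1 (modT t)) M0; lra.
have Bb t : B t <= 2 * M + 1.
  by apply: (le_trans (ler_normB _ _)); have := IM t; have := clamp_bound (g2 (modT t)) M0; lra.
apply: (@le_trans _ _ (\int[muT]_t (D * (A t + B t))%:E)%E).
  apply: ge0_le_integralT.
  - by apply: measurable_powRT; apply: measurable_cabs; apply: cmeasB => //; split.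
  - by apply: measurable_funM => //; exact: measurable_funD.
  - by move=> t; exact: powR_ge0.
  - move=> t; apply: (@le_trans _ _ ((A t + B t) `^ p)).
      apply: (ge0_ler_powR (ltW p0)); rewrite ?nnegrE ?cabs_ge0 ?addr_ge0//.
      by apply: (le_trans (cabs_le_ReIm _)); rewrite ReB ImB.
    apply: (le_trans (powR_le2 (ltW p0) (A0 t) (B0 t))).
    rewrite /D -mulrA ler_wpM2l ?powR_ge0// mulrDr.
    by apply: lerD; apply: powR_le_bounded; rewrite ?(ltW p1) ?A0 ?B0 ?Ab ?Bb.
rewrite ge0_integral_scale ?(ltW D0)//; last 2 first.
- exact: measurable_funD.
- by move=> t; rewrite addr_ge0.
rewrite ge0_integral_add//.
apply: (@le_trans _ _ (D%:E * (a%:E + a%:E))%E).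
  by apply: lee_wpmul2l; [rewrite lee_fin ltW|exact: leeD].
rewrite -EFinD -EFinM lee_fin /a (_ : D * _ = e)//.
by field; rewrite gt_eqF.
Qed.

(** Truncations of f are bounded and come arbitrarily close to f in L^p, by domination with 4^p
    |f|^p. *)
Lemma Lp_continuous_finite p f : 1 < p -> cmeas f -> per f ->
  (Jp p f < +oo)%E -> Lp_continuous p f.
Proof.
move=> p1 mf pf Jf; have p0 : 0 < p by lra.
apply: Lp_continuous_approx => // e e0.
have [mR mI] := mf.
pose fM (n : nat) t : R[i] := (clamp n%:R (Re (f t)) +i* clamp n%:R (Im (f t)))%C.
have mfM n : cmeas (fM n).
  by split; apply: (measurableT_comp (measurable_clamp _)).
have c0 n (y : R) : `|y - clamp n%:R y| <= 2 * `|y|.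
  apply: (le_trans (ler_normB _ _)).
  have := clamp_lip y 0 (ler0n R n); rewrite (@clamp_id _ 0) ?normr0// !subr0; lra.
have [n Hn] : exists n, (Jp p (fun t => (f t - fM n t)%R) <= e%:E)%E.
  have mg : measurable_fun setT (fun t => 4 `^ p * cabs (f t) `^ p).
    by apply: measurable_funM => //; apply: measurable_powRT; exact: measurable_cabs.
  apply: (@Jp_dominated p (fun n t => f t - fM n t) (fun t => 4 `^ p * cabs (f t) `^ p)) => //.
  - by move=> n; exact: cmeasB.
  - rewrite ge0_integral_scale ?powR_ge0//; last first.
      by move=> t; exact: powR_ge0.
      by apply: measurable_powRT; exact: measurable_cabs.
    by apply: lte_mul_pinfty => //; rewrite lee_fin powR_ge0.
  - move=> n t; rewrite -powRM ?cabs_ge0//.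
    apply: (ge0_ler_powR (ltW p0)); rewrite ?nnegrE ?mulr_ge0 ?cabs_ge0//.
    apply: (le_trans (cabs_le_ReIm _)); rewrite ReB ImB /=.
    have := c0 n (Re (f t)); have := c0 n (Im (f t)).
    have := ler_abs_Re (f t); have := ler_abs_Im (f t); lra.
  - move=> t _ d d0; exists (Num.bound (cabs (f t))) => n nn.
    have fn : cabs (f t) <= n%:R.
      apply: le_trans (ltW (archi_boundP (cabs_ge0 (f t)))) _.
      by rewrite ler_nat.
    rewrite (_ : f t - fM n t = 0) ?cabs0 ?ltW//.
    apply: complex_eq; rewrite ?ReB ?ImB /= clamp_id ?subrr//.
      exact: le_trans (ler_abs_Re _) fn.
    exact: le_trans (ler_abs_Im _) fn.
exists (fM n); split => //.
- by move=> t; rewrite /fM pf.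
- apply: (@Lp_continuous_bounded p (fM n) n%:R) => //.
  + by move=> t; rewrite /fM pf.
  + by move=> t; exact: clamp_bound.
  + by move=> t; exact: clamp_bound.
Qed.

End TranslationContinuity.

(** * Step functions *)

Section StepApproximation.
Variable R : realType.
Implicit Types (p w h t : R) (f : R -> R[i]) (K : nat).
Local Notation muT := (@muT R).

Lemma measurable_boolR disp (T : measurableType disp) (b : T -> bool) :
  measurable_fun setT b -> measurable_fun setT (fun x => (b x)%:R : R).
Proof.
move=> mb; rewrite (_ : (fun x => _) = (fun x => if b x then 1 else 0 : R)).
  exact: measurable_fun_ifT.
by apply/funext => x; case: (b x).
Qed.

Definition arc (a b : R) (t : R) : R := (a <= modT t < b)%R%:R.

Lemma arc_ge0 a b t : 0 <= arc a b t. Proof. exact: ler0n. Qed.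

Lemma measurable_arc a b : measurable_fun setT (arc a b).
Proof.
apply: (@measurable_boolR _ _ (fun t => a <= modT t < b)).
by apply: measurable_and; [apply: measurable_fun_ler|apply: measurable_fun_ltr] => //;
  exact: measurable_modT.
Qed.

Lemma integral_arc a b : 0 <= a -> a <= b -> b <= 1 ->
  (\int[muT]_t (arc a b t)%:E = (b - a)%:E)%E.
Proof.
move=> a0 ab b1; rewrite integral_muT; last first.
  by apply/measurable_EFinP; exact: measurable_arc.
rewrite (_ : (\int[_]_(t in _) _)%E =
    (\int[@lebesgue_measure R]_(t in @Tdom R) (\1_(`[a, b[%classic) t)%:E)%E); last first.
  apply: eq_integral => t; rewrite inE => Tt; rewrite /arc (modT_id Tt) indicE.
  by rewrite mem_setE in_itv.
rewrite integral_indic ?setIidl//; last exact: measurable_Tdom.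
  transitivity (@lebesgue_measure R [set` `[a, b[]); first by [].
  rewrite lebesgue_measure_itv/= lte_fin; case: ltP => // ba.
  by rewrite (@le_anti _ _ a b) ?ab ?ba// subrr.
move=> t /=; rewrite /Tdom/= !in_itv/= => /andP[h1 h2].
by rewrite (le_trans a0 h1) (lt_le_trans h2 b1).
Qed.

(** A sum of two indicators, not the indicator of a union: the mass is 2 h even when the arcs
    overlap, as they do for a single cell, h = 1. *)
Definition near0 h t : R := arc 0 h t + arc (1 - h) 1 t.

Lemma near0_ge0 h t : 0 <= near0 h t.
Proof. by rewrite addr_ge0// arc_ge0. Qed.

Lemma per_arc a b : per (arc a b).
Proof. by move=> t; rewrite /arc (modT_id (modT_dom t)). Qed.

Lemma arc_near0 h u t : 0 <= u < h -> arc 0 h (t + u) <= near0 h t.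
Proof.
move=> /andP[u0 uh]; have m0 := modT_ge0 t; have m1 := modT_lt1 t.
rewrite /near0 /arc -modTDl m0 m1 modT_ge0 /= andbT.
have [h1|h1] := ltP (modT t) h; first by rewrite ler_wpDr// lern1 leq_b1.
have [h2|h2] := leP (1 - h) (modT t); first by rewrite add0r lern1 leq_b1.
rewrite modT_id; last by rewrite /Tdom/= in_itv/=; apply/andP; split; lra.
by rewrite ltNge (le_trans h1) ?lerDl// addr0.
Qed.

Lemma measurable_near0 h : measurable_fun setT (near0 h).
Proof. by apply: measurable_funD; exact: measurable_arc. Qed.

Lemma integral_near0 h : 0 <= h <= 1 -> (\int[muT]_t (near0 h t)%:E = (h + h)%:E)%E.
Proof.
move=> /andP[h0 h1]; rewrite (ge0_integral_add (@measurable_arc _ _) (@measurable_arc _ _)); last 2 first.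
- by move=> t; exact: arc_ge0.
- by move=> t; exact: arc_ge0.
rewrite (@integral_arc 0 h)// (@integral_arc (1 - h) 1) ?subr_ge0//; last by rewrite lerBlDl lerDr.
by rewrite subr0 subKr.
Qed.




(** Where [near0] is nonzero, d is within h of an integer, and by periodicity that integer can be
    removed from the translation. *)
Lemma near0_translate p h w f d : per f -> near0 h d != 0 ->
  (forall d', `|d'| <= h -> (Jp p (fun t => (f t - f (t + d'))%R) <= w%:E)%E) ->
  (Jp p (fun t => (f t - f (t + d))%R) <= w%:E)%E.
Proof.
move=> pf nd H.
have E (k : int) : (fun t => f t - f (t + d)) = (fun t => f t - f (t + (d + k%:~R))).
  by apply/funext => t; rewrite addrA perDz.
pose l := Num.floor d; have m0 := modT_ge0 d; have m1 := modT_lt1 d.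
have mE : modT d = d + (- l)%:~R by rewrite /modT intrN.
have [h1|h1] := ltP (modT d) h.
  by rewrite (E (- l)) -mE; apply: H; rewrite ger0_norm// ltW.
have [h2|h2] := leP (1 - h) (modT d).
  rewrite (E (- l - 1)) intrD addrA -mE; apply: H.
  by rewrite ler0_norm; move: m0 m1 h1 h2; rewrite ?mulrNz ?intrN /=; set m := modT d; lra.
by move: nd; rewrite /near0 /arc m0 m1 ltNge h1 leNgt h2 /= addr0 eqxx.
Qed.

Definition cell K t : R := (Num.floor (K%:R * modT t))%:~R / K%:R.

Lemma measurable_cell K : measurable_fun setT (cell K).
Proof.
apply: measurable_funM => //.
have mfl : measurable_fun setT (fun x : R => (Num.floor x)%:~R : R).
  by apply: nondecreasing_measurable => // x y xy; rewrite ler_int le_floor.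
apply: (measurableT_comp mfl); apply: measurable_funM => //.
exact: measurable_modT.
Qed.

Lemma cell_bounds K t : (0 < K)%N -> cell K t <= modT t < cell K t + K%:R^-1.
Proof.
move=> K0; have K0' : 0 < K%:R :> R by rewrite ltr0n.
rewrite /cell ler_pdivrMr// mulrC floor_le /= -[X in _ + X]mul1r -mulrDl.
by rewrite ltr_pdivlMr// mulrC; have := floorD1_gt (K%:R * modT t); rewrite intrD.
Qed.

Lemma per_cell K : per (cell K).
Proof. by move=> t; rewrite /cell (modT_id (modT_dom t)). Qed.

Lemma measurable_cabs_powR2 disp (T : measurableType disp) p f (a b : T -> R) : cmeas f ->
  measurable_fun setT a -> measurable_fun setT b ->
  measurable_fun setT (fun z => cabs (f (a z) - f (b z)) `^ p).
Proof.
move=> [m1 m2] ma mb; apply: (measurableT_comp (measurable_powR _)).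
rewrite (_ : (fun z => _) = (fun z => Num.sqrt
  ((complex.Re (f (a z)) - complex.Re (f (b z))) ^+ 2 +
   (complex.Im (f (a z)) - complex.Im (f (b z))) ^+ 2))); last first.
  by apply/funext => z; rewrite cabsE ReB ImB.
apply: (measurableT_comp (@continuous_measurable_fun _ _ (@sqrt_continuous R))).
by apply: measurable_funD; apply: measurable_funX; apply: measurable_funB;
  solve [exact: (measurableT_comp m1)|exact: (measurableT_comp m2)].
Qed.

(* Averaging over d in [0, 1/K) shows that one of the step functions
   t |-> f (cell K t + d) is close to f. *)
Lemma step_approx p w f K : 0 < p -> 0 < w -> (0 < K)%N -> cmeas f -> per f ->
  (forall d, `|d| <= K%:R^-1 -> (Jp p (fun t => (f t - f (t + d))%R) <= w%:E)%E) ->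
  exists d, (Jp p (fun t => (f t - f (cell K t + d))%R) <= (3 * w)%:E)%E.
Proof.
move=> p0 w0 K0 mf pf Hw; apply: contrapT => nd.
set h : R := K%:R^-1; have h01 : 0 < h <= 1.
  by rewrite invr_gt0 ltr0n K0 invf_le1 ?ltr0n// ler1n.
have [h0 h1] := andP h01.
(* G records translations of f by d near 0, and H the error of sampling at cell K t + d for d in [0,
   h). *)
pose G (z : R * R) : R := cabs (f z.1 - f (z.1 + z.2)) `^ p * near0 h z.2.
pose H (z : R * R) : R := arc 0 h z.2 * cabs (f z.1 - f (cell K z.1 + z.2)) `^ p.
have mG : measurable_fun setT (EFin \o G).
  apply/measurable_EFinP; apply: measurable_funM.
    by apply: measurable_cabs_powR2 => //; exact: measurable_funD.
  by apply: (measurableT_comp (measurable_near0 h)).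
have mH : measurable_fun setT (EFin \o H).
  apply/measurable_EFinP; apply: measurable_funM.
    by apply: (measurableT_comp (measurable_arc 0 h)).
  apply: measurable_cabs_powR2 => //; apply: measurable_funD => //.
  exact: (measurableT_comp (measurable_cell K)).
have G0 z : (0 <= (EFin \o G) z)%E by rewrite lee_fin mulr_ge0 ?powR_ge0 ?near0_ge0.
have H0 z : (0 <= (EFin \o H) z)%E by rewrite lee_fin mulr_ge0 ?powR_ge0 ?arc_ge0.
have mG1 t : measurable_fun setT (fun d => (G (t, d))%:E).
  by apply: (measurableT_comp mG); exact: measurable_pair1.
have mH1 t : measurable_fun setT (fun d => (H (t, d))%:E).
  by apply: (measurableT_comp mH); exact: measurable_pair1.
have mG2 d : measurable_fun setT (fun t => (G (t, d))%:E).
  by apply: (measurableT_comp mG); exact: measurable_pair2.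
have mH2 d : measurable_fun setT (fun t => (H (t, d))%:E).
  by apply: (measurableT_comp mH); exact: measurable_pair2.
(* Adding t - cell K t to d turns the sampling point into t + d. This offset lies in [0, h), so the
   condition that the old variable is in [0, h) places the new one in the support of [near0 h]. *)
have HG t : (\int[muT]_d (H (t, d))%:E <= \int[muT]_d (G (t, d))%:E)%E.
  rewrite -(@ge0_integralT_shift _ (modT t - cell K t) (fun d => (H (t, d))%:E)) //; last 2 first.
  - by move=> d; exact: (H0 (t, d)).
  - move=> d; rewrite /H /= per_arc; congr (_ * cabs (_ - _) `^ _)%:E.
    by rewrite [in LHS]addrC -[LHS]pf modTDl pf addrC.
  apply: ge0_le_integral => //.
  - by move=> d _; exact: (H0 (t, _)).
  - exact: (measurable_shift (modT t - cell K t) (mH1 t)).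
  - exact: mG1.
  - move=> d _; rewrite lee_fin /H /G /=.
    have -> : cell K t + (d + (modT t - cell K t)) = modT t + d by ring.
    rewrite -[f (modT t + d)]pf modTDl pf mulrC.
    apply: ler_wpM2l; first exact: powR_ge0.
    apply: arc_near0; have /andP[c1 c2] := cell_bounds t K0.
    by rewrite subr_ge0 c1 ltrBlDl.
have HGI : (\int[muT]_d \int[muT]_t (H (t, d))%:E <= \int[muT]_d \int[muT]_t (G (t, d))%:E)%E.
  rewrite -[leLHS](@fubini_tonelli _ _ _ _ R muT muT (EFin \o H) mH H0).
  rewrite -[leRHS](@fubini_tonelli _ _ _ _ R muT muT (EFin \o G) mG G0).
  apply: ge0_le_integral => //.
  - by move=> t _; apply: integral_ge0 => d _; exact: (H0 (t, d)).
  - exact: (@measurable_fun_fubini_tonelli_F _ _ _ _ R muT (EFin \o H)).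
  - exact: (@measurable_fun_fubini_tonelli_F _ _ _ _ R muT (EFin \o G)).
  - by move=> t _; exact: HG.
have GI : (\int[muT]_d \int[muT]_t (G (t, d))%:E <= (w * (h + h))%:E)%E.
  apply: (@le_trans _ _ (\int[muT]_d (w * near0 h d)%:E)%E).
    apply: ge0_le_integral => //.
    - by move=> d _; apply: integral_ge0 => t _; exact: (G0 (t, d)).
    - exact: (@measurable_fun_fubini_tonelli_G _ _ _ _ R muT (EFin \o G)).
    - by apply/measurable_EFinP; apply: measurable_funM => //; exact: measurable_near0.
    - move=> d _; under eq_integral do rewrite /G /= mulrC.
      rewrite ge0_integral_scale ?near0_ge0//; last 2 first.
      + by apply: measurable_cabs_powR2 => //; exact: measurable_funD.
      + by move=> t; exact: powR_ge0.
      have [->|nd0] := eqVneq (near0 h d) 0; first by rewrite mul0e mulr0.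
      rewrite mulrC EFinM; apply: lee_wpmul2l; first by rewrite lee_fin near0_ge0.
      exact: near0_translate nd0 Hw.
  rewrite ge0_integral_scale ?(ltW w0)//; [|exact: measurable_near0|exact: near0_ge0].
  by rewrite integral_near0// (ltW h0).
(* If every d gave an error above 3 w, the integral of H would be at least 3 w h, more than the 2 w
   h allowed by the mass of [near0 h]. *)
have HI : ((3 * w * (h - 0))%:E <= \int[muT]_d \int[muT]_t (H (t, d))%:E)%E.
  rewrite EFinM -(integral_arc (lexx 0) (ltW h0) h1).
  have w3 : 0 <= 3 * w by rewrite mulr_ge0// ltW.
  rewrite -(ge0_integral_scale w3 (@measurable_arc 0 h) (arc_ge0 0 h)).
  apply: ge0_le_integral => //.
  - by move=> d _; rewrite lee_fin mulr_ge0// arc_ge0.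
  - by apply/measurable_EFinP; apply: measurable_funM => //; exact: measurable_arc.
  - exact: (@measurable_fun_fubini_tonelli_G _ _ _ _ R muT (EFin \o H)).
  - move=> d _; rewrite /H /=.
    rewrite ge0_integral_scale ?arc_ge0//; last 2 first.
    + apply: measurable_cabs_powR2 => //; apply: measurable_funD => //.
      exact: measurable_cell.
    + by move=> t; exact: powR_ge0.
    rewrite mulrC EFinM; apply: lee_wpmul2l; first by rewrite lee_fin arc_ge0.
    by rewrite leNgt; apply/negP => /ltW hd; apply: nd; exists d.
have := le_trans HI (le_trans HGI GI).
rewrite lee_fin subr0; have : 0 < w * h by rewrite mulr_gt0.
rewrite mulrDr -mulrA; set x := w * h; lra.
Qed.

End StepApproximation.

(** * Translating step functions *)

Section StepTranslation.
Variable R : realType.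
Implicit Types (p w h t d x : R) (f g : R -> R[i]) (K : nat).
Local Notation muT := (@muT R).

Definition in_cell K k t : bool := (k%:R / K%:R <= modT t) && (modT t < k.+1%:R / K%:R).

Lemma in_cellE K k t : (in_cell K k t)%:R = arc (k%:R / K%:R) (k.+1%:R / K%:R) t.
Proof. by []. Qed.

Lemma cell_index K t : (0 < K)%N -> exists k : 'I_K, in_cell K k t.
Proof.
move=> K0; have K0' : 0 < K%:R :> R by rewrite ltr0n.
have fl0 : 0 <= Num.floor (K%:R * modT t).
  by rewrite floor_ge0 mulr_ge0// modT_ge0.
have E : (absz (Num.floor (K%:R * modT t)))%:R = (Num.floor (K%:R * modT t))%:~R :> R.
  by rewrite natr_absz ger0_norm.
have bd := cell_bounds t K0; rewrite /cell -E in bd.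
have kK : (absz (Num.floor (K%:R * modT t)) < K)%N.
  rewrite -(ltr_nat R) E; apply: (le_lt_trans (floor_le _)).
  by rewrite -[ltRHS]mulr1 ltr_pM2l// modT_lt1.
exists (Ordinal kK); rewrite /in_cell /= -[X in _ < X]/(_ / _) mulrS mulrDl mul1r addrC.
exact: bd.
Qed.

Lemma cell_inj K (s : R) (j k : 'I_K) : (j%:R / K%:R <= s) && (s < j.+1%:R / K%:R) ->
  (k%:R / K%:R <= s) && (s < k.+1%:R / K%:R) -> j = k.
Proof.
move=> /andP[j1 j2] /andP[k1 k2].
have K0 : 0 < K%:R^-1 :> R by rewrite invr_gt0 ltr0n (leq_ltn_trans _ (ltn_ord k)).
have := le_lt_trans j1 k2; rewrite ltr_pM2r// ltr_nat ltnS => jk.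
have := le_lt_trans k1 j2; rewrite ltr_pM2r// ltr_nat ltnS => kj.
by apply/val_inj/anti_leq; rewrite jk kj.
Qed.

Lemma sum_cell (V : nzRingType) K (a : 'I_K -> V) t (k : 'I_K) : in_cell K k t ->
  \sum_(j < K) a j * (in_cell K j t)%:R = a k.
Proof.
move=> tk; rewrite (bigD1 k)//= tk mulr1 big1 ?addr0// => j jk.
suff -> : in_cell K j t = false by rewrite mulr0.
by apply/negP => tj; move/eqP: jk; apply; exact: cell_inj tj tk.
Qed.

Lemma measurable_in_cell K k : measurable_fun setT (fun t => (in_cell K k t)%:R : R).
Proof. by under eq_fun do rewrite in_cellE; exact: measurable_arc. Qed.

Lemma is_step_modT K g (c : 'I_K -> R[i]) t (k : 'I_K) :
  (forall (k : 'I_K) t, k%:R / K%:R <= t -> t < k.+1%:R / K%:R -> g t = c k) ->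
  in_cell K k t -> g (modT t) = c k.
Proof. by move=> gc /andP[]; exact: gc. Qed.

Lemma cmeas_step K g : (0 < K)%N -> is_step K g -> cmeas (fun t => g (modT t)).
Proof.
move=> K0 [c gc].
rewrite (_ : (fun t => _) = (fun t => \sum_(j < K) c j * (in_cell K j t)%:R%:C%C)).
  apply: cmeas_sum => j; apply: cmeasM; first exact: cmeas_cst.
  by apply: cmeas_real; exact: measurable_in_cell.
apply/funext => t; have [k tk] := cell_index t K0.
rewrite (is_step_modT gc tk) -(sum_cell c tk); apply: eq_bigr => j _.
by case: (in_cell K j t).
Qed.

Lemma is_step_cell K f d : (0 < K)%N -> is_step K (fun t => f (cell K t + d)).
Proof.
move=> K0; have K0' : 0 < K%:R :> R by rewrite ltr0n.
exists (fun k => f (k%:R / K%:R + d)) => k t t1 t2; congr (f (_ / _ + _)).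
have tT : Tdom t.
  rewrite /Tdom/= in_itv/= (le_trans _ t1) ?divr_ge0//=.
  by apply: (lt_le_trans t2); rewrite ler_pdivrMr// mul1r ler_nat.
rewrite modT_id// (@floor_def _ _ k)//.
by rewrite mulrC -ler_pdivrMr// t1 -ltr_pdivlMr// intrD natr1.
Qed.

Lemma step_sum_le K g (c : 'I_K -> R[i]) p : (0 < K)%N ->
  (forall (k : 'I_K) t, k%:R / K%:R <= t -> t < k.+1%:R / K%:R -> g t = c k) ->
  (Jp p (fun t => g (modT t)) = (\sum_(j < K) cabs (c j) `^ p / K%:R)%:E)%E.
Proof.
move=> K0 gc; have K0' : 0 < K%:R :> R by rewrite ltr0n.
rewrite /Jp (_ : (fun t => _) = (fun t => (\sum_(j < K) cabs (c j) `^ p *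
    (in_cell K j t)%:R)%:E)); last first.
  apply/funext => t; have [k tk] := cell_index t K0.
  by rewrite (is_step_modT gc tk) (sum_cell (fun j => cabs (c j) `^ p) tk).
rewrite ge0_integral_wsum; last 3 first.
- by move=> j; exact: powR_ge0.
- by move=> j; exact: measurable_in_cell.
- by move=> j t; exact: ler0n.
rewrite -sumEFin; apply: eq_bigr => j _.
under eq_integral do rewrite in_cellE.
rewrite integral_arc.
- by rewrite -mulrBl -natrB// subSnn mul1r.
- by rewrite divr_ge0.
- by rewrite ler_pM2r ?invr_gt0// ler_nat.
- by rewrite ler_pdivrMr// mul1r ler_nat.
Qed.

(** When t and t + d lie in different cells, t is in the last part of length d of its cell and t + d
    in the first part of length d of its own. A and B charge |c_j|^p to these parts, so each value
    counts with measure d instead of 1 / K. *)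
Lemma step_translate_ge0 p K g x d : 0 < p -> (0 < K)%N -> is_step K g ->
  0 <= d <= K%:R^-1 -> (Jp p (fun t => g (modT t)) <= x%:E)%E ->
  (Jp p (fun t => (g (modT t) - g (modT (t + d)))%R) <= (2 `^ p * (2 * (K%:R * d) * x))%:E)%E.
Proof.
move=> p0 K0 [c gc] /andP[d0 dK]; have K0' : 0 < K%:R :> R by rewrite ltr0n.
rewrite (step_sum_le p K0 gc) lee_fin => cx.
pose A t := \sum_(j < K) cabs (c j) `^ p * arc (j.+1%:R / K%:R - d) (j.+1%:R / K%:R) t.
pose B t := \sum_(j < K) cabs (c j) `^ p * arc (j%:R / K%:R) (j%:R / K%:R + d) t.
have mterm a b (y : R) : measurable_fun setT (fun t => y * arc a b t).
  by apply: measurable_funM => //; exact: measurable_arc.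
have mA : measurable_fun setT A by apply: measurable_sum => j; exact: mterm.
have mB : measurable_fun setT B by apply: measurable_sum => j; exact: mterm.
have A0 t : 0 <= A t by apply: sumr_ge0 => j _; rewrite mulr_ge0 ?powR_ge0 ?arc_ge0.
have B0 t : 0 <= B t by apply: sumr_ge0 => j _; rewrite mulr_ge0 ?powR_ge0 ?arc_ge0.
have mg : cmeas (fun t => g (modT t)) by apply: (cmeas_step K0); exists c.
have Ige (I : R -> R) (a b : 'I_K -> R) :
   (forall j, [/\ 0 <= a j, b j = a j + d & b j <= 1]) ->
   (\int[muT]_t (\sum_(j < K) cabs (c j) `^ p * arc (a j) (b j) t)%:E <= (K%:R * d * x)%:E)%E.
  move=> H; rewrite ge0_integral_wsum; last 3 first.
  - by move=> j; exact: powR_ge0.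
  - by move=> j; exact: measurable_arc.
  - by move=> j t; exact: arc_ge0.
  rewrite (eq_bigr (fun j => (cabs (c j) `^ p * d)%:E)); last first.
    move=> j _; have [h1 h2 h3] := H j.
    by rewrite integral_arc// h2 ?lerDl// [X in (_ * X%:E)%E]addrC addKr.
  rewrite sumEFin lee_fin -mulr_suml; move: cx; rewrite -mulr_suml.
  set S := \sum_(i < K) _ => cx.
  rewrite (_ : S * d = K%:R * d * (S / K%:R)).
    by apply: ler_wpM2l => //; rewrite mulr_ge0.
  by field; rewrite gt_eqF.
have IA : (\int[muT]_t (A t)%:E <= (K%:R * d * x)%:E)%E.
  apply: Ige => // j; split; rewrite ?subrK//.
  - by rewrite subr_ge0 (le_trans dK)// ler_pdivlMr// mulVf ?gt_eqF// ler1n.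
  - by rewrite ler_pdivrMr// mul1r ler_nat.
have IB : (\int[muT]_t (B (t + d))%:E <= (K%:R * d * x)%:E)%E.
  rewrite (@ge0_integralT_shift _ d (fun t => (B t)%:E)).
  - apply: Ige => // j; split => //.
    apply: (@le_trans _ _ (j.+1%:R / K%:R)); last by rewrite ler_pdivrMr// mul1r ler_nat.
    by rewrite -[j.+1%:R]natr1 mulrDl mul1r lerD2l.
  - exact/measurable_EFinP.
  - by move=> t; rewrite lee_fin.
  - by move=> t; congr _%:E; apply: eq_bigr => j _; rewrite per_arc.
have AB t : cabs (g (modT t) - g (modT (t + d))) `^ p <= 2 `^ p * (A t + B (t + d)).
  have [k tk] := cell_index t K0; have [l tl] := cell_index (t + d) K0.
  rewrite (is_step_modT gc tk) (is_step_modT gc tl).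
  have [-> | kl] := eqVneq k l.
    by rewrite subrr cabs0 powR0 ?gt_eqF// mulr_ge0 ?powR_ge0// addr_ge0.
  apply: (@le_trans _ _ (2 `^ p * (cabs (c k) `^ p + cabs (c l) `^ p))).
    apply: le_trans (powR_le2 (ltW p0) (cabs_ge0 _) (cabs_ge0 _)).
    apply: (ge0_ler_powR (ltW p0)); rewrite ?nnegrE ?cabs_ge0 ?addr_ge0 ?cabs_ge0//.
    exact: cabsB.
  apply: ler_wpM2l; first exact: powR_ge0.
  have t0 := modT_ge0 t; have td0 := modT_ge0 (t + d); have td1 := modT_lt1 (t + d).
  have := tk; have := tl; rewrite /in_cell => /andP[l1 l2] /andP[k1 k2].
  have lsum (y : 'I_K -> R) (j : 'I_K) : (forall j, 0 <= y j) -> y j <= \sum_(j < K) y j.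
    by move=> y0; rewrite (bigD1 j)//= lerDl sumr_ge0.
  apply: lerD.
    have := lsum (fun j => cabs (c j) `^ p * arc (j.+1%:R / K%:R - d) (j.+1%:R / K%:R) t) k.
    rewrite /arc k2 andbT (_ : _ - d <= _ = true) ?mulr1.
      by apply=> j; rewrite mulr_ge0// powR_ge0.
    rewrite leNgt; apply/negP; rewrite ltrBrDr => h.
    have h1 : modT (t + d) = modT t + d.
      rewrite -modTDl modT_id// /Tdom/= in_itv/= addr_ge0//=.
      by apply: (lt_le_trans h); rewrite ler_pdivrMr// mul1r ler_nat.
    move/eqP: kl; apply; apply: (@cell_inj _ (modT t + d)); last by rewrite -h1 l1.
    by rewrite h andbT (le_trans k1)// lerDl.
  have := lsum (fun j => cabs (c j) `^ p * arc (j%:R / K%:R) (j%:R / K%:R + d) (t + d)) l.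
  rewrite /arc l1 /= (_ : _ < _ + d = true) ?mulr1.
    by apply=> j; rewrite mulr_ge0// powR_ge0.
  rewrite ltNge; apply/negP; rewrite -lerBrDr => h.
  have h1 : modT t = modT (t + d) - d.
    have hT : Tdom (modT (t + d) - d).
      rewrite /Tdom/= in_itv/= (le_trans _ h) ?divr_ge0//=.
      by rewrite (le_lt_trans _ td1)// gerBl.
    by rewrite -(modT_id hT) modTDl addrK.
  move/eqP: kl; apply; apply: (@cell_inj _ (modT t)); first by rewrite k1.
  by rewrite h1 h (le_lt_trans _ l2)// gerBl.
apply: (@le_trans _ _ (\int[muT]_t (2 `^ p * (A t + B (t + d)))%:E)%E).
  apply: ge0_le_integralT => //.
  - apply: measurable_powRT; apply: measurable_cabs; apply: cmeasB => //.
    exact: (cmeas_shift d mg).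
  - apply: measurable_funM => //; apply: measurable_funD => //.
    exact: (measurable_shift d mB).
  - by move=> t; exact: powR_ge0.
have mBs := measurable_shift d mB.
rewrite ge0_integral_scale ?powR_ge0//; last 2 first.
- exact: measurable_funD.
- by move=> t; rewrite addr_ge0.
rewrite ge0_integral_add// EFinM; apply: lee_wpmul2l; first by rewrite lee_fin powR_ge0.
apply: (le_trans (leeD IA IB)); rewrite -EFinD lee_fin.
by move: (K%:R * d) => y; rewrite le_eqVlt; apply/orP; left; apply/eqP; ring.
Qed.

Lemma step_translate p K g x d : 0 < p -> (0 < K)%N -> is_step K g ->
  `|d| <= K%:R^-1 -> (Jp p (fun t => g (modT t)) <= x%:E)%E ->
  (Jp p (fun t => (g (modT t) - g (modT (t + d)))%R) <= (2 `^ p * (2 * (K%:R * `|d|) * x))%:E)%E.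
Proof.
move=> p0 K0 sg; have [d0 dK Jx|d0 dK Jx] := ger0P d.
  by apply: step_translate_ge0; rewrite ?d0.
have mg := cmeas_step K0 sg.
have := @step_translate_ge0 p K g x (- d) p0 K0 sg.
rewrite dK oppr_ge0 (ltW d0) => /(_ isT Jx); apply: le_trans.
(* For negative d, the difference is translated by -d and its two terms are exchanged. *)
rewrite -(@Jp_shift _ p _ (- d)); last 2 first.
- by apply: cmeasB => //; exact: (cmeas_shift d mg).
- by move=> t; rewrite modTDl (modT_id (modT_dom t)).
rewrite le_eqVlt; apply/orP; left; apply/eqP; apply: eq_Jp => t.
by rewrite -cabsN opprB subrK.
Qed.

End StepTranslation.

(** * Fourier partial sums *)

Section FourierLipschitz.
Variable R : realType.
Implicit Types (p t d x : R) (f g : R -> R[i]) (K : nat).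
Local Notation muT := (@muT R).

Lemma lipschitz_derive (g dg : R -> R) (a b : R) :
  (forall x, is_derive x 1%R g (dg x)) -> (forall x, `|dg x| <= 1) ->
  `|g b - g a| <= `|b - a|.
Proof.
move=> Dg dg1; wlog ab : a b / a <= b => [hw|].
  have [|/ltW] := leP a b; first exact: hw.
  by move=> ba; rewrite distrC [leRHS]distrC; exact: hw.
have [|c _ ->] := @MVT_segment R g dg a b ab (fun x _ => Dg x).
  by apply: derivable_within_continuous => x _; case: (Dg x).
by rewrite normrM ler_piMl.
Qed.

Lemma cabs_expi_sub1 (a : R) : cabs (expi a - 1) <= 2 * `|a|.
Proof.
apply: (le_trans (cabs_le_ReIm _)); rewrite ReB ImB /= subr0 mulr_natl mulr2n.
apply: lerD.
  have := @lipschitz_derive cos (fun x => - sin x) 0 a.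
  by rewrite cos0 subr0; apply=> x; rewrite normrN sin_max.
have := @lipschitz_derive sin cos 0 a.
by rewrite sin0 !subr0; apply=> x; exact: cos_max.
Qed.

Lemma pi_le4 : pi <= 4 :> R.
Proof. by have := pihalf_lt2 R; lra. Qed.

(** The constant is 2 * 2 * pi with pi <= 4; one factor 2 comes from [cabs_expi_sub1]. *)
Lemma cabs_Ek_translate (k : int) t d (K : nat) : (absz k <= K)%N ->
  cabs (Ek k t - Ek k (t + d)) <= 16 * K%:R * `|d|.
Proof.
move=> kK; have -> : Ek k t - Ek k (t + d) = Ek k t * - (Ek k d - 1).
  by rewrite EkDt mulrN mulrBr mulr1 opprB.
rewrite cabsM cabs_Ek mul1r cabsN; apply: (le_trans (cabs_expi_sub1 _)).
rewrite !normrM (ger0_norm (pi_ge0 R)) (ger0_norm (ler0n R 2)) !mulrA.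
apply: ler_wpM2r => //.
have kR : `|k%:~R| <= K%:R :> R by rewrite -intr_norm -natr_absz ler_nat.
have := pi_le4; have := pi_ge0 R; move: kR; set q : R := pi.
set y := `|_| => yK q0 q4; have y0 : 0 <= y by exact: normr_ge0.
nra.
Qed.

Lemma fourier_partial_translate K f t d (M : R) : 0 <= M ->
  (forall k, cabs (fourier_coef f k) <= M) ->
  cabs (fourier_partial K f t - fourier_partial K f (t + d)) <=
    (K + K).+1%:R * (M * (16 * K%:R * `|d|)).
Proof.
move=> M0 fM; rewrite !fourier_partialE -sumrB; apply: (le_trans (cabs_sum _ _)).
apply: (@le_trans _ _ (\sum_(i < (K + K).+1) M * (16 * K%:R * `|d|))).
  apply: ler_sum => i _; rewrite -mulrBr cabsM; apply: ler_pM; rewrite ?cabs_ge0//.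
  apply: cabs_Ek_translate; have := ltn_ord i; lia.
by rewrite sumr_const card_ord -[leLHS]mulr_natl.
Qed.

(** |f| <= 1 + |f|^p bounds the integral of |f| by 2, and [cabs_Cint] doubles it. *)
Lemma cabs_fourier_coef p f k : 1 < p -> cmeas f -> (Jp p f <= 1%:E)%E ->
  cabs (fourier_coef f k) <= 4.
Proof.
move=> p1 mf J1; have cf : cint f.
  by apply: (@Jp_cint _ p) => //; [exact: ltW|exact: le_lt_trans J1 (ltry _)].
rewrite fourier_coefE// -lee_fin; apply: (le_trans (cabs_Cint (cint_EkM _ cf))).
have -> : 4%:E = (2%:E * (1 + 1)%:E)%E :> \bar R by rewrite -EFinM; congr _%:E; ring.
apply: lee_wpmul2l => //.
have mp : measurable_fun setT (fun t => cabs (f t) `^ p).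
  by apply: measurable_powRT; exact: measurable_cabs.
apply: (@le_trans _ _ (\int[muT]_t (1 + cabs (f t) `^ p)%:E)%E).
  apply: ge0_le_integralT => [||t|t].
  - by apply: measurable_cabs; apply: cmeasM => //; exact: cmeas_Ek.
  - exact: measurable_funD.
  - exact: cabs_ge0.
  - rewrite cabsM cabs_Ek mulr1; have := cabs_ge0 (f t); move: (cabs (f t)) => y y0.
    have [y1|/ltW y1] := leP y 1; first by rewrite ler_wpDr// powR_ge0.
    by rewrite ler_wpDl// -[leLHS]powRr1// ler_powR// ltW.
rewrite ge0_integral_add//; last by move=> t; exact: powR_ge0.
rewrite integral_cst// [X in (_ * X)%E]probability_setT mule1 EFinD.
exact: leeD.
Qed.

Lemma translate_fourier_partial p f K d (x : R) : 1 < p -> cmeas f -> per f ->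
  (Jp p f <= 1%:E)%E ->
  (Jp p (fun t => (f t - fourier_partial K f t)%R) <= x%:E)%E ->
  (Jp p (fun t => (f t - f (t + d))%R) <=
    (2 `^ p * (2 `^ p * (x + x) + ((K + K).+1%:R * (4 * (16 * K%:R * `|d|))) `^ p))%:E)%E.
Proof.
move=> p1 mf pf J1 Jx; have p0 : 0 <= p by lra.
pose g := fourier_partial K f.
have mg : cmeas g by apply: cint_cmeas; exact: cint_fourier_partial.
have pg : per g by exact: per_fourier_partial.
have mfg : cmeas (fun t => f t - g t) by exact: cmeasB.
have pfg : per (fun t => f t - g t) by move=> t; rewrite pf pg.
have mgg : cmeas (fun t => g t - g (t + d)).
  by apply: cmeasB => //; exact: cmeas_shift.
have Js : (Jp p (fun t => (-1 * (f (t + d) - g (t + d)))%R) <= x%:E)%E.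
  rewrite (@eq_Jp _ p _ (fun t => f (t + d) - g (t + d))).
    by rewrite (Jp_shift p d mfg pfg).
  by move=> t; rewrite mulN1r cabsN.
have ms : cmeas (fun t => -1 * (f (t + d) - g (t + d))).
  by apply: cmeasM; [exact: cmeas_cst|exact: (cmeas_shift d mfg)].
rewrite (_ : (fun t => _) = (fun t => ((f t - g t) + -1 * (f (t + d) - g (t + d))) +
    (g t - g (t + d)))); last by apply/funext => t; ring.
apply: (JpD_le p0 (cmeasD mfg ms) mgg (JpD_le p0 mfg ms Jx Js)).
apply: (Jp_bounded p0 mgg) => t; apply: fourier_partial_translate => // k.
exact: cabs_fourier_coef p1 mf J1.
Qed.

(** The frequencies k i may repeat, as they do in the double sum of [fejer_mean_trig]. *)
Lemma fourier_partial_trig K (I : finType) (c : I -> R[i]) (k : I -> int) t :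
  (forall i, (absz (k i) <= K)%N) ->
  fourier_partial K (fun t => \sum_i c i * Ek (k i) t) t = \sum_i c i * Ek (k i) t.
Proof.
move=> kK; rewrite fourier_partialE.
have cE (l : int) : fourier_coef (fun t => \sum_i c i * Ek (k i) t) l =
    \sum_i c i * (l == k i)%:R.
  rewrite fourier_coef_sum; last by move=> i; apply: cintM; exact: cint_Ek.
  by apply: eq_bigr => i _; rewrite fourier_coefM ?fourier_coef_Ek//; exact: cint_Ek.
under eq_bigr do rewrite cE mulr_suml.
rewrite exchange_big/=; apply: eq_bigr => i _.
have iK : (absz (k i + K%:Z)%R < (K + K).+1)%N by have := kK i; lia.
have iE : (absz (k i + K%:Z)%R)%:Z - K%:Z = k i by have := kK i; lia.
rewrite (bigD1 (Ordinal iK))//= iE eqxx mulr1 big1 ?addr0// => j jn.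
rewrite (_ : _ == k i = false) ?mulr0 ?mul0r//; apply/negP => /eqP jE.
by move/negP: jn; apply; apply/eqP/val_inj => /=; lia.
Qed.

End FourierLipschitz.

(** * Approximation by Fejer means *)

Section FejerApproximation.
Variable R : realType.
Implicit Types (p t d h w : R) (f g : R -> R[i]) (N : nat).
Local Notation muT := (@muT R).
Local Notation Re := (@complex.Re R).
Local Notation Im := (@complex.Im R).
Local Notation e1 := (Ek 1).

Lemma cabs_1subX (z : R[i]) n : cabs z = 1 -> cabs (1 - z ^+ n) <= n%:R * cabs (1 - z).
Proof.
move=> z1; rewrite -[1 - _]opprB cabsN subrX1 cabsM -[z - 1]opprB cabsN mulrC.
apply: ler_wpM2r; first exact: cabs_ge0.
apply: (le_trans (cabs_sum _ _)).
under eq_bigr do rewrite cabsX z1 expr1n.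
by rewrite sumr_const card_ord.
Qed.

(** Some multiple n t lies in [1/4, 3/4], where cos(2 pi n t) is nonpositive, so |1 - z^n| >= 1 for
    z = e1 t. Since |1 - z^n| <= n |1 - z|, this gives |1 - z| >= 1 / n >= t. *)
Lemma cabs_1sub_e1_half t : 0 < t -> t <= 2^-1 -> t <= cabs (1 - e1 t).
Proof.
move=> t0 t1; pose n := (Num.truncn (4 * t)^-1).+1.
have n1 : n.-1%:R * t <= 4^-1.
  have := truncn_le (4 * t)^-1; rewrite invr_ge0 mulr_ge0 ?(ltW t0)//= => h.
  apply: (@le_trans _ _ ((4 * t)^-1 * t)); first by apply: ler_wpM2r => //; exact: ltW.
  by rewrite invfM -mulrA mulVf ?mulr1// gt_eqF.
have n2 : 4^-1 <= n%:R * t.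
  rewrite -ler_pdivrMr// -invfM; apply: ltW; exact: truncnS_gt.
have nt : n%:R * t <= 3 / 4 by rewrite -[n%:R]natr1 mulrDl mul1r; lra.
have c0 : cos (2 * pi * (n%:R * t)) <= 0.
  rewrite -[2 * _ * _](subrK pi) cosDpi oppr_le0; apply: cos_ge0_pihalf.
  have := pi_ge0 R; move: n2 nt; move: (n%:R * t) => x x1 x2; set q : R := pi => q0.
  by apply/andP; split; nra.
have le1 : 1 <= cabs (1 - e1 t ^+ n).
  apply: (le_trans _ (ler_abs_Re _)); apply: (le_trans _ (ler_norm _)).
  rewrite -EkX ReB /Ek [Re (expi _)]/= [Re 1]/=.
  by rewrite -[_ * n%:R * t]mulrA lerBrDl gerDr.
have := le_trans le1 (cabs_1subX n (cabs_Ek 1 t)).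
have n0 : 0 < n%:R :> R by rewrite ltr0n.
move=> h; apply: (@le_trans _ _ n%:R^-1).
  by rewrite -[leRHS]mul1r ler_pdivlMr// mulrC (le_trans nt)//; lra.
by rewrite -[leLHS]mul1r ler_pdivrMr// mulrC.
Qed.

Lemma cabs_1sub_e1 h t : 0 < h <= 2^-1 -> near0 h t = 0 -> h <= cabs (1 - e1 t).
Proof.
move=> /andP[h0 h1] nt; have m0 := modT_ge0 t; have m1 := modT_lt1 t.
have [mh mh'] : h <= modT t /\ modT t <= 1 - h.
  move: nt; rewrite /near0 /arc m0 m1 /= andbT.
  case: ltP => [_|hm]; first by case: (1 - h <= modT t)%R => /= /eqP; rewrite ?addr0 ?oner_eq0// -(natrD _ 1 1) pnatr_eq0.
  by case: leP => [_|/ltW mh _]; rewrite ?add0r//= => /eqP; rewrite oner_eq0.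
rewrite -per_Ek; have [le12|gt12] := leP (modT t) 2^-1.
  by apply: (le_trans mh); apply: cabs_1sub_e1_half => //; exact: lt_le_trans mh.
have -> : cabs (1 - e1 (modT t)) = cabs (1 - e1 (1 - modT t)).
  rewrite -cabs_conj; congr cabs.
  have -> : e1 (1 - modT t) = conjc (e1 (modT t)).
    rewrite EkDt EkNt (_ : e1 1 = 1) ?mul1r//.
    by rewrite /Ek mulr1; exact: expi_int.
  by rewrite rmorphB rmorph1.
by apply: (@le_trans _ _ (1 - modT t)); [lra|apply: cabs_1sub_e1_half; lra].
Qed.

Lemma fejer_le N t : fejer N t * cabs (1 - e1 t) ^+ 2 <= 4 / N.+1%:R.
Proof.
rewrite /fejer mulrAC -exprMn; apply: ler_wpM2r => //; rewrite -cabsM.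
have -> : (\sum_(j < N.+1) Ek j t) * (1 - e1 t) = 1 - e1 t ^+ N.+1.
  rewrite -[RHS]opprB subrX1 -mulNr opprB mulrC; congr (_ * _).
  by apply: eq_bigr => j _; rewrite EkX.
have h : cabs (1 - e1 t ^+ N.+1) <= 2.
  by apply: (le_trans (cabsB _ _)); rewrite cabs1 cabsX cabs_Ek expr1n.
have := cabs_ge0 (1 - e1 t ^+ N.+1); move: h; set y := cabs _ => h y0.
by rewrite expr2; nra.
Qed.

(** With r = 1 - h this is (1 + P_r) / 2 for the usual Poisson kernel P_r. As a majorant of the tail
    of the Fejer kernel it has a mass given by the mean value property, so no tail integral has to
    be computed. *)
Definition poisson h t : R := Re (1 - (1 - h)%:C%C * e1 t)^-1.

Lemma poisson_re_ge h t : 0 < h <= 1 -> h <= Re (1 - (1 - h)%:C%C * e1 t).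
Proof.
move=> /andP[h0 h1]; rewrite ReB ReM.
have -> : Re (1 : R[i]) = 1 by [].
have -> : Re (1 - h)%:C%C = 1 - h by [].
have -> : Im (1 - h)%:C%C = 0 by [].
rewrite mul0r subr0.
have : Re (e1 t) <= 1 by apply: cos_le1.
set y := Re _ => y1.
have : (1 - h) * y <= (1 - h) * 1 by apply: ler_wpM2l => //; rewrite subr_ge0.
lra.
Qed.

Lemma poisson_ge0 h t : 0 < h <= 1 -> 0 <= poisson h t.
Proof.
move=> h01; rewrite /poisson ReV; have := poisson_re_ge t h01.
have h0 : 0 <= h by case/andP: h01 => /ltW.
move: (Re (_ - _)) (Im (_ - _)) => x y hx.
by rewrite divr_ge0 ?addr_ge0 ?sqr_ge0// (le_trans h0).
Qed.

Lemma poisson_horner h t : (1 - (1 - h)%:C%C *: 'X : {poly R[i]}).[e1 t] =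
  1 - (1 - h)%:C%C * e1 t.
Proof. by rewrite !hornerE. Qed.

Lemma cint_poisson h : 0 < h <= 1 -> cint (fun t => (1 - (1 - h)%:C%C * e1 t)^-1).
Proof.
move=> h01; have h0 : 0 < h by case/andP: h01.
apply: (@cint_bounded _ _ h^-1).
  apply: cmeasV; apply: cmeasB; first exact: cmeas_cst.
  by apply: cmeasM; [exact: cmeas_cst|exact: cmeas_Ek].
move=> t; have := poisson_re_ge t h01; set z := (1 - _)%R => hz.
have hc : h <= cabs z by apply: (le_trans hz); apply: le_trans (ler_abs_Re z); exact: ler_norm.
by rewrite cabsV lef_pV2// posrE// (lt_le_trans h0).
Qed.

(** The mass is the value of 1 / (1 - (1 - h) z) at z = 0. *)
Lemma integral_poisson h : 0 < h <= 1 -> (\int[muT]_t (poisson h t)%:E = 1)%E.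
Proof.
move=> h01; have h0 : 0 < h by case/andP: h01.
have cP := cint_poisson h01.
have E : Cint (fun t => (1 - (1 - h)%:C%C * e1 t)^-1) = 1.
  under eq_fun do rewrite -poisson_horner.
  rewrite (Cint_horner_inv h0) => [|t]; last by rewrite poisson_horner poisson_re_ge.
  by rewrite !hornerE subr0 invr1.
have : Re (Cint (fun t => (1 - (1 - h)%:C%C * e1 t)^-1)) = 1 by rewrite E.
rewrite ReC /Rintegral => <-.
by rewrite fineK//; apply: integrable_fin_num => //; case: cP.
Qed.

(* Away from 0 the Fejer kernel is dominated by a small multiple of the
   Poisson kernel of radius 1 - h. *)
Lemma fejer_le_poisson N h t : 0 < h <= 2^-1 -> near0 h t = 0 ->
  fejer N t <= 16 / (N.+1%:R * h) * poisson h t.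
Proof.
move=> hh nt; have h01 : 0 < h <= 1 by case/andP: hh => h0 h1; apply/andP; split; lra.
have h0 : 0 < h by case/andP: h01.
have ha := cabs_1sub_e1 hh nt; have ha0 := lt_le_trans h0 ha.
have rh := poisson_re_ge t h01; rewrite /poisson ReV -sqr_cabs.
set z := (1 - _ * _)%R in rh *; have fl := fejer_le N t.
have hz : h <= cabs z by apply: (le_trans rh); apply: le_trans (ler_abs_Re z); exact: ler_norm.
(* z differs from 1 - e1 t by a number of modulus h, and h <= |1 - e1 t| since t is off the arc
   around 0. *)
have zle : cabs z <= 2 * cabs (1 - e1 t).
  have -> : z = (1 - e1 t) + h%:C%C * e1 t by rewrite /z rmorphB rmorph1; ring.
  apply: (le_trans (cabsD _ _)); rewrite cabsM cabs_Ek mulr1 cabs_real ger0_norm ?(ltW h0)//.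
  by lra.
move: fl ha0 rh hz zle; move: (cabs (1 - e1 t)) (cabs z) (Re z) (fejer N t) (fejer_ge0 N t).
move=> a c x y y0 ya a0 hx hc ca.
have N0 : 0 < N.+1%:R :> R by rewrite ltr0n.
have c0 : 0 < c by exact: lt_le_trans hc.
apply: (@le_trans _ _ (4 / N.+1%:R / a ^+ 2)).
  by rewrite ler_pdivlMr// exprn_gt0.
(* 16 = 4 * 2^2: the 4 of [fejer_le] and the square of the 2 in |z| <= 2 |1 - e1 t|. *)
apply: (@le_trans _ _ (16 / (N.+1%:R * h) * (h / c ^+ 2))).
  rewrite (_ : 16 / _ * _ = 16 / N.+1%:R / c ^+ 2); last by field; rewrite !gt_eqF.
  rewrite ler_pdivlMr ?exprn_gt0// mulrAC ler_pdivrMr ?exprn_gt0//.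
  rewrite (_ : 16 / _ * _ = 4 / N.+1%:R * (2 * a) ^+ 2); last by field; rewrite gt_eqF.
  apply: ler_wpM2l; first by rewrite divr_ge0// ltW.
  by rewrite lerXn2r// nnegrE ?mulr_ge0// ltW.
apply: ler_wpM2l; first by rewrite divr_ge0// mulr_ge0// ltW.
by apply: ler_wpM2r => //; rewrite invr_ge0 sqr_ge0.
Qed.


Definition fejer_mean N f t : R[i] := Cint (fun d => f (t + d) * (fejer N d)%:C%C).

Lemma fejer_bound N t : fejer N t <= N.+1%:R.
Proof.
rewrite /fejer ler_pdivrMr// -expr2 lerXn2r ?nnegrE ?cabs_ge0//.
apply: (le_trans (cabs_sum _ _)).
by under eq_bigr do rewrite cabs_Ek; rewrite sumr_const card_ord.
Qed.

Lemma cint_fejer_shift N f t : cint f -> per f ->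
  cint (fun d => f (t + d) * (fejer N d)%:C%C).
Proof.
move=> cf pf; apply: (@cint_mul_bounded _ _ _ N.+1%:R).
- by under eq_fun do rewrite addrC; exact: (cint_shift t cf pf).
- by apply: cmeas_real; exact: measurable_fejer.
- by move=> d; rewrite cabs_real ger0_norm ?fejer_ge0// fejer_bound.
Qed.

Lemma Cint_shift_Ek f (k : int) t : cint f -> per f ->
  Cint (fun d => f (t + d) * Ek k d) = fourier_coef f (- k) * Ek (- k) t.
Proof.
move=> cf pf; have E d : f (t + d) * Ek k d = Ek (- k) t * (f (d + t) * Ek k (d + t)).
  by rewrite (addrC d) [Ek k (_ + _)]EkDt EkN -[LHS]mulr1 -(Ek_conj_mul k t); ring.
have cg : cint (fun s => f s * Ek k s) by exact: cint_EkM.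
have pg : per (fun s => f s * Ek k s) by move=> s; rewrite pf per_Ek.
under eq_fun do rewrite E.
rewrite CintM; last exact: (cint_shift t cg pg).
by rewrite (Cint_shift t cg pg) mulrC fourier_coefE ?opprK//; exact: cint_cmeas.
Qed.

Lemma fejer_mean_trig N f : cint f -> per f -> fejer_mean N f = fun t =>
  \sum_(i : 'I_N.+1 * 'I_N.+1) ((N.+1%:R^-1)%:C%C *
    fourier_coef f (- (i.1%:Z - i.2%:Z))) * Ek (- (i.1%:Z - i.2%:Z)) t.
Proof.
move=> cf pf; apply/funext => t; rewrite /fejer_mean.
have E d : f (t + d) * (fejer N d)%:C%C = \sum_(i : 'I_N.+1 * 'I_N.+1)
    (N.+1%:R^-1)%:C%C * (f (t + d) * Ek (i.1%:Z - i.2%:Z) d).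
  rewrite /fejer rmorphM/= -cabs_complex_sum conjc_sum mulr_suml.
  rewrite -(pair_bigA _ (fun i j : 'I_N.+1 => (N.+1%:R^-1)%:C%C * (f (t + d) * Ek (i%:Z - j%:Z) d))).
  rewrite mulrC mulr_suml mulr_suml; apply: eq_bigr => i _.
  rewrite mulr_sumr !mulr_suml; apply: eq_bigr => j _.
  by rewrite EkD EkN; ring.
have cE (k : int) : cint (fun d => f (t + d) * Ek k d).
  by apply: cint_EkM; under eq_fun do rewrite addrC; exact: (cint_shift t cf pf).
under eq_fun do rewrite E.
rewrite Cint_sum; last by move=> i; exact: cintM.
by apply: eq_bigr => i _; rewrite CintM// Cint_shift_Ek// mulrA.
Qed.

Lemma fourier_partial_fejer_mean N f t : cint f -> per f ->
  fourier_partial N (fejer_mean N f) t = fejer_mean N f t.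
Proof.
move=> cf pf; rewrite fejer_mean_trig//.
rewrite (@fourier_partial_trig _ N _
  (fun i : 'I_N.+1 * 'I_N.+1 => (N.+1%:R^-1)%:C%C * fourier_coef f (- (i.1%:Z - i.2%:Z)))
  (fun i => - (i.1%:Z - i.2%:Z)))//.
by move=> [i j] /=; have := ltn_ord i; have := ltn_ord j; lia.
Qed.

Lemma fejer_mean_sub_le N f t : cint f -> per f ->
  ((cabs (f t - fejer_mean N f t))%:E <=
   2%:E * \int[muT]_d (cabs (f t - f (t + d)) * fejer N d)%:E)%E.
Proof.
move=> cf pf; have cK : cint (fun d => (fejer N d)%:C%C).
  apply: (@cint_bounded _ _ N.+1%:R); first by apply: cmeas_real; exact: measurable_fejer.
  by move=> d; rewrite cabs_real ger0_norm ?fejer_ge0// fejer_bound.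
have CK : Cint (fun d => (fejer N d)%:C%C) = 1.
  apply: complex_eq; rewrite ?ReC ?ImC /Rintegral /=.
    by rewrite integral_fejer.
  by rewrite integral0.
have E : f t - fejer_mean N f t = Cint (fun d => (f t - f (t + d)) * (fejer N d)%:C%C).
  under eq_fun do rewrite mulrBl.
  rewrite CintB; [|exact: cintM|exact: cint_fejer_shift].
  by rewrite CintM// CK mulr1.
have ci : cint (fun d => (f t - f (t + d)) * (fejer N d)%:C%C).
  under eq_fun do rewrite mulrBl.
  by apply: cintB; [exact: cintM|exact: cint_fejer_shift].
rewrite E; apply: (le_trans (cabs_Cint ci)); apply: lee_wpmul2l => //.
rewrite le_eqVlt; apply/orP; left; apply/eqP; apply: eq_integral => d _.
by rewrite cabsM cabs_real [X in _ * X]ger0_norm// fejer_ge0.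
Qed.

Lemma near0_neq0_measurable h : measurable_fun setT (fun t => near0 h t == 0).
Proof. by apply: measurable_fun_eqr => //; exact: measurable_near0. Qed.

(* The kernel bound is applied to the Fejer kernel with its far part rescaled
   to mass one; the mass [eps] of that part multiplies the integrand instead. *)
Lemma fejer_mean_approx p N h w f : 1 < p -> 0 < h <= 2^-1 -> 0 <= w ->
  cmeas f -> per f -> (Jp p f <= 1%:E)%E ->
  (forall d, `|d| <= h -> (Jp p (fun t => (f t - f (t + d))%R) <= w%:E)%E) ->
  (Jp p (fun t => (f t - fejer_mean N f t)%R) <=
    (4 `^ p * (w + (16 / (N.+1%:R * h)) `^ p * (2 `^ p * 2)))%:E)%E.
Proof.
move=> p1 hh w0 mf pf J1 Hw; have p0 : 0 < p by lra.
have cf : cint f.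
  by apply: (@Jp_cint _ p) => //; [exact: ltW|exact: le_lt_trans J1 (ltry _)].
have h01 : 0 < h <= 1 by case/andP: hh => h0 h1; apply/andP; split; lra.
have h0 : 0 < h by case/andP: h01.
pose eps : R := 16 / (N.+1%:R * h).
have eps0 : 0 < eps by rewrite divr_gt0// mulr_gt0.
pose a d : R := if near0 h d == 0 then eps else 1.
have a0 d : 0 < a d by rewrite /a; case: ifP.
have ma : measurable_fun setT a.
  by apply: measurable_fun_ifT => //; exact: near0_neq0_measurable.
pose G (z : R * R) := cabs (f z.1 - f (z.1 + z.2)) * a z.2.
pose k d := 2 * (fejer N d / a d).
have mG : measurable_fun setT G.
  apply: measurable_funM; last exact: (measurableT_comp ma).
  under eq_fun do rewrite -[cabs _]powRr1 ?cabs_ge0//.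
  by apply: measurable_cabs_powR2 => //; exact: measurable_funD.
have mai : measurable_fun setT (fun d => (a d)^-1).
  under eq_fun do rewrite -powR_inv1 ?(ltW (a0 _))//.
  exact: measurable_powRT.
have mk : measurable_fun setT k.
  by apply: measurable_funM => //; apply: measurable_funM => //; exact: measurable_fejer.
have mm : cmeas (fejer_mean N f).
  rewrite fejer_mean_trig//.
  by apply: cmeas_sum => i; apply: cmeasM; [exact: cmeas_cst|exact: cmeas_Ek].
(* 4 = 2 * (1 + 1): the factor of [fejer_mean_sub_le] and the masses of the Fejer and Poisson
   kernels. The bound on G adds the near case w and the far case, where eps^p multiplies the trivial
   bound 2^p * 2. *)
apply: (@kernel_bound _ p 4 _ G k) => //.
- by rewrite addr_ge0// !mulr_ge0// powR_ge0.
- by apply: measurable_cabs; exact: cmeasB.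
- by move=> z; rewrite mulr_ge0 ?cabs_ge0// ltW.
- by move=> d; rewrite /k mulr_ge0// divr_ge0 ?fejer_ge0// ltW.
- by move=> t; exact: cabs_ge0.
- apply: (@le_trans _ _ (\int[muT]_d (2 * (fejer N d + poisson h d))%:E)%E).
    apply: ge0_le_integralT => //.
    + apply: measurable_funM => //; apply: measurable_funD; first exact: measurable_fejer.
      by case: (cint_cmeas (cint_poisson h01)).
    + by move=> d; rewrite /k mulr_ge0// divr_ge0 ?fejer_ge0// ltW.
    + move=> d; apply: ler_wpM2l => //; rewrite /a; case: eqP => [nd|_].
        rewrite ler_pdivrMr//; apply: (le_trans (fejer_le_poisson N hh nd)).
        rewrite mulrC; apply: ler_wpM2r; first exact: ltW.
        by rewrite lerDr fejer_ge0.
      by rewrite divr1 lerDl poisson_ge0.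
  rewrite ge0_integral_scale//; last 2 first.
  + apply: measurable_funD; first exact: measurable_fejer.
    by case: (cint_cmeas (cint_poisson h01)).
  + by move=> d; rewrite addr_ge0 ?fejer_ge0 ?poisson_ge0.
  rewrite ge0_integral_add; last 4 first.
  + exact: measurable_fejer.
  + by case: (cint_cmeas (cint_poisson h01)).
  + exact: fejer_ge0.
  + by move=> d; exact: poisson_ge0.
  rewrite integral_fejer integral_poisson// -EFinD -EFinM lee_fin; lra.
- move=> d _; rewrite /G /=.
  have mfd : cmeas (fun t => f t - f (t + d)) by apply: cmeasB => //; exact: cmeas_shift.
  under eq_integral do rewrite powRM ?cabs_ge0 ?(ltW (a0 _))// mulrC.
  rewrite ge0_integral_scale ?powR_ge0//; last 2 first.
  + by apply: measurable_powRT; exact: measurable_cabs.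
  + by move=> t; exact: powR_ge0.
  rewrite /a; case: eqP => [nd|/eqP nd].
    apply: (@le_trans _ _ ((eps `^ p)%:E * (2 `^ p * 2)%:E)%E).
      apply: lee_wpmul2l; first by rewrite lee_fin powR_ge0.
      apply: (le_trans (JpB (ltW p0) mf (cmeas_shift d mf))).
      rewrite Jp_shift// EFinM; apply: lee_wpmul2l; first by rewrite lee_fin powR_ge0.
      have -> : 2%:E = (1%:E + 1%:E)%E :> \bar R by rewrite -EFinD.
      exact: leeD.
    by rewrite -EFinM lee_fin lerDr.
  rewrite powR1 mul1e; apply: (le_trans (near0_translate pf nd Hw)).
  by rewrite lee_fin lerDl !mulr_ge0// powR_ge0.
- move=> t; apply: (le_trans (fejer_mean_sub_le N t cf pf)).
  rewrite -ge0_integral_scale//; last 2 first.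
  + apply: measurable_funM; last exact: measurable_fejer.
    apply: measurable_cabs; apply: cmeasB; first exact: cmeas_cst.
    by under eq_fun do rewrite addrC; exact: cmeas_shift.
  + by move=> d; rewrite mulr_ge0 ?cabs_ge0 ?fejer_ge0.
  rewrite le_eqVlt; apply/orP; left; apply/eqP; apply: eq_integral => d _.
  rewrite /G /k /=; congr _%:E; field; by rewrite gt_eqF.
Qed.

(** With g = f - fejer_mean N f, the error of the partial sum is g minus its own partial sum, so
    boundedness of partial sums is applied to a small function. *)
Lemma fourier_partial_approx p : 1 < p -> exists2 C : R, 0 <= C &
  forall N h w f, 0 < h <= 2^-1 -> 0 <= w ->
  cmeas f -> per f -> (Jp p f <= 1%:E)%E ->
  (forall d, `|d| <= h -> (Jp p (fun t => (f t - f (t + d))%R) <= w%:E)%E) ->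
  (Jp p (fun t => (f t - fourier_partial N f t)%R) <=
    (C * (w + (N.+1%:R * h)^-1 `^ p))%:E)%E.
Proof.
move=> p1; have p0 : 0 <= p by lra.
have [C C0 HC] := fourier_partial_le p1.
exists (2 `^ p * (4 `^ p + C * 4 `^ p) * (1 + 16 `^ p * (2 `^ p * 2))).
  by rewrite !mulr_ge0 ?addr_ge0 ?mulr_ge0 ?powR_ge0.
move=> N h w f hh w0 mf pf J1 Hw.
have cf : cint f.
  by apply: (@Jp_cint _ p) => //; [exact: ltW|exact: le_lt_trans J1 (ltry _)].
pose g t := f t - fejer_mean N f t.
have cm : cint (fejer_mean N f).
  rewrite fejer_mean_trig//.
  by apply: cint_sum => i; apply: cintM; exact: cint_Ek.
have cg : cint g by exact: cintB.
have mg := cint_cmeas cg.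
have pg : per g.
  move=> t; rewrite /g pf; congr (_ - _); rewrite fejer_mean_trig//.
  by apply: eq_bigr => i _; rewrite per_Ek.
have Jg := fejer_mean_approx N p1 hh w0 mf pf J1 Hw.
have E t : f t - fourier_partial N f t = g t + -1 * fourier_partial N g t.
  have -> : fourier_partial N g t = fourier_partial N f t - fejer_mean N f t.
    rewrite -[fejer_mean N f t in RHS]fourier_partial_fejer_mean// !fourier_partialE -sumrB.
    apply: eq_bigr => i _; rewrite -mulrBl; congr (_ * _).
    rewrite (_ : g = fun t => f t + -1 * fejer_mean N f t); last first.
      by apply/funext => s; rewrite /g mulN1r.
    by rewrite fourier_coefD ?fourier_coefM ?mulN1r//; exact: cintM.
  by rewrite /g; ring.
under eq_fun do rewrite E.
have mF := cint_cmeas (cint_fourier_partial N g).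
have JF := JpM_le (-1) p0 mF (HC N g _ mg pg Jg).
apply: (le_trans (JpD_le p0 mg (cmeasM (cmeas_cst _) mF) Jg JF)).
rewrite lee_fin cabsN cabs1 powR1 mul1r.
have h0 : 0 < h by case/andP: hh.
have -> : (16 / (N.+1%:R * h)) `^ p = 16 `^ p * (N.+1%:R * h)^-1 `^ p.
  by rewrite powRM// invr_ge0 mulr_ge0// ltW.
have := powR_ge0 (N.+1%:R * h)^-1 p; move: (_^-1 `^ p) => y y0.
have := powR_ge0 16 p; have := powR_ge0 2 p; have := powR_ge0 4 p.
move: (16 `^ p) (2 `^ p) (4 `^ p) => A B D D0 B0 A0.
rewrite -subr_ge0 (_ : _ - _ = B * (D + C * D) * (y + A * (B * 2) * w)); last by ring.
by rewrite !mulr_ge0// ?addr_ge0 ?mulr_ge0.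
Qed.

End FejerApproximation.

(** * Rates *)

Section Rates.
Variable R : realType.
Implicit Types (p t d a : R) (f g F G : R -> R[i]) (P : nat -> Prop).

Lemma least_spec P : (exists m, P m) ->
  P (least P) /\ forall k, P k -> (least P <= k)%N.
Proof.
move=> exP.
have exb : exists m, `[< P m >] by have [m Pm] := exP; exists m; apply/asboolP.
have [m /asboolP Pm mmin] := ex_minnP exb.
rewrite /least; apply: (@xgetPex _ 0%N [set m | P m /\ forall k, P k -> (m <= k)%N]).
by exists m; split => // k Pk; apply: mmin; apply/asboolP.
Qed.

Lemma pow2n_gt0 n : 0 < pow2n R n.
Proof. by rewrite invr_gt0 exprn_gt0. Qed.

Lemma pow2nD m n : pow2n R (m + n) = pow2n R m * pow2n R n.
Proof. by rewrite /pow2n exprD invfM. Qed.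

Lemma pow2n_powR n p : pow2n R n `^ p = 2 `^ (- (p * n%:R)).
Proof.
by rewrite /pow2n -powR_invn// -powRrM mulNr mulrC.
Qed.

Lemma pow2n_powRD m n p : pow2n R (m + n) `^ p = pow2n R m `^ p * pow2n R n `^ p.
Proof. by rewrite pow2nD powRM// ltW// pow2n_gt0. Qed.

Lemma pow2n_le1 n : pow2n R n <= 1.
Proof. by rewrite invf_le1 ?exprn_gt0// exprn_ege1// ler1n. Qed.

(** Stated for all large C, so that the four rate estimates can share one shift. *)
Lemma pow2n_powR_absorb p (A : R) : 1 <= p -> 0 <= A ->
  exists C0, forall C, (C0 <= C)%N -> A * pow2n R C <= 1 /\ A * pow2n R C `^ p <= 1.
Proof.
move=> p1 A0; exists (Num.bound A) => C hC.
have h1 : A * pow2n R C <= 1.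
  rewrite ler_pdivrMr ?exprn_gt0// mul1r; apply: (le_trans (ltW (archi_boundP A0))).
  by rewrite -natrX ler_nat (leq_trans hC)// ltnW// ltn_expl.
split => //; apply: le_trans h1; apply: ler_wpM2l => //.
rewrite -[leRHS]powRr1 ?(ltW (pow2n_gt0 _))//.
by apply: ger_powR; rewrite ?pow2n_gt0 ?pow2n_le1.
Qed.

Lemma fourier_rate p : 1 < p -> exists C0, forall C, (C0 <= C)%N ->
  forall F, cmeas F -> per F -> (Jp p F <= 1%:E)%E -> forall m n,
  (forall d, `|d| <= pow2n R m ->
     (Jp p (fun t => (F t - F (t + d))%R) <= (pow2n R (n + C) `^ p)%:E)%E) ->
  (Jp p (fun t => (F t - fourier_partial (2 ^ (m + n + C))%N F t)%R) <=
     (pow2n R n `^ p)%:E)%E.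
Proof.
move=> p1; have [A A0 HA] := fourier_partial_approx p1.
have B0 : 0 <= A * (1 + 2 `^ p) by rewrite mulr_ge0// addr_ge0// powR_ge0.
have [C0 HC] := pow2n_powR_absorb (ltW p1) B0.
exists C0 => C /HC[_ hC] F mF pF J1 m n Hm.
(* The scale h = 2^-(m+1) rather than 2^-m meets the requirement h <= 1/2 also for m = 0; then 1 /
   (N h) <= 2 * 2^-(n + C). *)
have h2 : 0 < pow2n R m.+1 <= 2^-1.
  by rewrite pow2n_gt0 -addn1 pow2nD {2}/pow2n expr1 ler_piMl// pow2n_le1.
have := HA (2 ^ (m + n + C))%N _ _ F h2 (powR_ge0 (pow2n R (n + C)) p) mF pF J1.
have Hh d : `|d| <= pow2n R m.+1 ->
    (Jp p (fun t => (F t - F (t + d))%R) <= (pow2n R (n + C) `^ p)%:E)%E.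
  move=> hd; apply: Hm; apply: (le_trans hd).
  by rewrite -addn1 pow2nD ler_piMr ?pow2n_le1// ltW// pow2n_gt0.
move=> /(_ Hh) /le_trans; apply; rewrite lee_fin.
apply: (@le_trans _ _ (A * (1 + 2 `^ p) * pow2n R (n + C) `^ p)).
  rewrite -mulrA mulrDl mul1r; apply: ler_wpM2l => //; rewrite lerD2l.
  rewrite -powRM ?(ltW (pow2n_gt0 _))//.
  apply: ge0_ler_powR; rewrite ?nnegrE ?mulr_ge0 ?invr_ge0 ?mulr_ge0 ?(ltW (pow2n_gt0 _))//; first by lra.
  rewrite -[leLHS]mul1r ler_pdivrMr ?mulr_gt0 ?pow2n_gt0//.
  apply: (@le_trans _ _ (2 * pow2n R (n + C) * ((2 ^ (m + n + C))%:R * pow2n R m.+1))).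
    rewrite -addnA natrX exprD /pow2n exprS le_eqVlt; apply/orP; left; apply/eqP.
    by field; rewrite !expf_neq0.
  apply: ler_wpM2l; first by rewrite mulr_ge0// ltW// pow2n_gt0.
  by apply: ler_wpM2r; [rewrite ltW// pow2n_gt0|rewrite ler_nat].
by rewrite pow2n_powRD mulrCA ger_pMr// powR_gt0// pow2n_gt0.
Qed.

Lemma modulus_rate_fourier p : 1 < p -> exists C0, forall C, (C0 <= C)%N ->
  forall F, cmeas F -> per F -> (Jp p F <= 1%:E)%E -> forall m n,
  (Jp p (fun t => (F t - fourier_partial (2 ^ m)%N F t)%R) <=
     (pow2n R (n + C) `^ p)%:E)%E ->
  forall d, `|d| <= pow2n R (2 * m + n + C) ->
     (Jp p (fun t => (F t - F (t + d))%R) <= (pow2n R n `^ p)%:E)%E.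
Proof.
move=> p1; have p0 : 0 <= p by lra.
(* The Lipschitz bound is (2K + 1) * 4 * 16 K |d| <= 192 K^2 |d| for K = 2^m, and the exponent 2 m +
   n + C makes K^2 |d| <= 2^-(n + C). *)
have [c c0 cE] : exists2 c : R, 0 <= c & 192 <= c by exists 192; [exact: ler0n|exact: lexx].
have B0 : 0 <= 2 `^ p * (2 `^ p * (1 + 1) + c `^ p) :> R.
  by rewrite !(mulr_ge0, addr_ge0, powR_ge0).
have [C0 HC] := pow2n_powR_absorb (ltW p1) B0.
exists C0 => C /HC[_ hC] F mF pF J1 m n Jm d dm.
apply: (le_trans (translate_fourier_partial d p1 mF pF J1 Jm)); rewrite lee_fin.
apply: (@le_trans _ _ (2 `^ p * (2 `^ p * (1 + 1) + c `^ p) * pow2n R (n + C) `^ p)).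
  rewrite -[leRHS]mulrA; apply: ler_wpM2l; first exact: powR_ge0.
  rewrite [leRHS]mulrDl -[X in _ <= X + _]mulrA [(1 + 1) * _]mulrDl mul1r lerD2l.
  rewrite -powRM ?(ltW (pow2n_gt0 _))//.
  apply: (ge0_ler_powR p0); rewrite ?nnegrE ?mulr_ge0 ?(ltW (pow2n_gt0 _))//.
  have K1 : 1 <= (2 ^ m)%:R :> R by rewrite natrX exprn_ege1// ler1n.
  have dK : (2 ^ m)%:R * (2 ^ m)%:R * `|d| <= pow2n R (n + C).
    have m0 : 0 < 2 ^+ m :> R by rewrite exprn_gt0.
    rewrite -ler_pdivlMl ?mulr_gt0 ?natrX//; apply: (le_trans dm).
    by rewrite -addnA mul2n -addnn !pow2nD /pow2n -invfM.
  move: K1 dK (normr_ge0 d); rewrite -natr1 natrD; move: (2 ^ m)%:R (pow2n _ _) => K x K1.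
  set y := `|d| => h y0.
  have h1 : K * y <= K * K * y by rewrite -mulrA ler_peMl// mulr_ge0//; lra.
  by apply: (@le_trans _ _ (192 * x)); [nra|apply: ler_wpM2r => //; nra].
by rewrite pow2n_powRD mulrCA ger_pMr// powR_gt0// pow2n_gt0.
Qed.

Lemma step_rate p : 1 < p -> exists C0, forall C, (C0 <= C)%N ->
  forall F, cmeas F -> per F -> forall m n,
  (forall d, `|d| <= pow2n R m ->
     (Jp p (fun t => (F t - F (t + d))%R) <= (pow2n R (n + C) `^ p)%:E)%E) ->
  exists g, is_step (2 ^ m)%N g /\
    (Jp p (fun t => (F t - g (modT t))%R) <= (pow2n R n `^ p)%:E)%E.
Proof.
move=> p1; have p0 : 0 < p by lra.
have [C0 HC] := pow2n_powR_absorb (ltW p1) (ler0n R 3).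
exists C0 => C /HC[_ hC] F mF pF m n Hm.
have w0 : 0 < pow2n R (n + C) `^ p by rewrite powR_gt0// pow2n_gt0.
have m0 : (0 < 2 ^ m)%N by rewrite expn_gt0.
have [|d Hd] := step_approx p0 w0 m0 mF pF; first by rewrite natrX; exact: Hm.
exists (fun t => F (cell (2 ^ m) t + d)); split; first exact: is_step_cell.
under eq_fun do rewrite per_cell.
apply: (le_trans Hd); rewrite lee_fin pow2n_powRD mulrCA.
by rewrite ger_pMr// powR_gt0// pow2n_gt0.
Qed.

Lemma modulus_rate_step p : 1 < p -> exists C0, forall C, (C0 <= C)%N ->
  forall F, cmeas F -> per F -> (Jp p F <= 1%:E)%E -> forall s n m g,
  is_step (2 ^ s)%N g ->
  (Jp p (fun t => (F t - g (modT t))%R) <= (pow2n R (n + C) `^ p)%:E)%E ->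
  s%:R + p * n%:R + C%:R <= m%:R :> R ->
  forall d, `|d| <= pow2n R m ->
     (Jp p (fun t => (F t - F (t + d))%R) <= (pow2n R n `^ p)%:E)%E.
Proof.
move=> p1; have p0 : 0 < p by lra.
pose B : R := 2 `^ p.
have Bge0 : 0 <= B by exact: powR_ge0.
(* The first summand bounds F - G and its translate; the second is [step_translate] with [Jp p G] at
   most B (1 + 1). *)
pose A : R := B * (B * (1 + 1) + B * (2 * (B * (1 + 1)))).
have A0 : 0 <= A by rewrite !(mulr_ge0, addr_ge0).
have [C0 HC] := pow2n_powR_absorb (ltW p1) A0.
exists C0 => C /HC[hC1 hC2] F mF pF J1 s n m g sg Jg sm d dm.
have s0 : (0 < 2 ^ s)%N by rewrite expn_gt0.
have mg := cmeas_step s0 sg.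
pose G t := g (modT t).
have pG : per G by move=> t; rewrite /G (modT_id (modT_dom t)).
set x := pow2n R (n + C) `^ p in Jg.
have x1 : x <= 1.
  by rewrite /x -[leRHS](powR1E p) ge0_ler_powR ?nnegrE ?(ltW (pow2n_gt0 _)) ?(ltW p0)// pow2n_le1.
have mFG : cmeas (fun t => F t - G t) by exact: cmeasB.
have pFG : per (fun t => F t - G t) by move=> t; rewrite pF pG.
have JG : (Jp p G <= (B * (1 + 1))%:E)%E.
  have E : G = fun t => F t + -1 * (F t - G t) by apply/funext => t; ring.
  rewrite E; apply: (le_trans (JpD_le (ltW p0) mF (cmeasM (cmeas_cst _) mFG) J1
    (JpM_le (-1) (ltW p0) mFG Jg))).
  by rewrite lee_fin cabsN cabs1 powR1 mul1r -/B ler_wpM2l// lerD2l.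
pose y := (2 ^ s)%:R * `|d|.
(* This is where p n enters: the p-th power of the translation error of a step function is only
   linear in 2^s |d|, so 2^(s - m) has to be at most 2^(-p n - C). *)
have yx : y <= pow2n R n `^ p * pow2n R C.
  rewrite /y (pow2n_powR n) natrX -[pow2n R C]powRr1 ?(ltW (pow2n_gt0 _))// pow2n_powR mul1r.
  rewrite -powRD; last by rewrite pnatr_eq0 implybT.
  apply: (@le_trans _ _ (2 ^+ s * pow2n R m)); first by rewrite ler_wpM2l// exprn_ge0.
  rewrite -powR_mulrn// -[pow2n R m]powRr1 ?(ltW (pow2n_gt0 _))// pow2n_powR mul1r.
  rewrite -powRD; last by rewrite pnatr_eq0 implybT.
  by apply: ler_powR; [rewrite ler1n|lra].
have dK : `|d| <= (2 ^ s)%:R^-1.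
  apply: (le_trans dm); rewrite natrX lef_pV2 ?posrE ?exprn_gt0// ler_weXn2l ?ler1n//.
  rewrite -(ler_nat R); apply: le_trans sm; rewrite -addrA lerDl addr_ge0// mulr_ge0// ltW//.
have Jst := step_translate p0 s0 sg dK JG; rewrite -/y -/B in Jst.
have Js : (Jp p (fun t => (-1 * (F (t + d) - G (t + d)))%R) <= x%:E)%E.
  rewrite (@eq_Jp _ p _ (fun t => F (t + d) - G (t + d))).
    by rewrite (Jp_shift p d mFG pFG).
  by move=> t; rewrite mulN1r cabsN.
have ms : cmeas (fun t => -1 * (F (t + d) - G (t + d))).
  by apply: cmeasM; [exact: cmeas_cst|exact: (cmeas_shift d mFG)].
have mGG : cmeas (fun t => G t - G (t + d)).
  by apply: cmeasB => //; exact: (cmeas_shift d mg).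
rewrite (_ : (fun t => _) = (fun t => ((F t - G t) + -1 * (F (t + d) - G (t + d))) +
    (G t - G (t + d)))); last by apply/funext => t; ring.
apply: (le_trans (JpD_le (ltW p0) (cmeasD mFG ms) mGG (JpD_le (ltW p0) mFG ms Jg Js) Jst)).
rewrite lee_fin -/B; have w0 : 0 < pow2n R n `^ p by rewrite powR_gt0// pow2n_gt0.
have xE : x = pow2n R n `^ p * pow2n R C `^ p by exact: pow2n_powRD.
have E : pow2n R C `^ p <= pow2n R C.
  rewrite -[leRHS]powRr1 ?(ltW (pow2n_gt0 _))//.
  by apply: ger_powR; rewrite ?pow2n_gt0 ?pow2n_le1// ltW.
have xy : x <= pow2n R n `^ p * pow2n R C by rewrite xE ler_wpM2l// ltW.
apply: (@le_trans _ _ (A * (pow2n R n `^ p * pow2n R C))); last first.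
  by rewrite mulrCA ger_pMr.
move: yx xy; move: (_ * pow2n R C) => z yz xz; rewrite /A -[leRHS]mulrA; apply: ler_wpM2l => //.
rewrite [leRHS]mulrDl; apply: lerD.
  by rewrite -[leRHS]mulrA [(1 + 1) * z]mulrDl mul1r; apply: ler_wpM2l => //; exact: lerD.
rewrite -[leRHS]mulrA; apply: ler_wpM2l => //.
rewrite mulrAC; apply: ler_wpM2l => //.
by rewrite !(mulr_ge0, addr_ge0).
Qed.

End Rates.

(** * From functions on [0, 1) to periodic functions *)

Section Periodization.
Variable R : realType.
Implicit Types (p t d a : R) (f g F G : R -> R[i]).

(** The norms of the statement see only [0, 1), so g has to agree with the measurable G there and
    nowhere else. *)
Lemma Lpnorm_le p a g G : 0 < p -> 0 <= a -> cmeas G ->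
  (forall t, Tdom t -> g t = G t) ->
  (Lpnorm p g <= a%:E)%E <-> (Jp p G <= (a `^ p)%:E)%E.
Proof.
move=> p0 a0 mG gG.
have -> : Lpnorm p g = (Jp p G `^ p^-1)%E.
  rewrite /Lpnorm /Jp integral_muT; last exact: measurable_cabs_powR.
  apply: (congr1 (fun J => (J `^ p^-1)%E)); apply: eq_integral => t; rewrite inE => Tt.
  by congr ((cabs _ `^ _)%:E); exact: gG.
have pi0 : 0 <= p^-1 by rewrite invr_ge0 ltW.
have J0 := Jp_ge0 p G; move: (Jp p G) J0 => J J0.
split=> h.
  rewrite -[leLHS]poweRe1// -(mulVf (lt0r_neq0 p0)) poweRrM -poweR_EFin.
  by apply: (gt0_ler_poweR (ltW p0)); rewrite ?in_itv/= ?leey ?andbT ?poweR_ge0 ?lee_fin.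
have -> : a%:E = ((a `^ p)%:E `^ p^-1)%E.
  by rewrite poweR_EFin -powRrM mulfV ?gt_eqF// powRr1.
by apply: (gt0_ler_poweR pi0); rewrite ?in_itv/= ?leey ?andbT ?lee_fin ?powR_ge0.
Qed.

Lemma cmeas_modT f : cmeasurable f -> cmeas (fun t => f (modT t)).
Proof.
have H (h : R -> R) : measurable_fun (@Tdom R) h -> measurable_fun setT (fun t => h (modT t)).
  move=> mh; apply: (measurable_comp (@measurable_Tdom R) _ mh); last exact: measurable_modT.
  by move=> _ [t _ <-]; exact: modT_dom.
by case=> m1 m2; split; [exact: (H (fun t => complex.Re (f t)))|exact: (H (fun t => complex.Im (f t)))].
Qed.

Lemma per_modT f : per (fun t => f (modT t)).
Proof. by move=> t; rewrite (modT_id (modT_dom t)). Qed.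

Lemma fourier_partial_modT K f t :
  fourier_partial K f t = fourier_partial K (fun t => f (modT t)) t.
Proof.
rewrite !fourier_partialE; apply: eq_bigr => i _; congr (_ * _).
rewrite /fourier_coef; congr (_ +i* _)%C; apply: eq_Rintegral => s; rewrite inE => Ts;
  by rewrite (modT_id Ts).
Qed.

End Periodization.

Theorem theorem2p5 (R : realType) (p : R) (hp : 1 < p) :
  exists C : nat, forall (f : R -> R[i]), cmeasurable f ->
    (Lpnorm p f <= 1%:E)%E ->
    forall n : nat,
      [/\ (Lp_fourierrate p f n <= Lp_modulus p f (n + C) + n + C)%N,
          (Lp_modulus p f n <= 2 * Lp_fourierrate p f (n + C) + n + C)%N,
          (Lp_steprate p f n <= Lp_modulus p f (n + C))%N &
          ((Lp_modulus p f n)%:R <= (Lp_steprate p f (n + C))%:R + p * n%:R + C%:R :> R)].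
Proof.
have p0 : 0 < p by lra.
have [Ca Ha] := fourier_rate hp; have [Cb Hb] := modulus_rate_fourier hp.
have [Cc Hc] := step_rate hp; have [Cd Hd] := modulus_rate_step hp.
pose D := maxn (maxn Ca Cb) (maxn Cc Cd).
have [ha hb hc hd] : [/\ Ca <= D, Cb <= D, Cc <= D & Cd <= D]%N.
  by split; rewrite !leq_max leqnn ?orbT.
(* The extra unit pays for rounding the real exponent of (d) up to a natural number. *)
exists D.+1 => f mf f1 n.
pose F t := f (modT t).
have mF : cmeas F by exact: cmeas_modT.
have pF : per F by exact: per_modT.
have fF t : Tdom t -> f t = F t by move=> Tt; rewrite /F modT_id.
have J1 : (Jp p F <= 1%:E)%E.
  by have /(Lpnorm_le p0 ler01 mF fF) := f1; rewrite powR1.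
have pos k : 0 <= pow2n R k by exact/ltW/pow2n_gt0.
pose mod_ok m k := forall d, `|d| <= pow2n R m ->
  (Jp p (fun t => (F t - F (t + d))%R) <= (pow2n R k `^ p)%:E)%E.
have modP m k : (forall d, `|d| <= pow2n R m ->
    (Lpnorm p (fun t => (f t - tau d f t)%R) <= (pow2n R k)%:E)%E) <-> mod_ok m k.
  have E d t : Tdom t -> f t - tau d f t = F t - F (t + d) by move=> Tt; rewrite (fF t Tt).
  have T d := Lpnorm_le p0 (pos k) (cmeasB mF (cmeas_shift d mF)) (E d).
  by split=> H d /H /T.
have fourP m k : (Lpnorm p (fun t => (f t - fourier_partial (2 ^ m)%N f t)%R) <=
    (pow2n R k)%:E)%E <->
    (Jp p (fun t => (F t - fourier_partial (2 ^ m)%N F t)%R) <= (pow2n R k `^ p)%:E)%E.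
  apply: (Lpnorm_le p0 (pos k)).
    by apply: (cmeasB mF); apply: cint_cmeas; exact: cint_fourier_partial.
  by move=> t Tt; rewrite (fF t Tt) fourier_partial_modT.
have stepP m k g : is_step (2 ^ m)%N g ->
    (Lpnorm p (fun t => (f t - g t)%R) <= (pow2n R k)%:E)%E <->
    (Jp p (fun t => (F t - g (modT t))%R) <= (pow2n R k `^ p)%:E)%E.
  move=> sg; apply: (Lpnorm_le p0 (pos k)).
    by apply: (cmeasB mF); apply: cmeas_step sg; rewrite expn_gt0.
  by move=> t Tt; rewrite (fF t Tt) (modT_id Tt).
(* Without a witness [least] would be 0, and the modulus would carry no information. *)
have mod_ex k : exists m, mod_ok m k.
  apply: (Lp_continuous_finite hp mF pF); last by rewrite powR_gt0// pow2n_gt0.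
  exact: le_lt_trans J1 (ltry _).
have [modS modL] : (forall k, mod_ok (Lp_modulus p f k) k) /\
    (forall m k, mod_ok m k -> (Lp_modulus p f k <= m)%N).
  have S k : exists m, forall d, `|d| <= pow2n R m ->
      (Lpnorm p (fun t => (f t - tau d f t)%R) <= (pow2n R k)%:E)%E.
    by have [m /modP] := mod_ex k; exists m.
  split=> [k|m k /modP]; first by apply/modP; case: (least_spec (S k)).
  by case: (least_spec (S k)) => _; apply.
have ha1 := leqW ha; have hb1 := leqW hb; have hc1 := leqW hc; have hd1 := leqW hd.
have Fa k := Ha _ ha1 F mF pF J1 _ k (modS (k + D.+1)%N).
have [g0 Hg0] := Hc _ hc1 F mF pF _ _ (modS (n + D.+1)%N).
(* The Fourier rate is attained because the estimate behind (a) exhibits an admissible order. *)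
have [fourS fourL] : (forall k, (Jp p (fun t => (F t - fourier_partial
      (2 ^ Lp_fourierrate p f k)%N F t)%R) <= (pow2n R k `^ p)%:E)%E) /\
    (forall m k, (Jp p (fun t => (F t - fourier_partial (2 ^ m)%N F t)%R) <=
       (pow2n R k `^ p)%:E)%E -> (Lp_fourierrate p f k <= m)%N).
  have S k : exists m, (Lpnorm p (fun t => (f t - fourier_partial (2 ^ m)%N f t)%R) <=
      (pow2n R k)%:E)%E.
    by exists (Lp_modulus p f (k + D.+1) + k + D.+1)%N; apply/fourP; exact: Fa.
  split=> [k|m k /fourP]; first by apply/fourP; case: (least_spec (S k)).
  by case: (least_spec (S k)) => _; apply.
have stepE k : exists s g, is_step (2 ^ s)%N g /\
    (Lpnorm p (fun t => (f t - g t)%R) <= (pow2n R k)%:E)%E.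
  have [g [sg Jg]] := Hc _ hc1 F mF pF _ _ (modS (k + D.+1)%N).
  by exists (Lp_modulus p f (k + D.+1)), g; split => //; exact/(stepP _ _ _ sg).
split.
- exact: fourL.
- exact/modL/(Hb _ hb1 F mF pF J1)/fourS.
- have [_] := least_spec (stepE n); apply.
  by case: Hg0 => sg Jg; exists g0; split => //; exact/(stepP _ _ _ sg).
- have [[g [sg /(stepP _ _ _ sg) Jg]] _] := least_spec (stepE (n + D.+1)%N).
  have Jg' : (Jp p (fun t => (F t - g (modT t))%R) <= (pow2n R (n + D) `^ p)%:E)%E.
    apply: (le_trans Jg); rewrite lee_fin addnS -addn1 pow2n_powRD.
    rewrite ler_piMr ?powR_ge0// -[leRHS](powR1E p).
    by apply: (ge0_ler_powR (ltW p0)); rewrite ?nnegrE ?pow2n_le1.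
  (* The modulus estimate needs a natural exponent at least y; truncn y + 1 is one, and it is at
     most y + 1. *)
  pose y := (Lp_steprate p f (n + D.+1))%:R + p * n%:R + D%:R.
  have y0 : 0 <= y by rewrite !addr_ge0// mulr_ge0// ltW.
  have ym : y <= (Num.truncn y).+1%:R by exact/ltW/truncnS_gt.
  apply: (@le_trans _ _ (Num.truncn y).+1%:R).
    by rewrite ler_nat; apply: modL; exact: (Hd _ hd F mF pF J1 _ n _ g sg Jg' ym).
  rewrite -natr1 -[D.+1%:R]natr1 addrA lerD2r.
  by rewrite truncn_le.
Qed.
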